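(* Let $\mathcal M_a\subseteq\mathcal M_{\text{code}}$ and $\mathcal M_A\subseteq\mathcal M_{\text{CFT}}$ be (unital inclusions of) finite-dimensional von Neumann algebras and let $\mathcal J\colon S(\mathcal M_{\text{code}})\to S(\mathcal M_{\text{CFT}})$ be a quantum channel. Let $\mathcal R^*\colon\mathcal M_a\to\mathcal M_A$ be the map $$\mathcal R^*[\phi_a]=\int_{\mathbb R}dt\,\beta_0(t)\,e^{\frac{1-it}{2}H_A}\,\mathcal J\Bigl[\mathcal E_a\bigl[e^{-\frac{1-it}{2}H_a}\,\phi_a\,e^{-\frac{1+it}{2}H_a}\bigr]\Bigr]_A\,e^{\frac{1+it}{2}H_A},$$ with $\beta_0(t)=\frac{\pi}{2}(\cosh(\pi t)+1)^{-1}$, $H_a=-\log\sigma_a$, $H_A=-\log\mathcal J[\mathcal E_a[\sigma_a]]_A$, where the full-rank state $\sigma_a\in S(\mathcal M_a)$ is chosen to be the maximally mixed state, so that $\mathcal E_a[\sigma_a]=\tau_{\text{code}}:=1_{\text{code}}/d_{\text{code}}$ with $d_{\text{code}}:=\operatorname{tr}[1_{\text{code}}]$. Then for all $\phi_a\in\mathcal M_a$, $$\mathcal R^*[\phi_a]=\frac1{d_{\text{code}}}\int_{\mathbb R}dt\,\beta_0(t)\,e^{\frac{1-it}{2}H_A}\,\mathcal J[\phi_a]_A\,e^{\frac{1+it}{2}H_A}$$ with $H_A=-\log\mathcal J[\tau_{\text{code}}]_A$, and $$\mathcal R^*[\phi_a]=\frac1{d_{\text{code}}}\frac{d}{dt}\Big|_{t=0}\log\mathcal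 J[\tau_{\text{code}}+t\phi_a]_A=-\frac1{d_{\text{code}}}\frac{d}{dt}\Big|_{t=0}H_A[\tau_{\text{code}}+t\phi_a],$$ where $H_A[\rho]:=-\log\mathcal J[\rho]_A$.
   Context: A finite-dimensional von Neumann algebra is a unital ($*$-)subalgebra $\mathcal A\subseteq B(\mathcal H)$ of the linear operators on a finite-dimensional Hilbert space $\mathcal H$; $\operatorname{tr}$ is the trace on $\mathcal H$. Its states are $S(\mathcal A)=\mathcal A\cap S(\mathcal H)$, where $S(\mathcal H)$ is the set of density operators on $\mathcal H$. $\mathcal M_a$ and $\mathcal M_{\text{code}}$ act on the same Hilbert space, as do $\mathcal M_A$ and $\mathcal M_{\text{CFT}}$; $1_{\text{code}}$ is the identity of $\mathcal M_{\text{code}}$. A quantum channel is a completely positive trace-preserving map, understood as extended linearly to the whole algebra. For a unital subalgebra $\mathcal M_A\subseteq\mathcal M_{\text{CFT}}$ and $X\in\mathcal M_{\text{CFT}}$, $X_A$ denotes the restriction to $\mathcal M_A$: the unique element of $\mathcal M_A$ with $\operatorname{tr}X_A\phi=\operatorname{tr}X\phi$ for all $\phi\in\mathcal M_A$. The state extension map $\mathcal E_a$ is the inclusion $\mathcal M_a\subseteq\mathcal M_{\text{code}}$. All logarithms are natural. If $\mathcal J[\tau_{\text{code}}]_A$ is not full rank, the logarithms (including that of $\mathcal J[\tau_{\text{code}}+t\phi_a]_A$ for small $t$) and the powers $e^{zH_A}=(\mathcal J[\tau_{\text{code}}]_A)^{-z}$ are taken on the support of $\mathcal J[\tau_{\text{code}}]_A$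 and set to zero on its kernel. For non-Hermitian $\phi_a$ the logarithm near the positive operator $\mathcal J[\tau_{\text{code}}]_A$ is defined by the principal-branch holomorphic functional calculus. *)

(* Defs.v *)
From HB Require Import structures.
From mathcomp Require Import all_boot all_order all_algebra all_field.
From mathcomp Require Import complex.
From mathcomp Require Import all_classical all_reals all_analysis.
Set Implicit Arguments.
Unset Strict Implicit.
Unset Printing Implicit Defensive.
Import Order.TTheory GRing.Theory Num.Theory.
Import numFieldNormedType.Exports.
Local Open Scope classical_set_scope.
Local Open Scope ring_scope.
Local Open Scope complex_scope.
Local Open Scope sesquilinear_scope.

(* Operators on the Hilbert space C^(n+1) are matrices over R[i], with R an   *)
(* arbitrary model of the real numbers; [M ^t*] is the adjoint.               *)

Section ComplexFunctions.
Variable R : realType.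

Definition cexp (z : R[i]) : R[i] :=
  (expR (complex.Re z))%:C * (cos (complex.Im z) +i* sin (complex.Im z)).

(* principal logarithm: the argument is taken in ]-pi, pi]                     *)
Definition clog (z : R[i]) : R[i] :=
  let r := Num.sqrt (complex.Re z ^+ 2 + complex.Im z ^+ 2) in
  let a := acos (complex.Re z / r) in
  ln r +i* (if 0 <= complex.Im z then a else - a).

Definition cint (D : set R) (f : R -> R[i]) : R[i] :=
  Rintegral (@lebesgue_measure R) D (fun t => complex.Re (f t)) +i*
  Rintegral (@lebesgue_measure R) D (fun t => complex.Im (f t)).

Definition beta0 (t : R) : R :=
  pi / 2 * ((expR (pi * t) + expR (- (pi * t))) / 2 + 1)^-1.

End ComplexFunctions.

Section Operators.
Variables (R : realType) (n : nat).
Local Notation op := 'M[R[i]]_n.+1.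
Implicit Types (A P X rho : op) (z : R[i]).

(* Entrywise integral and derivative of an operator-valued function of a real *)
(* variable.                                                                  *)
Definition mxint (D : set R) (F : R -> op) : op :=
  \matrix_(i, j) cint D (fun t => F t i j).

Definition mxderivable (F : R -> op) (x : R) : Prop := forall i j,
  derivable (fun t => complex.Re (F t i j)) x 1 /\
  derivable (fun t => complex.Im (F t i j)) x 1.

Definition mxderive (F : R -> op) (x : R) : op := \matrix_(i, j)
  ('D_1 (fun t => complex.Re (F t i j)) x +i*
   'D_1 (fun t => complex.Im (F t i j)) x).

(* The order of R[i] forces the quadratic form to be real.                    *)
Definition psd k (X : 'M[R[i]]_k) : Prop :=
  forall v : 'cV[R[i]]_k, 0 <= (v ^t* *m X *m v) 0 0.

Definition is_vN (M : {aspace op}) : Prop :=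
  1 \in M /\ {in M, forall X, X ^t* \in M}.

Definition is_state (M : {vspace op}) (rho : op) : Prop :=
  [/\ rho \in M, psd rho & \tr rho = 1].

(* f(A) for normal A, through A = V^-1 diag(lambda) V                          *)
Definition specfun (f : R[i] -> R[i]) A : op :=
  invmx (spectralmx A) *m diag_mx (map_mx f (spectral_diag A))
    *m spectralmx A.

(* For rho positive: the projection onto its support, and the powers of rho   *)
(* on its support, extended by zero on its kernel.                            *)
Definition supp rho : op := specfun (fun x => (x != 0)%:R) rho.

Definition mxpow rho z : op :=
  specfun (fun x => if x == 0 then 0 else cexp (z * clog x)) rho.

(* e^(zH) with H = - log rho                                                  *)
Definition expH z rho : op := mxpow rho (- z).

(* Eigenvalues of P X P as an operator on the range of the projection P       *)
Definition eig_on P X z : Prop := exists v : 'cV[R[i]]_n.+1,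
  [/\ v != 0, P *m v = v & P *m X *m P *m v = z *: v].

(* (2 pi i)^-1 times the integral of Log z (z - X)^-1 dz over the circle      *)
(* |z - c| = r, the resolvent being that of P X P on the range of P: for      *)
(* z != 0 it is P (z - P X P)^-1 P, which vanishes on the kernel of P.        *)
Definition cauchy_log P X (c r : R) : op :=
  ((2 * pi)%:C * 'i%C)^-1 *:
  mxint `[0, 2 * pi] (fun th =>
    let e := cexp (th *i) in
    let z := c%:C + r%:C * e in
    (clog z * ('i%C * r%:C * e)) *:
      (P *m invmx (z%:M - P *m X *m P) *m P)).

(* The logarithm of P X P on the range of P, by holomorphic functional        *)
(* calculus; it is zero on the kernel of P. The contour is any circle around  *)
(* the spectrum that is centred on the positive half-line and avoids the cut; *)
(* such circles exist as soon as the spectrum is close to the positive reals, *)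
(* and the value does not depend on the choice.                               *)
Definition mxlog_on P X : op :=
  xget 0 [set L | exists c r : R,
    [/\ 0 < r < c, (forall z, eig_on P X z -> `|z - c%:C| < r%:C) &
        L = cauchy_log P X c r]].

(* Existence and uniqueness for *-subalgebras: the trace form is nondegenerate *)
(* on M.                                                                      *)
Definition restr (M : {vspace op}) X : op :=
  xget 0 [set Y | Y \in M /\
    {in M, forall phi, \tr (Y *m phi) = \tr (X *m phi)}].

Definition dimH : R[i] := \tr (1%:M : op).

Definition maxmixed : op := dimH^-1 *: 1%:M.

(* Subalgebras sit in the same matrix algebra, so that the inclusion          *)
(* M_a <= M_code does not change the matrix.                                  *)
Definition state_ext (X : op) : op := X.

End Operators.

Section Channels.
Variables (R : realType) (n m : nat).
Local Notation C := R[i].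
Implicit Type J : 'M[C]_n.+1 -> 'M[C]_m.+1.

(* Only the values of J on M matter. Complete positivity: the map induced by  *)
(* J on k x k block matrices with entries in M is positive, for every k.      *)
Record is_channel (M : {vspace 'M[C]_n.+1}) (N : {vspace 'M[C]_m.+1}) J
    : Prop := IsChannel {
  channel_in : {in M, forall X, J X \in N};
  channel_linear : forall a : C,
    {in M &, forall X Y, J (a *: X + Y) = a *: J X + J Y};
  channel_cp : forall (k : nat) (X : 'I_k -> 'I_k -> 'M[C]_n.+1),
    (forall i j, X i j \in M) ->
    psd (\mxblock_(i < k, j < k) X i j) ->
    psd (\mxblock_(i < k, j < k) J (X i j));
  channel_tp : {in M, forall X, \tr (J X) = \tr X} }.

(* The map R^*, for a reference state sigma on M_a                            *)
Definition Rstar (MA : {vspace 'M[C]_m.+1}) J (sigma phi : 'M[C]_n.+1)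
    : 'M[C]_m.+1 :=
  let rhoA := restr MA (J (state_ext sigma)) in
  mxint setT (fun t : R =>
    let w : C := (1 - 'i%C * t%:C) / 2 in
    let w' : C := (1 + 'i%C * t%:C) / 2 in
    (beta0 t)%:C *:
      (expH w rhoA *m
       restr MA (J (state_ext (expH (- w) sigma *m phi *m expH (- w') sigma)))
       *m expH w' rhoA)).

(* log J[rho]_A and H_A[rho] = - log J[rho]_A, on the support of J[tau]_A     *)
Definition logJ (MA : {vspace 'M[C]_m.+1}) J (rho : 'M[C]_n.+1)
    : 'M[C]_m.+1 :=
  mxlog_on (supp (restr MA (J (maxmixed R n)))) (restr MA (J rho)).

Definition HA (MA : {vspace 'M[C]_m.+1}) J (rho : 'M[C]_n.+1)
    : 'M[C]_m.+1 := - logJ MA J rho.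

End Channels.

(* Main.v *)
(** Writing tau for the maximally mixed state, the powers of sigma are scalars
    whose exponents add up to one, which gives the first formula.  The second
    one compares matrix entries in an eigenbasis of rho = J[tau]_A, with
    eigenvalues x_i.  Expanding the resolvent to second order under the contour
    integral that defines the logarithm, the derivative of log multiplies the
    (i, j) entry of J[phi]_A by the contour integral of
    log z / ((z - x_i) (z - x_j)), which is the divided difference of log at
    x_i and x_j.  The twirled powers multiply the same entry by
    (x_i x_j)^(-1/2) times the Fourier transform of beta0 at
    b = (log x_i - log x_j) / 2, and the two factors agree because this
    transform is b / sinh b.

    The Fourier transform F is found without residues.  Shifting the line of
    integration by half the distance to the poles of beta0 gives
    cosh (b / 2) F(b) = F(b / 2), so F(b) sinh b / b is invariant under halving
    b, and it tends to 1 at 0.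

    Cauchy's theorem for circles, used both for the independence of the contour
    and for the divided differences, is obtained by differentiating under the
    integral sign along a family of circles: the derivative is exact. *)

Require Import Defs.
From HB Require Import structures.
From mathcomp Require Import all_boot all_order all_algebra all_field.
From mathcomp Require Import complex.
From mathcomp Require Import all_classical all_reals all_analysis measurable_realfun.
From mathcomp Require Import ring lra.
Import Order.TTheory GRing.Theory Num.Theory.
Import numFieldNormedType.Exports.
Local Open Scope classical_set_scope.
Local Open Scope ring_scope.
Local Open Scope complex_scope.

Set Implicit Arguments.
Unset Strict Implicit.
Unset Printing Implicit Defensive.

Local Notation Re := complex.Re.
Local Notation Im := complex.Im.

(** * Curves in the complex plane *)

Section ComplexCurves.
Variable R : realType.
Local Notation C := R[i].

(** The logarithm and the restriction are both picked by a choice operator, so their values must be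
    shown independent of the choice. The direction of differentiation need not be Hermitian, so the
    perturbed operator need not be diagonalisable; its spectrum and resolvent are controlled by
    diagonal dominance in the eigenbasis of rho. One circle then serves for all small t, with the
    nonzero eigenvalues inside and 0 outside, and the compression to the support removes the kernel.

    The Fourier transform carries a phase, cos (b t + phi), which keeps the argument real and covers
    the real and imaginary parts together. Half the distance to the poles is the right shift because
    there the mean of the two shifted kernels is cos (b t + phi) / cosh^2 (pi t), and 1 + cosh (2 x)
    = 2 cosh^2 x turns this, after halving t, into the unshifted kernel at frequency b / 2. *)

Lemma cReD (z w : C) : Re (z + w) = Re z + Re w. Proof. by case: z; case: w. Qed.
Lemma cImD (z w : C) : Im (z + w) = Im z + Im w. Proof. by case: z; case: w. Qed.
Lemma cReN (z : C) : Re (- z) = - Re z. Proof. by case: z. Qed.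
Lemma cImN (z : C) : Im (- z) = - Im z. Proof. by case: z. Qed.
Lemma cReM (z w : C) : Re (z * w) = Re z * Re w - Im z * Im w.
Proof. by case: z; case: w. Qed.
Lemma cImM (z w : C) : Im (z * w) = Re z * Im w + Im z * Re w.
Proof. by case: z; case: w => a b c d /=. Qed.
Lemma cReV (z : C) : Re z^-1 = Re z / (Re z ^+ 2 + Im z ^+ 2).
Proof. by case: z. Qed.
Lemma cImV (z : C) : Im z^-1 = - Im z / (Re z ^+ 2 + Im z ^+ 2).
Proof. by case: z => a b /=; rewrite mulNr. Qed.

Lemma complexP (z w : C) : Re z = Re w -> Im z = Im w -> z = w.
Proof. by case: z; case: w => a b c d /= -> ->. Qed.

Lemma sqr_norm_gt0 (z : C) : z != 0 -> 0 < Re z ^+ 2 + Im z ^+ 2.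
Proof.
move=> z0; rewrite lt_def addr_ge0 ?sqr_ge0// andbT.
rewrite paddr_eq0 ?sqr_ge0// !sqrf_eq0; apply: contra z0 => /andP[/eqP a /eqP b].
by apply/eqP/complexP.
Qed.

Lemma is_derive_mul (f g : R -> R) (x a b : R) :
  is_derive x (1 : R) f a -> is_derive x (1 : R) g b ->
  is_derive x (1 : R) (fun t => f t * g t) (f x * b + a * g x).
Proof.
move=> fa gb; have := is_deriveM fa gb.
by rewrite /GRing.scale /= (mulrC a).
Qed.

Lemma is_derive_inv (f : R -> R) (x a : R) : f x != 0 ->
  is_derive x (1 : R) f a -> is_derive x (1 : R) (fun t => (f t)^-1) (- a / f x ^+ 2).
Proof.
move=> f0 fa; apply: is_derive_eq (is_deriveV f0 fa) _.
by rewrite /GRing.scale /= mulNr mulrC mulNr.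
Qed.

Lemma is_derive_continuous (f : R -> R) (x a : R) :
  is_derive x (1 : R) f a -> {for x, continuous f}.
Proof. by move=> fa; apply/differentiable_continuous/derivable1_diffP; case: fa. Qed.

Definition cderive (f : R -> C) (x : R) (d : C) : Prop :=
  is_derive x (1 : R) (fun t => Re (f t)) (Re d) /\
  is_derive x (1 : R) (fun t => Im (f t)) (Im d).

Lemma cderive_eq f x d d' : cderive f x d -> d = d' -> cderive f x d'.
Proof. by move=> ? <-. Qed.

Lemma cderive_ext f g x d : cderive f x d -> f =1 g -> cderive g x d.
Proof. by move=> ? /funext <-. Qed.

Lemma cderive_cst (c : C) x : cderive (fun=> c) x 0.
Proof. by split; exact: is_derive_cst. Qed.

Lemma cderive_real (f : R -> R) x a :
  is_derive x (1 : R) f a -> cderive (fun t => (f t)%:C) x a%:C.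
Proof. by move=> fa; split => //=; exact: is_derive_cst. Qed.

Lemma cderiveD f g x a b :
  cderive f x a -> cderive g x b -> cderive (fun t => f t + g t) x (a + b).
Proof.
move=> [fa fa'] [gb gb']; split.
- by under eq_fun do rewrite cReD; rewrite cReD; exact: is_deriveD.
- by under eq_fun do rewrite cImD; rewrite cImD; exact: is_deriveD.
Qed.

Lemma cderiveM f g x a b :
  cderive f x a -> cderive g x b ->
  cderive (fun t => f t * g t) x (f x * b + a * g x).
Proof.
move=> [fa fa'] [gb gb']; split.
- under eq_fun do rewrite cReM.
  apply: is_derive_eq (is_deriveB (is_derive_mul fa gb) (is_derive_mul fa' gb')) _.
  by rewrite cReD !cReM; ring.
- under eq_fun do rewrite cImM.
  apply: is_derive_eq (is_deriveD (is_derive_mul fa gb') (is_derive_mul fa' gb)) _.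
  by rewrite cImD !cImM; ring.
Qed.

Lemma cderiveZ f x a c : cderive f x a -> cderive (fun t => c * f t) x (c * a).
Proof.
move=> fa; apply: cderive_eq (cderiveM (cderive_cst c x) fa) _.
by rewrite mul0r addr0.
Qed.

Lemma cderiveV f x a : f x != 0 -> cderive f x a ->
  cderive (fun t => (f t)^-1) x (- a / f x ^+ 2).
Proof.
move=> f0 [fa fa'].
have n0 := lt0r_neq0 (sqr_norm_gt0 f0).
pose N t := Re (f t) ^+ 2 + Im (f t) ^+ 2.
have dN : is_derive x (1 : R) N (2 * (Re (f x) * Re a + Im (f x) * Im a)).
  have -> : N = fun t => Re (f t) * Re (f t) + Im (f t) * Im (f t).
    by apply/funext => t; rewrite /N !expr2.
  apply: is_derive_eq (is_deriveD (is_derive_mul fa fa) (is_derive_mul fa' fa')) _.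
  by ring.
have H := is_derive_inv (n0 : N x != 0) dN.
have -> : - a / f x ^+ 2 = - a * ((f x)^-1 * (f x)^-1) by rewrite -expr2 exprVn.
split.
- under eq_fun do rewrite cReV.
  apply: is_derive_eq (is_derive_mul fa H) _.
  by rewrite !(cReM, cImM, cReN, cImN, cReV, cImV) /N /=; field.
- under eq_fun do rewrite cImV.
  have nfa' : is_derive x (1 : R) (fun t => - Im (f t)) (- Im a) by exact: is_deriveN.
  apply: is_derive_eq (is_derive_mul nfa' H) _.
  by rewrite !(cReM, cImM, cReN, cImN, cReV, cImV) /N /=; field.
Qed.

Lemma cexp_i (x : R) : cexp (x *i) = cos x +i* sin x.
Proof.
apply: complexP; rewrite /cexp /=.
  by rewrite expR0 mul1r mul0r subr0.
by rewrite expR0 mul1r mul0r addr0.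
Qed.

Lemma cderive_cexp_i x : cderive (fun t => cexp (t *i)) x ('i%C * cexp (x *i)).
Proof.
rewrite cexp_i; split.
- under eq_fun do rewrite cexp_i /=.
  by apply: is_derive_eq (is_derive_cos x) _; rewrite /= mul0r mul1r sub0r.
- under eq_fun do rewrite cexp_i /=.
  by apply: is_derive_eq (is_derive_sin x) _; rewrite /= mul0r mul1r add0r.
Qed.

(** On the right half-plane the signed [acos] of [clog] is a single [atan], which is smooth. Circles
    with [0 < r < c] stay in this half-plane. *)
Lemma clogE (z : C) : 0 < Re z ->
  clog z = (ln (Re z ^+ 2 + Im z ^+ 2) / 2) +i* atan (Im z / Re z).
Proof.
case: z => x y /= x0; rewrite /clog /=.
set N := x ^+ 2 + y ^+ 2.
have N0 : 0 < N by rewrite /N ltr_pwDl ?sqr_ge0 ?exprn_gt0.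
have r0 : 0 < Num.sqrt N by rewrite sqrtr_gt0.
apply: complexP => /=.
  rewrite -[in RHS](sqr_sqrtr (ltW N0)) expr2 lnM ?posrE//; lra.
have -> : x / Num.sqrt N = cos (atan (y / x)).
  rewrite cos_atan.
  have -> : 1 + (y / x) ^+ 2 = N / x ^+ 2 by rewrite /N; field; exact: lt0r_neq0.
  rewrite sqrtrM ?(ltW N0)// sqrtrV ?sqr_ge0// sqrtr_sqr gtr0_norm//.
  by rewrite invfM invrK mulrC.
have pi2 : - pi < - (pi / 2) :> R by have := pi_gt0 R; lra.
have := atan_gtNpi2 (y / x); have := atan_ltpi2 (y / x).
have pi0 := pi_gt0 R.
case: ifPn => y0 ha hb.
- rewrite cosK// in_itv/=; apply/andP; split; last lra.
  by rewrite -atan0 le_atan// divr_ge0 // ltW.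
- rewrite cosKN ?opprK//; apply/andP; split; first lra.
  by rewrite -atan0 le_atan// mulr_le0_ge0 ?invr_ge0 ?ltW// ltNge.
Qed.

Lemma clog_real (x : R) : 0 < x -> clog x%:C = (ln x)%:C.
Proof.
move=> x0; rewrite clogE//= expr0n addr0 lnXn// mulr2n.
by apply: complexP; rewrite /= ?mul0r ?atan0//; lra.
Qed.

(** The whole curve is kept in the half-plane because [clog] is replaced by its [atan] form under
    the binder. For this reason families of circles are later parametrised so as to be admissible at
    every real parameter. *)
Lemma cderive_clog f x a : (forall t, 0 < Re (f t)) ->
  cderive f x a -> cderive (fun t => clog (f t)) x (a / f x).
Proof.
move=> f0 [fa fa'].
have x0 := f0 x; have x0' := lt0r_neq0 x0.
pose N t := Re (f t) ^+ 2 + Im (f t) ^+ 2.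
have N0 : 0 < N x by rewrite /N ltr_pwDl ?sqr_ge0 ?exprn_gt0.
have N0' := lt0r_neq0 N0.
have dN : is_derive x (1 : R) N (2 * (Re (f x) * Re a + Im (f x) * Im a)).
  have -> : N = fun t => Re (f t) * Re (f t) + Im (f t) * Im (f t).
    by apply/funext => t; rewrite /N !expr2.
  apply: is_derive_eq (is_deriveD (is_derive_mul fa fa) (is_derive_mul fa' fa')) _.
  by ring.
split.
- under eq_fun => t do rewrite clogE//=.
  have := is_derive_mul (is_derive1_comp (is_derive1_ln N0) dN) (is_derive_cst (2^-1 : R) x 1).
  move=> /is_derive_eq; apply.
  by rewrite !(cReM, cImM, cReN, cImN, cReV, cImV) -/(N x) /=; field.
- under eq_fun => t do rewrite clogE//=.
  have dq := is_derive_mul fa' (is_derive_inv x0' fa).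
  have := @is_derive1_comp _ (@atan R) (fun t => Im (f t) / Re (f t)) _ _ _
    (is_derive1_atan _) dq.
  move=> /is_derive_eq; apply.
  rewrite !(cReM, cImM, cReN, cImN, cReV, cImV) -/(N x) /=.
  have -> : 1 + (Im (f x) / Re (f x)) ^+ 2 = N x / Re (f x) ^+ 2 by rewrite /N; field.
  by field; rewrite N0' x0'.
Qed.


Definition ccontinuous_at (T : topologicalType) (f : T -> C) (p : T) : Prop :=
  {for p, continuous (fun t => Re (f t))} /\
  {for p, continuous (fun t => Im (f t))}.

Lemma cderive_continuous f x a : cderive f x a -> ccontinuous_at f x.
Proof. by move=> [/is_derive_continuous ? /is_derive_continuous ?]. Qed.

Section Continuity.
Variable T : topologicalType.
Implicit Types (f g : T -> C) (p : T).

Lemma continuous_at_ext (f g : T -> R) p :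
  f =1 g -> {for p, continuous g} -> {for p, continuous f}.
Proof. by move=> /funext ->. Qed.

Lemma ccontinuous_cst (c : C) p : ccontinuous_at (fun=> c) p.
Proof. by split; exact: cvg_cst. Qed.

Lemma ccontinuous_real (f : T -> R) p :
  {for p, continuous f} -> ccontinuous_at (fun t => (f t)%:C) p.
Proof. by split => //; exact: cvg_cst. Qed.

Lemma ccontinuousD f g p : ccontinuous_at f p -> ccontinuous_at g p ->
  ccontinuous_at (fun t => f t + g t) p.
Proof.
move=> [? ?] [? ?]; split.
- by apply: (continuous_at_ext (fun=> cReD _ _)); exact: cvgD.
- by apply: (continuous_at_ext (fun=> cImD _ _)); exact: cvgD.
Qed.

Lemma ccontinuousM f g p : ccontinuous_at f p -> ccontinuous_at g p ->
  ccontinuous_at (fun t => f t * g t) p.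
Proof.
move=> [? ?] [? ?]; split.
- by apply: (continuous_at_ext (fun=> cReM _ _)); apply: cvgB; apply: cvgM.
- by apply: (continuous_at_ext (fun=> cImM _ _)); apply: cvgD; apply: cvgM.
Qed.

Lemma ccontinuousV f p : f p != 0 -> ccontinuous_at f p ->
  ccontinuous_at (fun t => (f t)^-1) p.
Proof.
move=> f0 [cr ci]; have n0 := lt0r_neq0 (sqr_norm_gt0 f0).
have cN : {for p, continuous (fun t => (Re (f t) ^+ 2 + Im (f t) ^+ 2)^-1)}.
  apply: cvgV => //; apply: cvgD.
  - by apply: (continuous_at_ext (fun=> expr2 _)); exact: cvgM.
  - by apply: (continuous_at_ext (fun=> expr2 _)); exact: cvgM.
split.
- by apply: (continuous_at_ext (fun=> cReV _)); exact: cvgM.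
- by apply: (continuous_at_ext (fun=> cImV _)); apply: cvgM => //; exact: cvgN.
Qed.

Lemma ccontinuous_clog f p : (forall t, 0 < Re (f t)) ->
  ccontinuous_at f p -> ccontinuous_at (fun t => clog (f t)) p.
Proof.
move=> f0 [cr ci]; have x0 := f0 p; have x0' := lt0r_neq0 x0.
have N0 : 0 < Re (f p) ^+ 2 + Im (f p) ^+ 2.
  by rewrite ltr_pwDl ?sqr_ge0 ?exprn_gt0.
split.
- apply: (@continuous_at_ext _ (fun t => ln (Re (f t) ^+ 2 + Im (f t) ^+ 2) / 2)).
    by move=> t; rewrite clogE.
  apply: cvgM; last exact: cvg_cst.
  apply: (@continuous_comp _ _ _ (fun t => Re (f t) ^+ 2 + Im (f t) ^+ 2) (@ln R)).
    apply: cvgD.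
    - by apply: (continuous_at_ext (fun=> expr2 _)); exact: cvgM.
    - by apply: (continuous_at_ext (fun=> expr2 _)); exact: cvgM.
  exact: is_derive_continuous (is_derive1_ln N0).
- apply: (@continuous_at_ext _ (fun t => atan (Im (f t) / Re (f t)))).
    by move=> t; rewrite clogE.
  apply: (@continuous_comp _ _ _ (fun t => Im (f t) / Re (f t)) (@atan R)).
    by apply: cvgM => //; exact: cvgV.
  exact: continuous_atan.
Qed.

Lemma ccontinuous_cexp_i (h : T -> R) p : {for p, continuous h} ->
  ccontinuous_at (fun t => cexp ((h t) *i)) p.
Proof.
move=> ch; split.
- apply: (@continuous_at_ext _ (fun t => cos (h t))) => [t|]; first by rewrite cexp_i.
  by apply: (@continuous_comp _ _ _ h) => //; exact: continuous_cos.
- apply: (@continuous_at_ext _ (fun t => sin (h t))) => [t|]; first by rewrite cexp_i.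
  by apply: (@continuous_comp _ _ _ h) => //; exact: continuous_sin.
Qed.

End Continuity.

Lemma ccontinuous_comp (T U : topologicalType) (f : U -> C) (h : T -> U) p :
  ccontinuous_at f (h p) -> {for p, continuous h} ->
  ccontinuous_at (fun t => f (h t)) p.
Proof.
move=> [fr fi] ch; split.
- exact: (@continuous_comp _ _ _ h (fun t => Re (f t))).
- exact: (@continuous_comp _ _ _ h (fun t => Im (f t))).
Qed.

Local Notation mu := (@lebesgue_measure R).

Definition cintegrable (D : set R) (f : R -> C) : Prop :=
  mu.-integrable D (EFin \o (fun t => Re (f t))) /\
  mu.-integrable D (EFin \o (fun t => Im (f t))).

Lemma eq_cint (D : set R) (f g : R -> C) : {in D, f =1 g} -> cint D f = cint D g.
Proof.
by move=> fg; congr (_ +i* _); apply: eq_Rintegral => x xD; rewrite fg.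
Qed.

Section Integral.
Variables (D : set R) (mD : measurable (D : set (measurableTypeR R))).

Lemma integrable_lin (f g : R -> R) (a b : R) :
  mu.-integrable D (EFin \o f) -> mu.-integrable D (EFin \o g) ->
  mu.-integrable D (EFin \o (fun t => a * f t + b * g t)) /\
  Rintegral mu D (fun t => a * f t + b * g t) =
  a * Rintegral mu D f + b * Rintegral mu D g.
Proof.
move=> fi gi.
have fi' : mu.-integrable D (EFin \o (fun t => a * f t)).
  rewrite [X in integrable _ _ X](_ : _ = fun t => a%:E * (EFin \o f) t)%E//.
  exact: integrableZl.
have gi' : mu.-integrable D (EFin \o (fun t => b * g t)).
  rewrite [X in integrable _ _ X](_ : _ = fun t => b%:E * (EFin \o g) t)%E//.
  exact: integrableZl.
split; last by rewrite RintegralD// !RintegralZl.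
by have := integrableD mD fi' gi'; apply: eq_integrable.
Qed.

Lemma cint_lin (f : R -> C) (c : C) : cintegrable D f ->
  cintegrable D (fun t => c * f t) /\ cint D (fun t => c * f t) = c * cint D f.
Proof.
move=> [fr fi].
have [rI rE] := integrable_lin (Re c) (- Im c) fr fi.
have [iI iE] := integrable_lin (Re c) (Im c) fi fr.
have eR : (fun t => Re (c * f t)) = (fun t => Re c * Re (f t) + - Im c * Im (f t)).
  by apply/funext => t; rewrite cReM mulNr.
have eI : (fun t => Im (c * f t)) = (fun t => Re c * Im (f t) + Im c * Re (f t)).
  by apply/funext => t; rewrite cImM.
split; first by split; rewrite ?eR ?eI.
by apply: complexP; rewrite /cint /= ?eR ?eI ?rE ?iE ?cReM ?cImM//= mulNr.
Qed.

Lemma cintegrableZ (f : R -> C) (c : C) : cintegrable D f -> cintegrable D (fun t => c * f t).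
Proof. by move=> /(cint_lin c)[]. Qed.

Lemma cintZ (f : R -> C) (c : C) : cintegrable D f -> cint D (fun t => c * f t) = c * cint D f.
Proof. by move=> /(cint_lin c)[]. Qed.

Lemma cintegrable0 : cintegrable D (fun=> 0).
Proof. by split; exact: integrable0. Qed.

Lemma cint0 : cint D (fun=> 0) = 0.
Proof. by apply: complexP; rewrite /cint /Rintegral /= integral0. Qed.

Lemma cintegrableD (f g : R -> C) : cintegrable D f -> cintegrable D g ->
  cintegrable D (fun t => f t + g t).
Proof.
move=> [fr fi] [gr gi]; split.
- rewrite [X in integrable _ _ X](_ : _ =
    (fun t => (EFin \o (fun t => Re (f t))) t + (EFin \o (fun t => Re (g t))) t)%E).
    exact: integrableD.
  by apply/funext => t /=; rewrite cReD.
- rewrite [X in integrable _ _ X](_ : _ =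
    (fun t => (EFin \o (fun t => Im (f t))) t + (EFin \o (fun t => Im (g t))) t)%E).
    exact: integrableD.
  by apply/funext => t /=; rewrite cImD.
Qed.

Lemma cintD (f g : R -> C) : cintegrable D f -> cintegrable D g ->
  cint D (fun t => f t + g t) = cint D f + cint D g.
Proof.
move=> [fr fi] [gr gi]; apply: complexP; rewrite /cint ?cReD ?cImD /=.
- by under eq_Rintegral do rewrite cReD; rewrite RintegralD.
- by under eq_Rintegral do rewrite cImD; rewrite RintegralD.
Qed.

Lemma cintegrable_sum (I : Type) (s : seq I) (F : I -> R -> C) :
  (forall i, cintegrable D (F i)) -> cintegrable D (fun t => \sum_(i <- s) F i t).
Proof.
move=> FI; elim: s => [|i s IH].
  by under eq_fun do rewrite big_nil; exact: cintegrable0.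
by under eq_fun do rewrite big_cons; exact: cintegrableD.
Qed.

Lemma cint_sum (I : Type) (s : seq I) (F : I -> R -> C) :
  (forall i, cintegrable D (F i)) ->
  cint D (fun t => \sum_(i <- s) F i t) = \sum_(i <- s) cint D (F i).
Proof.
move=> FI; elim: s => [|i s IH].
  by under eq_fun do rewrite big_nil; rewrite cint0 big_nil.
under eq_fun do rewrite big_cons.
by rewrite cintD ?IH ?big_cons//; exact: cintegrable_sum.
Qed.

End Integral.


End ComplexCurves.

(** * Integrals depending on a parameter, and families of circles *)

Section CircleIntegrals.
Variable R : realType.
Local Notation C := R[i].
Local Notation mu := (@lebesgue_measure R).

Lemma continuous_integrable (a b : R) (f : R -> R) : continuous f ->
  mu.-integrable `[a, b] (EFin \o f).
Proof.
move=> cf; apply: continuous_compact_integrable; first exact: segment_compact.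
exact: continuous_subspaceT.
Qed.

(** Over a compact segment continuity provides the domination: [f'] is bounded by a constant on the
    rectangle [[s - 1, s + 1]] times [[a, b]]. *)
Lemma is_derive_Rintegral (a b : R) (f f' : R -> R -> R) :
  (forall s u, is_derive s (1 : R) (f^~ u) (f' s u)) ->
  continuous (fun p : R * R => f' p.1 p.2) ->
  (forall s, continuous (f s)) ->
  forall s, is_derive s (1 : R) (fun s => Rintegral mu `[a, b] (f s))
    (Rintegral mu `[a, b] (f' s)).
Proof.
move=> df cf' cf s.
have [M HM] : exists M : R, forall x y, x \in `[s - 1, s + 1] -> y \in `[a, b] ->
    `|f' x y| <= M.
  have cK : compact (`[s - 1, s + 1]%classic `*` `[a, b]%classic : set (R * R)).
    by apply: compact_setX; exact: segment_compact.
  have := continuous_compact (continuous_subspaceT cf') cK.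
  move=> /compact_bounded [M [_ HM]]; exists (M + 1) => x y xs yab.
  apply: (HM (M + 1)); first by rewrite ltrDl.
  by exists (x, y).
have sI : s \in `]s - 1, s + 1[ by rewrite in_itv/= ltrBlDr ltrDl ltr01.
have M0 (x y : R) : x \in `[s - 1, s + 1] -> y \in `[a, b] -> 0 <= M.
  by move=> xs ys; apply: le_trans (HM _ _ xs ys).
have d1E x u : partial1of2 f x u = f' x u.
  by rewrite partial1of2E; case: (df x u).
have intf (x : R) : `]s - 1, s + 1[%classic x -> mu.-integrable `[a, b] (EFin \o f x).
  by move=> _; exact: continuous_integrable.
have derf (x y : R) : `]s - 1, s + 1[%classic x -> `[a, b]%classic y -> derivable (f^~ y) x 1.
  by move=> _ _; case: (df x y).
(* The maximum with 0 makes the dominating constant nonnegative even if [[a, b]] is empty. *)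
have intG : mu.-integrable `[a, b] (EFin \o (cst (Num.max M 0) : R -> R)).
  by apply: continuous_integrable => x; exact: cvg_cst.
have G0 (y : R) : 0 <= (cst (Num.max M 0) : R -> R) y by rewrite /= le_max lexx orbT.
have Gub (x y : R) : `]s - 1, s + 1[%classic x -> `[a, b]%classic y ->
    `|partial1of2 f x y| <= (cst (Num.max M 0) : R -> R) y.
  move=> xs ys; rewrite d1E /= le_max HM//.
  exact: subset_itv_oo_cc.
have mab : measurable (`[a, b]%classic : set (measurableTypeR R)) by exact: measurable_itv.
have sI' : `]s - 1, s + 1[%classic s by [].
split; first exact: (derivable_under_integral mab sI' intf derf G0 intG Gub).
have := differentiation_under_integral mab sI' intf derf G0 intG Gub.
rewrite derive1E => ->; apply: eq_Rintegral => u _.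
by rewrite d1E.
Qed.

Lemma Rintegral_derive (a b : R) (F f : R -> R) : a < b ->
  (forall x, is_derive x (1 : R) F (f x)) -> continuous f ->
  Rintegral mu `[a, b] f = F b - F a.
Proof.
move=> ab dF cf.
rewrite /Rintegral (@continuous_FTC2 _ f F)//.
- exact: continuous_subspaceT.
- split.
  + by move=> x _; case: (dF x).
  + exact/cvg_at_right_filter/(is_derive_continuous (dF a)).
  + exact/cvg_at_left_filter/(is_derive_continuous (dF b)).
- by move=> x _; rewrite derive1E; case: (dF x).
Qed.

Lemma cintegrable_continuous (a b : R) (f : R -> C) :
  (forall x, ccontinuous_at f x) -> cintegrable `[a, b] f.
Proof.
by move=> cf; split; apply: continuous_integrable => x; have [] := cf x.
Qed.

Lemma cint_derive (a b : R) (F f : R -> C) : a < b ->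
  (forall x, cderive F x (f x)) -> (forall x, ccontinuous_at f x) ->
  cint `[a, b] f = F b - F a.
Proof.
move=> ab dF cf; apply: complexP; rewrite /cint /= ?cReD ?cImD ?cReN ?cImN.
- apply: (@Rintegral_derive a b (fun t => Re (F t)) (fun t => Re (f t)) ab) => x.
    by have [] := dF x.
  by have [] := cf x.
- apply: (@Rintegral_derive a b (fun t => Im (F t)) (fun t => Im (f t)) ab) => x.
    by have [] := dF x.
  by have [] := cf x.
Qed.

Lemma cderive_cint (a b : R) (f f' : R -> R -> C) :
  (forall s u, cderive (f^~ u) s (f' s u)) ->
  (forall p : R * R, ccontinuous_at (fun p : R * R => f' p.1 p.2) p) ->
  (forall s u, ccontinuous_at (f s) u) ->
  forall s, cderive (fun s => cint `[a, b] (f s)) s (cint `[a, b] (f' s)).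
Proof.
move=> df cf' cf s; split => /=.
- apply: (@is_derive_Rintegral a b (fun s u => Re (f s u)) (fun s u => Re (f' s u))).
  + by move=> x u; have [] := df x u.
  + by move=> p; have [] := cf' p.
  + by move=> x u; have [] := cf x u.
- apply: (@is_derive_Rintegral a b (fun s u => Im (f s u)) (fun s u => Im (f' s u))).
  + by move=> x u; have [] := df x u.
  + by move=> p; have [] := cf' p.
  + by move=> x u; have [] := cf x u.
Qed.

Lemma cderive0_cst (f : R -> C) x y : (forall s, cderive f s 0) -> f x = f y.
Proof.
move=> df; apply: complexP.
- by apply: (@is_derive_0_is_cst _ (fun t => Re (f t))) => s; have [] := df s.
- by apply: (@is_derive_0_is_cst _ (fun t => Im (f t))) => s; have [] := df s.
Qed.

(* Each [f' s] is exact along a closed curve, hence integrates to zero. *)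
Lemma cint_family_cst (a b : R) (f f' W : R -> R -> C) : a < b ->
  (forall s u, cderive (f^~ u) s (f' s u)) ->
  (forall p : R * R, ccontinuous_at (fun p : R * R => f' p.1 p.2) p) ->
  (forall s u, ccontinuous_at (f s) u) ->
  (forall s u, cderive (W s) u (f' s u)) ->
  (forall s, W s a = W s b) ->
  forall s t, cint `[a, b] (f s) = cint `[a, b] (f t).
Proof.
move=> ab df cf' cf dW Wab s t.
apply: (@cderive0_cst (fun s => cint `[a, b] (f s))) => x.
apply: cderive_eq (cderive_cint a b df cf' cf x) _.
rewrite (cint_derive ab (dW x)) ?Wab ?subrr// => u.
apply: (@ccontinuous_comp _ _ _ (fun p : R * R => f' p.1 p.2) (fun u => (x, u))) => //.
by apply: (@cvg_pair _ _ _ (nbhs u) (nbhs x) (nbhs u) _ _ _ (fun=> x) id);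
  [exact: cvg_cst|exact: cvg_id].
Qed.

Definition circ (c r u : R) : C := c%:C + r%:C * cexp (u *i).
Definition circ' (r u : R) : C := 'i%C * r%:C * cexp (u *i).

(* [g] is continuous on [U] and complex differentiable there with continuous  *)
(* derivative [g'], tested along curves and through compositions.             *)
Definition holomorphic_on (U : set C) (g g' : C -> C) : Prop :=
  [/\ forall (f : R -> C) x a, (forall t, U (f t)) -> cderive f x a ->
        cderive (fun t => g (f t)) x (g' (f x) * a),
      forall (T : topologicalType) (f : T -> C) p, (forall t, U (f t)) ->
        ccontinuous_at f p -> ccontinuous_at (fun t => g (f t)) p &
      forall (T : topologicalType) (f : T -> C) p, (forall t, U (f t)) ->
        ccontinuous_at f p -> ccontinuous_at (fun t => g' (f t)) p].

(** Let z(s, u) be the moving point and z_s, z_u its partial derivatives. The s-derivative of g(z)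
    z_u and the u-derivative of g(z) z_s are both g'(z) z_s z_u + g(z) z_su, so g(z) z_s, where z_s
    is [w s u], is the primitive along the closed curve. *)
Lemma cint_circ_cst (U : set C) (g g' : C -> C) (c r c' r' : R -> R) :
  holomorphic_on U g g' ->
  (forall s, is_derive s (1 : R) c (c' s)) -> (forall s, is_derive s (1 : R) r (r' s)) ->
  continuous c' -> continuous r' ->
  (forall s u, U (circ (c s) (r s) u)) ->
  forall s t, cint `[0, 2 * pi] (fun u => g (circ (c s) (r s) u) * circ' (r s) u)
    = cint `[0, 2 * pi] (fun u => g (circ (c t) (r t) u) * circ' (r t) u).
Proof.
move=> [dg cg cg'] dc dr cc' cr' UU.
pose e (u : R) : C := cexp (u *i).
have de u : cderive e u ('i%C * e u) by exact: cderive_cexp_i.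
pose w s u : C := (c' s)%:C + (r' s)%:C * e u.
have dcs s u : cderive (fun s => circ (c s) (r s) u) s (w s u).
  apply: cderive_eq (cderiveD (cderive_real (dc s))
    (cderiveM (cderive_real (dr s)) (cderive_cst (e u) s))) _.
  by rewrite mulr0 add0r.
have dcu s u : cderive (circ (c s) (r s)) u (circ' (r s) u).
  apply: cderive_eq (cderiveD (cderive_cst _ u) (cderiveZ (r s)%:C (de u))) _.
  by rewrite add0r /circ' mulrCA mulrA.
have dc's s u : cderive (fun s => circ' (r s) u) s ('i%C * (r' s)%:C * e u).
  apply: cderive_eq (cderiveM (cderiveZ 'i%C (cderive_real (dr s))) (cderive_cst (e u) s)) _.
  by rewrite mulr0 add0r.
have dwu s u : cderive (w s) u ('i%C * (r' s)%:C * e u).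
  apply: cderive_eq (cderiveD (cderive_cst _ u) (cderiveZ (r' s)%:C (de u))) _.
  by rewrite add0r mulrCA mulrA.
pose f' s u := g (circ (c s) (r s) u) * ('i%C * (r' s)%:C * e u)
  + (g' (circ (c s) (r s) u) * w s u) * circ' (r s) u.
have cfst (h : R -> R) (p : R * R) : continuous h ->
    ccontinuous_at (fun p : R * R => (h p.1)%:C) p.
  move=> ch; apply: (@ccontinuous_real _ _ (fun p : R * R => h p.1)).
  apply: (@continuous_comp _ _ _ (@fst R R)); last exact: ch.
  by case: p => x y; exact: cvg_fst.
have ce (p : R * R) : ccontinuous_at (fun p : R * R => e p.2) p.
  by apply: ccontinuous_cexp_i; case: p => x y; exact: cvg_snd.
have cw (p : R * R) : ccontinuous_at (fun p : R * R => w p.1 p.2) p.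
  by apply: ccontinuousD; [exact: cfst|apply: ccontinuousM; [exact: cfst|exact: ce]].
have rc : continuous r by move=> x; exact: is_derive_continuous (dr x).
have cc : continuous c by move=> x; exact: is_derive_continuous (dc x).
have ccirc (p : R * R) : ccontinuous_at (fun p : R * R => circ (c p.1) (r p.1) p.2) p.
  by apply: ccontinuousD; [exact: cfst|apply: ccontinuousM; [exact: cfst|exact: ce]].
have ccirc' (p : R * R) : ccontinuous_at (fun p : R * R => circ' (r p.1) p.2) p.
  apply: ccontinuousM; last exact: ce.
  by apply: ccontinuousM; [exact: ccontinuous_cst|exact: cfst].
apply: (@cint_family_cst 0 (2 * pi) _ f'
  (fun s u => g (circ (c s) (r s) u) * w s u)).
- by rewrite mulr_gt0// pi_gt0.
- by move=> s u; exact: cderiveM (dg _ _ _ (UU^~ u) (dcs s u)) (dc's s u).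
- move=> p; apply: ccontinuousD; apply: ccontinuousM.
  + apply: (cg _ (fun p : R * R => circ (c p.1) (r p.1) p.2)); last exact: ccirc.
    by move=> q; exact: UU.
  + apply: ccontinuousM; last exact: ce.
    by apply: ccontinuousM; [exact: ccontinuous_cst|exact: cfst].
  + apply: ccontinuousM; last exact: cw.
    apply: (cg' _ (fun p : R * R => circ (c p.1) (r p.1) p.2)); last exact: ccirc.
    by move=> q; exact: UU.
  + exact: ccirc'.
- move=> s u; apply: ccontinuousM.
    apply: (cg _ (circ (c s) (r s))); first exact: UU.
    exact: cderive_continuous (dcu s u).
  apply: ccontinuousM; last exact: cderive_continuous (de u).
  exact: ccontinuous_cst.
- move=> s u.
  apply: cderive_eq (cderiveM (dg _ _ _ (UU s) (dcu s u)) (dwu s u)) _.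
  by rewrite /f'; congr (_ + _); rewrite mulrAC.
- move=> s; have e2 : e (2 * pi) = e 0.
    by rewrite /e !cexp_i mulr_natl cos2pi sin2pi cos0 sin0.
  by rewrite /w /circ -/(e _) -/(e _) e2.
Qed.

End CircleIntegrals.

(** * The Fourier transform of beta0 *)

Section HyperbolicFourier.
Variable R : realType.
Local Notation mu := (@lebesgue_measure R).
Implicit Types b t th phi : R.

Definition ch (x : R) : R := (expR x + expR (- x)) / 2.
Definition sh (x : R) : R := (expR x - expR (- x)) / 2.

Lemma is_derive_chain (f g : R -> R) x a b :
  is_derive (g x) (1 : R) f a -> is_derive x (1 : R) g b ->
  is_derive x (1 : R) (fun t => f (g t)) (a * b).
Proof. exact: is_derive1_comp. Qed.

Lemma is_derive_addr (f : R -> R) x a c : is_derive x (1 : R) f a ->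
  is_derive x (1 : R) (fun t => f t + c) a.
Proof.
by move=> fa; apply: is_derive_eq (is_deriveD fa (is_derive_cst c x 1)) _; rewrite addr0.
Qed.

Lemma is_derive_scale (f : R -> R) x a c : is_derive x (1 : R) f a ->
  is_derive x (1 : R) (fun t => c * f t) (c * a).
Proof.
move=> fa; apply: is_derive_eq (is_derive_mul (is_derive_cst c x 1) fa) _.
by rewrite mul0r addr0.
Qed.

Lemma is_derive_affine a b x : is_derive x (1 : R) (fun t => a * t + b) a.
Proof.
have := is_deriveD (is_derive_mul (is_derive_cst a x 1) (is_derive_id x (1 : R)))
  (is_derive_cst b x (1 : R)).
by move=> /is_derive_eq; apply; rewrite /= mul0r !addr0 mulr1.
Qed.

Lemma is_derive_linear a x : is_derive x (1 : R) (fun t => a * t) a.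
Proof.
by have := is_derive_affine a 0 x; under eq_fun do rewrite addr0.
Qed.

Lemma is_derive_expN x : is_derive x (1 : R) (fun t => expR (- t)) (- expR (- x)).
Proof.
have dN : is_derive x (1 : R) (fun t : R => - t) (-1) by exact: is_deriveN.
by apply: is_derive_eq (is_derive_chain (is_derive_expR (- x)) dN) _; rewrite mulrN1.
Qed.

Lemma is_derive_sh x : is_derive x (1 : R) sh (ch x).
Proof.
have := is_derive_mul (is_deriveB (is_derive_expR x) (is_derive_expN x))
  (is_derive_cst (2^-1 : R) x (1 : R)).
by move=> /is_derive_eq; apply; rewrite /ch /= mulr0 add0r opprK.
Qed.

Lemma is_derive_ch x : is_derive x (1 : R) ch (sh x).
Proof.
have := is_derive_mul (is_deriveD (is_derive_expR x) (is_derive_expN x))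
  (is_derive_cst (2^-1 : R) x (1 : R)).
by move=> /is_derive_eq; apply; rewrite /sh /= mulr0 add0r.
Qed.

Lemma ch2Bsh2 x : ch x ^+ 2 = 1 + sh x ^+ 2.
Proof.
rewrite /ch /sh expRN; field; exact: lt0r_neq0 (expR_gt0 x).
Qed.

Lemma ch_gt0 x : 0 < ch x.
Proof. by rewrite divr_gt0// addr_gt0 ?expR_gt0. Qed.

Lemma sh_le_ch x : `|sh x| <= ch x.
Proof.
by have h := expR_gt0 x; have h' := expR_gt0 (- x); rewrite /sh /ch ler_norml; lra.
Qed.

Lemma ch_ge1 x : 1 <= ch x.
Proof.
rewrite leNgt; apply/negP => h.
have h0 := ch_gt0 x; have h2 := ch2Bsh2 x; have h3 := sqr_ge0 (sh x).
nra.
Qed.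

Lemma sh2 x : sh (2 * x) = 2 * sh x * ch x.
Proof.
have e : 2 * x = x + x by ring.
rewrite /ch /sh e opprD !expRD expRN; field; exact: lt0r_neq0 (expR_gt0 x).
Qed.

Lemma ch2 x : ch (2 * x) = 2 * ch x ^+ 2 - 1.
Proof.
have e : 2 * x = x + x by ring.
rewrite /ch e opprD !expRD expRN; field; exact: lt0r_neq0 (expR_gt0 x).
Qed.

(** Exponential growth is weakened to quadratic growth, so that multiples of 1 / (1 + t^2) serve as
    dominating functions everywhere. The 8 is 2 times 4: cosh (pi t) is at least exp (pi |t|) / 2,
    and 1 + t^2 <= 4 (1 + |t| / 2)^2 <= 4 exp |t|. *)
Lemma ch_lb t : (1 + t ^+ 2) / 8 <= ch (pi * t).
Proof.
have : 1 + t ^+ 2 <= 4 * expR (pi * `|t|).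
  have h1 : expR `|t| <= expR (pi * `|t|).
    by rewrite ler_expR ler_peMl// (le_trans _ (pi_ge2 R))// ler1n.
  have h2 : (1 + `|t| / 2) ^+ 2 <= expR `|t|.
    have -> : expR `|t| = expR (`|t| / 2) ^+ 2.
      by rewrite expr2 -expRD; congr expR; lra.
    by rewrite ler_sqr ?nnegrE ?expR_ge0 ?addr_ge0 ?divr_ge0// expR_ge1Dx.
  have h0 := normr_ge0 t; have := real_normK (num_real t).
  by nra.
have e1 := expR_gt0 (pi * t); have e2 := expR_gt0 (- (pi * t)).
rewrite /ch; case: (ler0P t) => [t0|t0].
- by rewrite mulrN => h; lra.
- by move=> h; lra.
Qed.

Lemma integrable_oneDsqrV : mu.-integrable [set: R] (EFin \o (fun t : R => (1 + t ^+ 2)^-1)).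
Proof.
have c1 : continuous (fun t : R => (1 + t ^+ 2)^-1).
  by move=> x; have := @continuous_oneDsqrV R x.
have f0 (x : R) : 0 <= (1 + x ^+ 2)^-1 by rewrite invr_ge0 addr_ge0 ?sqr_ge0.
apply/integrableP; split.
  by apply/measurable_EFinP; exact: continuous_measurable_fun.
apply/abse_integralP => //=.
  by apply/measurable_EFinP; exact: continuous_measurable_fun.
rewrite ge0_symfun_integralT//=; last by move=> x /=; rewrite sqrrN.
rewrite (_ : [set x | _] = `[0, +oo[%classic); last first.
  by apply/seteqP; split => x/=; rewrite in_itv/= andbT.
have := @integral0y_oneDsqr R; rewrite /oneDsqr /= => ->.
by rewrite -EFinM /= ltry.
Qed.

Lemma integrable_oneDsqrVZ (K : R) :
  mu.-integrable [set: R] (EFin \o (fun t : R => K / (1 + t ^+ 2))).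
Proof.
have mT : measurable (setT : set (measurableTypeR R)) by exact: measurableT.
have := integrableZl mT K integrable_oneDsqrV.
by apply: eq_integrable => // t _ /=; rewrite EFinM.
Qed.

Lemma integrable_decay (f : R -> R) (K : R) : continuous f ->
  (forall t, `|f t| <= K / (1 + t ^+ 2)) ->
  mu.-integrable [set: R] (EFin \o f).
Proof.
move=> cf fK.
have Ki := integrable_oneDsqrVZ K.
apply: le_integrable Ki => //.
  by apply/measurable_EFinP; exact: continuous_measurable_fun.
by move=> t _ /=; rewrite lee_fin; apply: le_trans (fK t) (ler_norm _).
Qed.

(** The line is exhausted by the intervals [[- n, n]] under dominated convergence, so only a
    symmetric limit of the primitive along the integers is needed. *)
Lemma Rintegral_derive_setT (F f : R -> R) (K l : R) :
  (forall x, is_derive x (1 : R) F (f x)) -> continuous f ->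
  (forall t, `|f t| <= K / (1 + t ^+ 2)) ->
  F n%:R - F (- n%:R) @[n --> \oo] --> l ->
  Rintegral mu setT f = l.
Proof.
move=> dF cf fK Fl.
pose f_ (n : nat) (x : R) : \bar R := ((EFin \o f) \_ `[- n%:R, n%:R]) x.
have mf : measurable_fun [set: R] (EFin \o f).
  by apply/measurable_EFinP; exact: continuous_measurable_fun.
have mf_ n : measurable_fun [set: R] (f_ n).
  apply/(measurable_restrictT _ _).1 => //.
  exact: measurable_funS mf.
have Ki := integrable_oneDsqrVZ K.
have f_f : {ae mu, forall x, setT x -> f_ ^~ x @ \oo --> (EFin \o f) x}.
  apply: aeW => x _; apply: cvg_near_cst.
  have [N _ HN] := @nbhs_infty_ger R `|x|.
  exists N => // n /HN xn; rewrite /f_ patchE ifT// inE /= in_itv/=.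
  by rewrite -ler_norml.
have f_K : {ae mu, forall x n, setT x ->
    (`|f_ n x| <= (EFin \o (fun t : R => K / (1 + t ^+ 2))%R) x)%E}.
  apply: aeW => x n _; rewrite /f_ patchE; case: ifP => _ /=.
    by rewrite lee_fin.
  by rewrite normr0 lee_fin; apply: le_trans (fK x).
have [_ _ fcvg] := dominated_convergence (measurableT : measurable [set: measurableTypeR R])
  mf_ mf f_f Ki f_K.
rewrite /Rintegral; suff -> : (\int[mu]_x (f x)%:E = l%:E)%E by [].
suff H : [sequence (\int[mu]_x f_ n x)%E]_n @ \oo --> l%:E by exact: (cvg_unique _ fcvg H).
(* The fundamental theorem of calculus is applied with [- n < n], which excludes [n = 0]. *)
rewrite -cvg_shiftS.
rewrite [X in X @ _ --> _](_ : _ = (fun n => (F n.+1%:R - F (- n.+1%:R))%:E)); last first.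
  apply/funext => n.
  transitivity (\int[mu]_(x in `[(- n.+1%:R)%R, n.+1%:R%R]) (f x)%:E)%E.
    by rewrite [RHS]integral_mkcond.
  rewrite (@continuous_FTC2 _ f F) ?EFinB//.
  - by rewrite lt_neqAle eq_sym -subr_eq0 opprK -natrD pnatr_eq0 /= -subr_ge0 opprK -natrD.
  - exact: continuous_subspaceT.
  - split.
    + by move=> x _; case: (dF x).
    + exact/cvg_at_right_filter/(is_derive_continuous (dF _)).
    + exact/cvg_at_left_filter/(is_derive_continuous (dF _)).
  - by move=> x _; rewrite derive1E; case: (dF x).
apply/fine_cvgP; split; first exact: nearW.
by move: Fl; rewrite -cvg_shiftS.
Qed.

Lemma decay_cvg0 (F : R -> R) (K : R) : (forall t, `|F t| <= K / (1 + t ^+ 2)) ->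
  F n%:R - F (- n%:R) @[n --> \oo] --> 0.
Proof.
move=> FK; apply: norm_cvg0.
have h0 : (4 * K) * harmonic n @[n --> \oo] --> (0 : R).
  by rewrite -[X in _ --> X](mulr0 (4 * K)); apply: cvgM; [exact: cvg_cst|exact: cvg_harmonic].
apply: (@squeeze_cvgr _ _ _ _ (cst 0) _ _ _ _ _ h0); last exact: cvg_cst.
apply: nearW => n /=; rewrite normr_ge0 /=.
have n0 : 0 <= n%:R :> R by rewrite ler0n.
have F1 := FK n%:R; have F2 := FK (- n%:R); rewrite sqrrN in F2.
apply: le_trans (ler_normB _ _) _; apply: le_trans (lerD F1 F2) _.
have K0 : 0 <= K.
  have /(le_trans (normr_ge0 _)) := FK 0.
  by rewrite expr0n addr0 divr1.
have d1 : 0 < 1 + n%:R ^+ 2 :> R by rewrite ltr_pwDl ?sqr_ge0.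
rewrite -mulrDl ler_pdivrMr// mulrAC.
rewrite ler_pdivlMr ?ltr0n// -natr1.
(* The remaining inequality follows from 4 (1 + n^2) - 2 (n + 1) = (2 n - 1/2)^2 + 7/4. *)
have := mulr_ge0 K0 (sqr_ge0 (2 * n%:R - 1 / 2)); nra.
Qed.

(** The denominator has one more power of [c] than the numerator. With [c] the hyperbolic cosine,
    this is the decay 1 / cosh common to the four kernels below. *)
Lemma ratio_bound (N A c D : R) n : 0 < c -> c / 4 <= D -> `|N| <= A * c ^+ n ->
  `|N / D ^+ n.+1| <= A * 4 ^+ n.+1 / c.
Proof.
move=> c0 cD NA.
have c40 : 0 < c / 4 by rewrite divr_gt0.
have D0 : 0 < D by exact: lt_le_trans cD.
rewrite normrM normrV ?unitfE ?expf_neq0 ?lt0r_neq0//.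
rewrite (ger0_norm (exprn_ge0 _ (ltW D0))).
apply: le_trans (_ : A * c ^+ n / (c / 4) ^+ n.+1 <= _).
  apply: ler_pM => //; first by rewrite invr_ge0; exact/exprn_ge0/ltW.
  rewrite lef_pV2 ?posrE ?exprn_gt0//.
  by apply: lerXn2r; rewrite ?nnegrE ?(ltW c40) ?(ltW D0).
rewrite expr_div_n [c ^+ n.+1]exprS invf_div.
have cn : c ^+ n != 0 by rewrite expf_neq0 ?lt0r_neq0.
rewrite le_eqVlt; apply/orP; left; apply/eqP.
by field; rewrite cn lt0r_neq0.
Qed.

(* With [T z = tanh (z / 2)], the functions [kP] and [kQ] are the real part and *)
(* minus the imaginary part of [T' (pi t + i th)], and [dP], [dQ] are their     *)
(* derivatives in [th].                                                        *)
Definition kP th t : R := (1 + ch (pi * t) * cos th) / (ch (pi * t) + cos th) ^+ 2.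
Definition kQ th t : R := sh (pi * t) * sin th / (ch (pi * t) + cos th) ^+ 2.
Definition dP th t : R :=
  sin th * (2 + ch (pi * t) * cos th - ch (pi * t) ^+ 2) / (ch (pi * t) + cos th) ^+ 3.
Definition dQ th t : R :=
  sh (pi * t) * (cos th * (ch (pi * t) + cos th) + 2 * sin th ^+ 2)
    / (ch (pi * t) + cos th) ^+ 3.

Section Kernel.
Variable th : R.
Hypothesis cth : - (3 / 4) <= cos th.

(** As cosh >= 1, subtracting 3/4 leaves at least a quarter of it. The bound -3/4 lies below cos (3
    pi / 4) = - sqrt 2 / 2, so it holds on an open interval containing all shifts from - pi / 2 to
    pi / 2. *)
Lemma den_ge t : ch (pi * t) / 4 <= ch (pi * t) + cos th.
Proof. by have := ch_ge1 (pi * t); have := cth; lra. Qed.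

Lemma den_gt0 t : 0 < ch (pi * t) + cos th.
Proof. by apply: lt_le_trans (den_ge t); rewrite divr_gt0 ?ch_gt0. Qed.

Lemma den_neq0 t : ch (pi * t) + cos th != 0.
Proof. exact: lt0r_neq0 (den_gt0 t). Qed.

Lemma kernel_bound t : [/\ `|kP th t| <= 32 / ch (pi * t), `|kQ th t| <= 16 / ch (pi * t),
  `|dP th t| <= 256 / ch (pi * t) & `|dQ th t| <= 256 / ch (pi * t)].
Proof.
have c1 := ch_ge1 (pi * t); have c0 := ch_gt0 (pi * t).
have := sh_le_ch (pi * t); rewrite ler_norml => /andP[s1 s2].
have dg := den_ge t.
have k1 := cos_le1 th; have k2 := cos_geN1 th.
have l1 := sin_le1 th; have l2 := sin_geN1 th.
have kl := cos2Dsin2 th.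
set c := ch (pi * t) in c1 c0 s1 s2 dg *; set s := sh (pi * t) in s1 s2 *.
have p1 := ler_wpM2l (ltW c0) k1; have p2 := ler_wpM2l (ltW c0) k2.
have c2 : c <= c ^+ 2 by rewrite expr2 ler_peMl // ltW.
have q1 := sqr_ge0 (sin th); have q2 := sqr_ge0 (cos th).
rewrite mulr1 in p1; rewrite mulrN1 in p2.
split.
- have := @ratio_bound (1 + c * cos th) 2 c _ 1 c0 dg.
  rewrite (_ : 2 * 4 ^+ 2 = 32); last by ring.
  by apply; rewrite ler_norml expr1; apply/andP; split; lra.
- have := @ratio_bound (s * sin th) 1 c _ 1 c0 dg.
  rewrite (_ : 1 * 4 ^+ 2 = 16); last by ring.
  apply; rewrite normrM expr1 mul1r -[leRHS]mulr1; apply: ler_pM => //.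
  + by rewrite ler_norml s1.
  + by rewrite ler_norml l1 l2.
- have := @ratio_bound (sin th * (2 + c * cos th - c ^+ 2)) 4 c _ 2 c0 dg.
  rewrite (_ : 4 * 4 ^+ 3 = 256); last by ring.
  apply; rewrite normrM -[leRHS]mul1r; apply: ler_pM => //.
  + by rewrite ler_norml l1 l2.
  + by rewrite ler_norml; apply/andP; split; lra.
- have := @ratio_bound (s * (cos th * (c + cos th) + 2 * sin th ^+ 2)) 4 c _ 2 c0 dg.
  rewrite (_ : 4 * 4 ^+ 3 = 256); last by ring.
  apply; rewrite normrM (_ : 4 * c ^+ 2 = c * (4 * c)); last by ring.
  apply: ler_pM => //.
  + by rewrite ler_norml s1.
  + by rewrite ler_norml; apply/andP; split; lra.
Qed.

Lemma is_derive_ch_pi t : is_derive t (1 : R) (fun t => ch (pi * t)) (pi * sh (pi * t)).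
Proof.
by apply: is_derive_eq (is_derive_chain (is_derive_ch _) (is_derive_linear pi t)) _; rewrite mulrC.
Qed.

Lemma is_derive_sh_pi t : is_derive t (1 : R) (fun t => sh (pi * t)) (pi * ch (pi * t)).
Proof.
by apply: is_derive_eq (is_derive_chain (is_derive_sh _) (is_derive_linear pi t)) _; rewrite mulrC.
Qed.

Lemma is_derive_quot2 (N D : R -> R) x n d :
  is_derive x (1 : R) N n -> is_derive x (1 : R) D d -> D x != 0 ->
  is_derive x (1 : R) (fun t => N t / D t ^+ 2) ((n * D x - 2 * N x * d) / D x ^+ 3).
Proof.
move=> dN dD D0.
have dE : is_derive x (1 : R) (fun t => (D t ^+ 2)^-1) (- 2 * d / D x ^+ 3).
  have D20 : D x * D x != 0 by rewrite mulf_neq0.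
  under eq_fun do rewrite expr2.
  by apply: is_derive_eq (@is_derive_inv R (fun t => D t * D t) x _ D20 (is_derive_mul dD dD)) _; field.
by apply: is_derive_eq (is_derive_mul dN dE) _; field.
Qed.

Lemma is_derive_kP_th t : is_derive th (1 : R) (kP^~ t) (dP th t).
Proof.
have D0 := den_neq0 t.
have dc := is_derive_cos th.
have dD : is_derive th (1 : R) (fun th => ch (pi * t) + cos th) (- sin th).
  by under eq_fun do rewrite addrC; exact: is_derive_addr.
have dN : is_derive th (1 : R) (fun th => 1 + ch (pi * t) * cos th) (- (ch (pi * t) * sin th)).
  under eq_fun do rewrite addrC; apply: is_derive_addr.
  by rewrite -mulrN; exact: is_derive_scale.
apply: is_derive_eq (is_derive_quot2 dN dD D0) _.
by rewrite /dP; congr (_ / _); ring.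
Qed.

Lemma is_derive_kQ_th t : is_derive th (1 : R) (kQ^~ t) (dQ th t).
Proof.
have D0 := den_neq0 t.
have dc := is_derive_cos th.
have dD : is_derive th (1 : R) (fun th => ch (pi * t) + cos th) (- sin th).
  by under eq_fun do rewrite addrC; exact: is_derive_addr.
have dN : is_derive th (1 : R) (fun th => sh (pi * t) * sin th) (sh (pi * t) * cos th).
  exact: is_derive_scale.
apply: is_derive_eq (is_derive_quot2 dN dD D0) _.
by rewrite /dQ; congr (_ / _); ring.
Qed.

Lemma is_derive_den t :
  is_derive t (1 : R) (fun t => ch (pi * t) + cos th) (pi * sh (pi * t)).
Proof.
exact: is_derive_addr (is_derive_ch_pi t).
Qed.

(* The Cauchy-Riemann equations of [T']. *)
Lemma is_derive_kP t : is_derive t (1 : R) (kP th) (- (pi * dQ th t)).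
Proof.
have D0 := den_neq0 t.
have dN : is_derive t (1 : R) (fun t => 1 + ch (pi * t) * cos th) (pi * sh (pi * t) * cos th).
  under eq_fun do rewrite addrC mulrC; apply: is_derive_addr.
  by rewrite mulrC; apply: is_derive_scale; exact: is_derive_ch_pi.
apply: is_derive_eq (is_derive_quot2 dN (is_derive_den t) D0) _.
rewrite /dQ sin2cos2.
have -> (a b : R) : - (pi * (a / b)) = (- (pi * a)) / b by rewrite mulrA mulNr.
by congr (_ / _); ring.
Qed.

Lemma is_derive_kQ t : is_derive t (1 : R) (kQ th) (pi * dP th t).
Proof.
have D0 := den_neq0 t.
have dN : is_derive t (1 : R) (fun t => sh (pi * t) * sin th) (pi * ch (pi * t) * sin th).
  under eq_fun do rewrite mulrC.
  by rewrite mulrC; apply: is_derive_scale; exact: is_derive_sh_pi.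
apply: is_derive_eq (is_derive_quot2 dN (is_derive_den t) D0) _.
rewrite /dP.
have -> (a b : R) : pi * (a / b) = pi * a / b by rewrite mulrA.
congr (_ / _).
have -> : 2 * (sh (pi * t) * sin th) * (pi * sh (pi * t)) =
  2 * pi * sin th * sh (pi * t) ^+ 2 by ring.
have -> : sh (pi * t) ^+ 2 = ch (pi * t) ^+ 2 - 1 by rewrite ch2Bsh2; ring.
by ring.
Qed.

Lemma continuous_dPQ : continuous (dP th) /\ continuous (dQ th).
Proof.
have cc t : {for t, continuous (fun t => ch (pi * t))}.
  exact: is_derive_continuous (is_derive_ch_pi t).
have cs t : {for t, continuous (fun t => sh (pi * t))}.
  exact: is_derive_continuous (is_derive_sh_pi t).
have cd t : {for t, continuous (fun t => ch (pi * t) + cos th)}.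
  exact: is_derive_continuous (is_derive_den t).
have cV t : {for t, continuous (fun t => ((ch (pi * t) + cos th) ^+ 3)^-1)}.
  apply: cvgV; first by rewrite expf_neq0 ?den_neq0.
  apply: (@continuous_comp _ _ _ (fun t => ch (pi * t) + cos th) (fun x : R => x ^+ 3)); first exact: cd.
  exact: exprn_continuous.
split=> t; apply: cvgM; try exact: cV.
- apply: cvgM; first exact: cvg_cst.
  apply: cvgB; first by apply: cvgD; [exact: cvg_cst|apply: cvgM; [exact: cc|exact: cvg_cst]].
  apply: (@continuous_comp _ _ _ (fun t => ch (pi * t)) (fun x : R => x ^+ 2)); first exact: cc.
  exact: exprn_continuous.
- apply: cvgM; first exact: cs.
  by apply: cvgD; [apply: cvgM; [exact: cvg_cst|exact: cd]|exact: cvg_cst].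
Qed.

End Kernel.

(* [kern b phi th] is the real part of [e^(i (b t + phi)) T' (pi t + i th)]. *)
Definition kern b phi th t : R :=
  kP th t * cos (b * t + phi) + kQ th t * sin (b * t + phi).
Definition kern' b phi th t : R :=
  dP th t * cos (b * t + phi) + dQ th t * sin (b * t + phi).

Lemma le_ch_decay (K t : R) : 0 <= K -> K / ch (pi * t) <= 8 * K / (1 + t ^+ 2).
Proof.
move=> K0; have d0 : 0 < 1 + t ^+ 2 by rewrite ltr_pwDl ?sqr_ge0.
rewrite (mulrC 8) -mulrA ler_wpM2l// -[8]invrK -invfM lef_pV2 ?posrE ?ch_gt0 ?mulr_gt0//.
by rewrite mulrC; exact: ch_lb.
Qed.

Section Shift.
Variables b phi : R.

Lemma is_derive_phase_cos t :
  is_derive t (1 : R) (fun t => cos (b * t + phi)) (- (b * sin (b * t + phi))).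
Proof.
apply: is_derive_eq (is_derive_chain (is_derive_cos _) (is_derive_affine b phi t)) _.
by rewrite mulNr mulrC.
Qed.

Lemma is_derive_phase_sin t :
  is_derive t (1 : R) (fun t => sin (b * t + phi)) (b * cos (b * t + phi)).
Proof.
apply: is_derive_eq (is_derive_chain (is_derive_sin _) (is_derive_affine b phi t)) _.
by rewrite mulrC.
Qed.

Lemma le_phase (x y c s A B : R) : `|x| <= A -> `|y| <= B -> `|c| <= 1 -> `|s| <= 1 ->
  `|x * c + y * s| <= A + B.
Proof.
move=> xA yB c1 s1; apply: le_trans (ler_normD _ _) _; rewrite !normrM.
by apply: lerD; rewrite -[leRHS]mulr1; apply: ler_pM.
Qed.

Section Fixed.
Variable th : R.
Hypothesis cth : - (3 / 4) <= cos th.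

Lemma kern_decay t : `|kern b phi th t| <= 384 / (1 + t ^+ 2).
Proof.
have [p q _ _] := kernel_bound cth t.
apply: le_trans (le_phase p q (cos_max _) (sin_max _)) _.
rewrite -mulrDl; apply: le_trans (le_ch_decay _ _) _; first by rewrite addr_ge0.
by rewrite (_ : 8 * (32 + 16) = 384)//; ring.
Qed.

Lemma kern'_decay t : `|kern' b phi th t| <= 4096 / (1 + t ^+ 2).
Proof.
have [_ _ p q] := kernel_bound cth t.
apply: le_trans (le_phase p q (cos_max _) (sin_max _)) _.
rewrite -mulrDl; apply: le_trans (le_ch_decay _ _) _; first by rewrite addr_ge0.
by rewrite (_ : 8 * (256 + 256) = 4096)//; ring.
Qed.

Lemma continuous_kern : continuous (kern b phi th).
Proof.
move=> t; apply: (is_derive_continuous (is_deriveD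
  (is_derive_mul (is_derive_kP cth t) (is_derive_phase_cos t))
  (is_derive_mul (is_derive_kQ cth t) (is_derive_phase_sin t)))).
Qed.

Lemma continuous_kern' : continuous (kern' b phi th).
Proof.
have [cP cQ] := continuous_dPQ cth.
move=> t; apply: cvgD; apply: cvgM.
- exact: cP.
- exact: is_derive_continuous (is_derive_phase_cos t).
- exact: cQ.
- exact: is_derive_continuous (is_derive_phase_sin t).
Qed.

Lemma integrable_kern : mu.-integrable [set: R] (EFin \o kern b phi th).
Proof. exact: integrable_decay continuous_kern kern_decay. Qed.

Lemma integrable_kern' : mu.-integrable [set: R] (EFin \o kern' b phi th).
Proof. exact: integrable_decay continuous_kern' kern'_decay. Qed.

Lemma is_derive_kern_th t : is_derive th (1 : R) (fun th => kern b phi th t) (kern' b phi th t).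
Proof.
apply: is_derive_eq (is_deriveD
  (is_derive_mul (is_derive_kP_th cth t) (is_derive_cst (cos (b * t + phi)) th (1 : R)))
  (is_derive_mul (is_derive_kQ_th cth t) (is_derive_cst (sin (b * t + phi)) th (1 : R)))) _.
by rewrite /kern' /= !mulr0 !add0r.
Qed.

(** By the Cauchy-Riemann equations a derivative in [th] is a derivative in [t] of the conjugate
    kernel, divided by [pi]; integration by parts moves it to the phase and produces [b].
    Concretely, [W] is a primitive of [kern' - b / pi * kern] that vanishes at both ends. *)
Lemma Rintegral_kern' :
  Rintegral mu setT (kern' b phi th) = b / pi * Rintegral mu setT (kern b phi th).
Proof.
have pi0 : pi != 0 :> R by rewrite lt0r_neq0 ?pi_gt0.
pose W t := pi^-1 * (kQ th t * cos (b * t + phi) - kP th t * sin (b * t + phi)).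
pose w t := 1 * kern' b phi th t + - (b / pi) * kern b phi th t.
have dW t : is_derive t (1 : R) W (w t).
  apply: is_derive_eq (is_derive_scale _ (is_deriveB
    (is_derive_mul (is_derive_kQ cth t) (is_derive_phase_cos t))
    (is_derive_mul (is_derive_kP cth t) (is_derive_phase_sin t)))) _.
  by rewrite /w /kern /kern'; move: pi0; move: (pi : R) => p p0; field.
have cw : continuous w.
  move=> t; apply: cvgD; apply: cvgM.
  - exact: cvg_cst.
  - exact: continuous_kern'.
  - exact: cvg_cst.
  - exact: continuous_kern.
have wK t : `|w t| <= (4096 + `|b / pi| * 384) / (1 + t ^+ 2).
  apply: le_trans (ler_normD _ _) _; rewrite mulrDl; apply: lerD.
    by rewrite mul1r kern'_decay.
  by rewrite normrM normrN -mulrA ler_wpM2l// kern_decay.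
have WK t : `|W t| <= (pi^-1 * 384) / (1 + t ^+ 2).
  rewrite normrM gtr0_norm ?invr_gt0 ?pi_gt0// -mulrA ler_wpM2l ?invr_ge0 ?pi_ge0//.
  have [p q _ _] := kernel_bound cth t; rewrite -mulrN.
  apply: le_trans (le_phase q p (cos_max _) _) _; first by rewrite normrN sin_max.
  rewrite -mulrDl; apply: le_trans (le_ch_decay _ _) _; first by rewrite addr_ge0.
  by rewrite (_ : 8 * (16 + 32) = 384)//; ring.
have w0 := Rintegral_derive_setT dW cw wK (decay_cvg0 WK).
have mT : measurable (setT : set (measurableTypeR R)) by exact: measurableT.
have [_] := integrable_lin mT 1 (- (b / pi)) integrable_kern' integrable_kern.
by rewrite -/w w0 mul1r mulNr => /esym/eqP; rewrite subr_eq0 => /eqP.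
Qed.

End Fixed.

End Shift.

End HyperbolicFourier.

(** * Evaluation of the transform by shifting and halving *)

Section FourierBeta.
Variable R : realType.
Local Notation mu := (@lebesgue_measure R).

Lemma cos_ge_34 (th : R) : th \in `]-(3 / 4 * pi), 3 / 4 * pi[ -> - (3 / 4) <= cos th.
Proof.
rewrite in_itv/= => /andP[t1 t2]; have pi0 := pi_gt0 R.
have cq : cos (pi / 4) ^+ 2 = 1 / 2 :> R.
  have := cos_mulr2n (pi / 4 : R).
  have -> : (pi / 4) *+ 2 = pi / 2 :> R by rewrite mulr2n; lra.
  rewrite cos_pihalf; set c := cos _; rewrite mulr2n => h; lra.
have cq0 : 0 <= cos (pi / 4) :> R.
  by apply: cos_ge0_pihalf; apply/andP; split; lra.
have c34 : - (3 / 4) <= cos (3 / 4 * pi) :> R.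
  have -> : 3 / 4 * pi = - (pi / 4) + pi :> R by lra.
  by rewrite cosDpi cosN; nra.
apply: le_trans c34 _; rewrite -[in leRHS]cos_norm le_eqVlt; apply/orP; right.
have tn : `|th| < 3 / 4 * pi by rewrite ltr_norml t1 t2.
have n0 := normr_ge0 th.
by rewrite ltr_cos ?in_itv/=; [|apply/andP; split; lra..].
Qed.

Lemma is_derive_Rintegral_setT (f f' : R -> R -> R) (u v a : R) (G : R -> R) :
  a \in `]u, v[ ->
  (forall x, x \in `]u, v[ -> mu.-integrable [set: R] (EFin \o f x)) ->
  (forall x y, x \in `]u, v[ -> is_derive x (1 : R) (f^~ y) (f' x y)) ->
  (forall y, 0 <= G y) -> mu.-integrable [set: R] (EFin \o G) ->
  (forall x y, x \in `]u, v[ -> `|f' x y| <= G y) ->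
  is_derive a (1 : R) (fun x => Rintegral mu setT (f x)) (Rintegral mu setT (f' a)).
Proof.
move=> auv intf df G0 intG Gub.
have d1E x y : x \in `]u, v[ -> partial1of2 f x y = f' x y.
  by move=> xuv; rewrite partial1of2E; case: (df x y xuv).
have derf (x y : R) : `]u, v[%classic x -> [set: R] y -> derivable (f^~ y) x 1.
  by move=> xuv _; case: (df x y xuv).
have Gub' (x y : R) : `]u, v[%classic x -> [set: R] y -> `|partial1of2 f x y| <= G y.
  by move=> xuv _; rewrite d1E// Gub.
have mT : measurable (setT : set (measurableTypeR R)) by exact: measurableT.
have auv' : `]u, v[%classic a by [].
split; first exact: (derivable_under_integral mT auv' intf derf G0 intG Gub').
have := differentiation_under_integral mT auv' intf derf G0 intG Gub'.
rewrite derive1E => ->; apply: eq_Rintegral => y _.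
by rewrite d1E.
Qed.

Section Phase.
Variable phi : R.

Definition intk (b th : R) : R := Rintegral mu setT (kern b phi th).

Lemma is_derive_intk b th : th \in `]-(3 / 4 * pi), 3 / 4 * pi[ ->
  is_derive th (1 : R) (intk b) (b / pi * intk b th).
Proof.
move=> thI; rewrite -Rintegral_kern' ?cos_ge_34//.
apply: (@is_derive_Rintegral_setT (kern b phi) (kern' b phi) (-(3 / 4 * pi)) (3 / 4 * pi) th
  (fun t => 4096 / (1 + t ^+ 2))).
- exact: thI.
- by move=> x xI; apply: integrable_kern; exact: cos_ge_34.
- by move=> x y xI; apply: is_derive_kern_th; exact: cos_ge_34.
- by move=> y; apply: divr_ge0; [exact: ler0n|rewrite addr_ge0 ?sqr_ge0].
- exact: integrable_oneDsqrVZ.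
- by move=> x y xI; apply: kern'_decay; exact: cos_ge_34.
Qed.

(** The shift of the line is a linear differential equation: [intk b] has logarithmic derivative
    [b / pi] in the shift. The parameter [pi / 2 * sin s] stays in the strip for every real [s], so
    constancy of [g] follows from a derivative vanishing on the whole line; [s = pi / 2] and
    [s = - (pi / 2)] give the two extreme shifts. *)
Lemma intk_shift b s : intk b (pi / 2 * sin s) = expR (b / 2 * sin s) * intk b 0.
Proof.
have pi0 := pi_gt0 R; have pi00 : pi != 0 :> R by rewrite lt0r_neq0.
pose th x : R := pi / 2 * sin x.
have thI x : th x \in `]-(3 / 4 * pi), 3 / 4 * pi[.
  have := sin_le1 x; have := sin_geN1 x; rewrite in_itv/= /th.
  have h : 0 <= pi / 2 :> R by rewrite divr_ge0// ltW.
  move=> /(ler_wpM2l h) h1 /(ler_wpM2l h) h2; apply/andP; split; lra.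
pose g x := expR (- (b / pi) * th x) * intk b (th x).
have dth x : is_derive x (1 : R) th (pi / 2 * cos x).
  by apply: is_derive_scale.
have dg x : is_derive x (1 : R) g 0.
  have dE := is_derive_chain (is_derive_expR _) (is_derive_scale (- (b / pi)) (dth x)).
  have dI := is_derive_chain (is_derive_intk b (thI x)) (dth x).
  by apply: is_derive_eq (is_derive_mul dE dI) _; ring.
have := is_derive_0_is_cst s 0 dg; rewrite /g /th sin0 !mulr0 expR0 mul1r => <-.
rewrite mulrA -expRD.
have -> : b / 2 * sin s + - (b / pi) * (pi / 2 * sin s) = 0.
  by move: pi00; move: (pi : R) => p p0; field.
by rewrite expR0 mul1r.
Qed.

Definition sech2 (b t : R) : R := cos (b * t + phi) / ch (pi * t) ^+ 2.

(** At both shifts cos th = 0; the [kQ] terms are opposite and cancel in the mean. *)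
Lemma sech2E b t : sech2 b t = 2^-1 * kern b phi (pi / 2) t + 2^-1 * kern b phi (- (pi / 2)) t.
Proof.
rewrite /kern /kP /kQ /sech2 cosN sinN cos_pihalf sin_pihalf !mulr0 !addr0 mulr1 mulrN1.
by field; exact: lt0r_neq0 (ch_gt0 _).
Qed.

Lemma cos_pihalf_ge : - (3 / 4) <= cos (pi / 2) :> R /\ - (3 / 4) <= cos (- (pi / 2)) :> R.
Proof. by rewrite cosN cos_pihalf; split; lra. Qed.

Lemma Rintegral_sech2 b : mu.-integrable [set: R] (EFin \o sech2 b) /\
  Rintegral mu setT (sech2 b) = ch (b / 2) * intk b 0.
Proof.
have mT : measurable (setT : set (measurableTypeR R)) by exact: measurableT.
have [c1 c2] := cos_pihalf_ge.
have -> : sech2 b = fun t => 2^-1 * kern b phi (pi / 2) t + 2^-1 * kern b phi (- (pi / 2)) t.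
  by apply/funext => t; exact: sech2E.
have [I ->] := integrable_lin mT 2^-1 2^-1 (integrable_kern b phi c1) (integrable_kern b phi c2).
split => //.
have := intk_shift b (pi / 2); rewrite sin_pihalf !mulr1 /intk => ->.
have := intk_shift b (- (pi / 2)); rewrite sinN sin_pihalf !mulrN1 /intk => ->.
by rewrite /ch; field.
Qed.

Lemma kern0E b t : kern b phi 0 t = cos (b * t + phi) / (1 + ch (pi * t)).
Proof.
have c0 := ch_gt0 (pi * t).
have d0 : 1 + ch (pi * t) != 0 by rewrite lt0r_neq0// addr_gt0.
have d1 : ch (pi * t) + 1 != 0 by rewrite addrC.
rewrite /kern /kP /kQ cos0 sin0 !mulr0 !mul0r addr0 mulr1; field.
by rewrite ?d0 ?d1.
Qed.

Lemma sech2_half b t : sech2 b (t / 2) / 2 = kern (b / 2) phi 0 t.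
Proof.
have c0 := ch_gt0 (pi * (t / 2)).
have e : pi * t = 2 * (pi * (t / 2)) :> R by field.
rewrite kern0E /sech2 e ch2.
have -> : b * (t / 2) = b / 2 * t by field.
have -> : 1 + (2 * ch (pi * (t / 2)) ^+ 2 - 1) = 2 * ch (pi * (t / 2)) ^+ 2 by ring.
by field; exact: lt0r_neq0.
Qed.

End Phase.

Lemma intk_halve phi b : ch (b / 2) * intk phi b 0 = intk phi (b / 2) 0.
Proof.
have mT : measurable (setT : set (measurableTypeR R)) by exact: measurableT.
have [I1 E1] := Rintegral_sech2 phi b; have [I2 E2] := Rintegral_sech2 0 0.
have c00 : - (3 / 4) <= cos 0 :> R by rewrite cos0; lra.
have K1 := integrable_kern (b / 2) phi c00; have K2 := integrable_kern (0 / 2) 0 c00.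
have [_ G1] := integrable_lin mT 1 1 I1 I2.
have [_ G2] := integrable_lin mT 1 1 K1 K2.
(* The substitution rule used below is for nonnegative integrands. Adding 1 / cosh^2 (pi t), the
   case of zero phase and frequency, makes the integrand nonnegative, and its contribution cancels
   at the end because cosh 0 = 1. *)
pose G t := 1 * sech2 phi b t + 1 * sech2 0 0 t.
have csech p a : continuous (sech2 p a).
  move=> t; apply: cvgM; first exact: is_derive_continuous (is_derive_phase_cos _ _ _).
  apply: cvgV; first by rewrite expf_neq0 ?lt0r_neq0 ?ch_gt0.
  apply: (@continuous_comp _ _ _ (fun t => ch (pi * t)) (fun x : R => x ^+ 2)).
    exact: is_derive_continuous (is_derive_ch_pi t).
  exact: exprn_continuous.
have cG : continuous G.
  by move=> t; apply: cvgD; apply: cvgM; [exact: cvg_cst|exact: csech|exact: cvg_cst|exact: csech].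
have G0 : forall t, 0 <= G t.
  move=> t; rewrite /G /sech2 mul0r addr0 cos0 !mul1r -[X in _ + X]mul1r -mulrDl divr_ge0 ?exprn_ge0 ?(ltW (ch_gt0 _))//.
have dF x : is_derive x (1 : R) (fun x : R => x / 2) 2^-1.
  by under eq_fun do rewrite mulrC; exact: is_derive_linear.
have dFE : derive1 (fun x : R => x / 2) = cst 2^-1.
  by apply/funext => x; rewrite derive1E; case: (dF x).
have key : Rintegral mu setT G =
    Rintegral mu setT (fun t => 1 * kern (b / 2) phi 0 t + 1 * kern (0 / 2) 0 0 t).
  rewrite /Rintegral; congr fine.
  rewrite (@increasing_ge0_integration_by_substitutionT _ (fun x : R => x / 2) G)//.
  - apply: eq_integral => t _; rewrite dFE; congr EFin => /=.
    by rewrite -[LHS]/(G (t / 2) * 2^-1) -!sech2_half /G; ring.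
  - by move=> x y xy; rewrite ltr_pM2r// invr_gt0.
  - by rewrite dFE => x; exact: cvg_cst.
  - by rewrite dFE; exact: is_cvg_cst.
  - by rewrite dFE; exact: is_cvg_cst.
  - by apply: gt0_cvgMlNy; [rewrite invr_gt0|exact: cvg_id].
  - by apply: gt0_cvgMly; [rewrite invr_gt0|exact: cvg_id].
move: G1; rewrite -/G key G2 E1 E2 !mul1r !mul0r.
have ch0 : ch 0 = 1 :> R by rewrite /ch oppr0 expR0; field.
rewrite -/(intk 0 0 0) -/(intk phi (b / 2) 0) ch0 mul1r.
by move=> /addIr ->.
Qed.

Lemma intk00 : intk 0 0 0 = 2 / pi.
Proof.
have pi0 := pi_gt0 R; have pi00 : pi != 0 :> R by rewrite lt0r_neq0.
have c00 : - (3 / 4) <= cos 0 :> R by rewrite cos0; lra.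
(* This is tanh (pi t / 2) / pi, written without the half angle; its total increase over the line is
   2 / pi. *)
pose S t : R := pi^-1 * (sh (pi * t) / (1 + ch (pi * t))).
have d0 t : 1 + ch (pi * t) != 0 :> R by rewrite lt0r_neq0// addr_gt0 ?ch_gt0.
have dS t : is_derive t (1 : R) S (kern 0 0 0 t).
  have dD : is_derive t (1 : R) (fun t => 1 + ch (pi * t)) (pi * sh (pi * t)).
    under eq_fun do rewrite addrC; apply: is_derive_addr; exact: is_derive_ch_pi.
  apply: is_derive_eq (is_derive_scale _
    (is_derive_mul (is_derive_sh_pi t) (@is_derive_inv _ (fun t => 1 + ch (pi * t)) t _ (d0 t) dD))) _.
  rewrite kern0E mul0r addr0 cos0.
  have h2 := ch2Bsh2 (pi * t); move: (d0 t) h2.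
  move: (ch (pi * t)) (sh (pi * t)) => c s c1 h2.
  have -> : s * (- (pi * s) / (1 + c) ^+ 2) + pi * c * (1 + c)^-1 =
    (pi * (c * (1 + c) - s ^+ 2)) / (1 + c) ^+ 2.
    by field.
  have -> : s ^+ 2 = c ^+ 2 - 1 by rewrite h2; ring.
  by move: pi00; move: (pi : R) => p p0; field; rewrite p0 c1.
rewrite /intk; apply: (Rintegral_derive_setT dS (@continuous_kern _ 0 0 _ c00) (@kern_decay _ 0 0 _ c00)).
have SN t : S (- t) = - S t.
  have shN x : sh (- x) = - sh x :> R by rewrite /sh opprK -mulNr opprB.
  have chN x : ch (- x) = ch x :> R by rewrite /ch opprK addrC.
  by rewrite /S mulrN shN chN mulNr mulrN.
have S1 t : 0 <= t -> `|2 / pi - (S t - S (- t))| <= 4 / (1 + t).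
  move=> t0; rewrite SN opprK.
  have e0 := expR_gt0 (pi * t).
  have e1 : 1 + t <= expR (pi * t) + 1.
    have := expR_ge1Dx (pi * t).
    have : t <= pi * t by rewrite ler_peMl// (le_trans _ (pi_ge2 R))// ler1n.
    by move=> h1 h2; lra.
  have -> : 2 / pi - (S t + S t) = 4 / (pi * (expR (pi * t) + 1)).
    rewrite /S /sh /ch expRN.
    have e00 := lt0r_neq0 e0; have e10 : expR (pi * t) + 1 != 0 by rewrite lt0r_neq0// addr_gt0.
    have h3 : 1 + (expR (pi * t) + (expR (pi * t))^-1) / 2 =
      (expR (pi * t) + 1) ^+ 2 / (2 * expR (pi * t)) by field.
    rewrite h3; move: pi00 e00 e10; move: (expR (pi * t)) => y; move: (pi : R) => p p0 y0 y1.
    by field; rewrite p0 y0 y1.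
  have d1 : 0 < 1 + t by rewrite ltr_pwDl.
  have d2 : 0 < expR (pi * t) + 1 by rewrite addr_gt0.
  rewrite gtr0_norm ?divr_gt0 ?mulr_gt0// ler_wpM2l// lef_pV2 ?posrE ?mulr_gt0//.
  by apply: le_trans e1 _; rewrite ler_peMl ?(ltW d2)// (le_trans _ (pi_ge2 R))// ler1n.
apply: cvg_zero; apply: norm_cvg0.
have h0 : 4 * harmonic n @[n --> \oo] --> (0 : R).
  by rewrite -[X in _ --> X](mulr0 4); apply: cvgM; [exact: cvg_cst|exact: cvg_harmonic].
apply: (@squeeze_cvgr _ _ _ _ (cst 0) _ _ _ _ _ h0); last exact: cvg_cst.
apply: nearW => n /=; rewrite normr_ge0 -[X in X <= _]/(`|S n%:R - S (- n%:R) - 2 / pi|) distrC /=.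
by apply: le_trans (S1 _ (ler0n _ n)) _; rewrite (_ : n.+1%:R = 1 + n%:R :> R)// -natr1 addrC.
Qed.

Lemma intk0 phi : intk phi 0 0 = 2 / pi * cos phi.
Proof.
have mT : measurable (setT : set (measurableTypeR R)) by exact: measurableT.
have c00 : - (3 / 4) <= cos 0 :> R by rewrite cos0; lra.
have K := integrable_kern 0 0 c00.
have [_] := integrable_lin mT (cos phi) 0 K K.
rewrite -/(intk 0 0 0) intk00 mul0r addr0 mulrC => <-.
rewrite /intk; apply: eq_Rintegral => t _.
rewrite -[LHS]/(kern 0 phi 0 t) (kern0E phi 0 t) (kern0E 0 0 t).
by rewrite !(mul0r, add0r, addr0, cos0, mul1r).
Qed.

Lemma continuous_intk phi : {for 0, continuous (fun b => intk phi b 0)}.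
Proof.
have mT : measurable (setT : set (measurableTypeR R)) by exact: measurableT.
have c00 : - (3 / 4) <= cos 0 :> R by rewrite cos0; lra.
have I0 : (0 : R) \in `](-1), 1[%classic by rewrite inE /= in_itv/=; apply/andP; split; lra.
apply: (@continuity_under_integral R _ _ mu (fun b t => kern b phi 0 t) setT mT (-1) 1 _ _
  (fun t => 384 / (1 + t ^+ 2)) _ _ 0 I0).
- by move=> b _; exact: integrable_kern.
- apply: aeW => t _ b _.
  have -> : (fun b => kern b phi 0 t) =
      fun b => cos ((t : R) * b + phi) * (1 + ch (pi * (t : R)))^-1.
    by apply/funext => x; rewrite kern0E (mulrC x).
  apply: cvgM; last exact: cvg_cst.
  exact: is_derive_continuous (is_derive_phase_cos (t : R) phi b).
- exact: integrable_oneDsqrVZ.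
- by move=> b _; apply: aeW => t _; exact: kern_decay.
Qed.

Lemma intkE phi b : sh b * intk phi b 0 = b * (2 / pi * cos phi).
Proof.
have [->|b0] := eqVneq b 0; first by rewrite /sh oppr0 subrr mul0r !mul0r.
pose q x := sh x / x * intk phi x 0.
have qh x : q x = q (x / 2).
  rewrite /q -intk_halve.
  have e : x = 2 * (x / 2) by field.
  have -> : sh x = 2 * sh (x / 2) * ch (x / 2) by rewrite -sh2 -e.
  have [->|x0] := eqVneq x 0; first by rewrite !(mul0r, invr0, mulr0).
  by field.
have qn n : q (b / 2 ^+ n) = q b.
  elim: n => [|n <-]; first by rewrite expr0 divr1.
  by rewrite [RHS]qh exprS invfM [2^-1 * _]mulrC mulrA.
have xn0 (n : nat) : b / 2 ^+ n != 0 by rewrite mulf_neq0// invr_neq0// expf_neq0.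
have xn : b / 2 ^+ n @[n --> \oo] --> (0 : R).
  rewrite -[X in _ --> X](mulr0 b); apply: cvgM; first exact: cvg_cst.
  under eq_fun do rewrite -exprVn.
  by apply: cvg_expr; rewrite ger0_norm ?invr_ge0// invf_lt1// ltr1n.
have c1 : intk phi (b / 2 ^+ n) 0 @[n --> \oo] --> intk phi 0 0.
  have : (fun x => intk phi x 0) \o (fun n : nat => b / 2 ^+ n) @ \oo --> intk phi 0 0.
    by apply: (cvg_comp _ _ xn); exact: continuous_intk.
  exact.
have c2 : sh (b / 2 ^+ n) / (b / 2 ^+ n) @[n --> \oo] --> (1 : R).
  have [ds vs] := is_derive_sh (0 : R).
  have sh0 : sh 0 = 0 :> R by rewrite /sh oppr0 subrr mul0r.
  have ch0 : ch 0 = 1 :> R by rewrite /ch oppr0 expR0; field.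
  have : (fun h : R => h^-1 *: ((@sh R \o shift 0) (h *: (1 : R)) - sh 0)) @ 0^' --> (1 : R).
    by rewrite -[X in _ --> X]ch0 -vs; exact: ds.
  (* The slope of sinh at 0 is taken along b / 2^n, which never reaches 0; its limit is cosh 0 =
     1. *)
  move=> /cvgr_dnbhsP /(_ (fun n => b / 2 ^+ n) (conj xn0 xn)).
  under eq_fun => n do rewrite /= sh0 subr0 addr0 scaler1 /GRing.scale /= mulrC.
  exact.
have c3 := cvgM c2 c1.
have c4 : (fun=> q b) @ \oo --> 1 * intk phi 0 0.
  rewrite [X in X @ _ --> _](_ : _ = (fun n : nat => q (b / 2 ^+ n))); first exact: c3.
  by apply/funext => n; rewrite qn.
have : q b = 1 * intk phi 0 0 by exact: (cvg_unique _ (cvg_cst (q b)) c4).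
by rewrite mul1r intk0 => <-; rewrite /q; field.
Qed.

(* The value [1] at [b = 0] is the limit; the quotient would give [0] there. *)
Definition sinhc (b : R) : R := if b == 0 then 1 else b / sh b.

Lemma sh_neq0 (b : R) : b != 0 -> sh b != 0.
Proof.
move=> b0; apply/eqP => s0.
have : expR b = expR (- b) by move: s0; rewrite /sh; lra.
by move=> /expR_inj h; move: b0; rewrite -(inj_eq (@mulrI _ 2 _)) ?mulr0 ?unitfE//; lra.
Qed.

Lemma intk_sinhc phi b : intk phi b 0 = 2 / pi * cos phi * sinhc b.
Proof.
rewrite /sinhc; case: eqVneq => [->|b0]; first by rewrite intk0 mulr1.
have s0 := sh_neq0 b0.
apply: (mulfI s0); rewrite intkE.
have : pi != 0 :> R by rewrite lt0r_neq0 ?pi_gt0.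
by move: (pi : R) => p p0; field; rewrite s0 p0.
Qed.

Lemma beta0E t : beta0 t = pi / 2 / (1 + ch (pi * t)) :> R.
Proof. by rewrite /beta0 /ch addrC. Qed.

Lemma fourier_beta0 phi b :
  mu.-integrable [set: R] (EFin \o (fun t => beta0 t * cos (b * t + phi))) /\
  Rintegral mu setT (fun t => beta0 t * cos (b * t + phi)) = cos phi * sinhc b.
Proof.
have mT : measurable (setT : set (measurableTypeR R)) by exact: measurableT.
have c00 : - (3 / 4) <= cos 0 :> R by rewrite cos0; lra.
have K := integrable_kern b phi c00.
have [] := integrable_lin mT (pi / 2) 0 K K.
have -> : (fun t => pi / 2 * kern b phi 0 t + 0 * kern b phi 0 t) =
    fun t => beta0 t * cos (b * t + phi).
  by apply/funext => t; rewrite mul0r addr0 beta0E kern0E -!mulrA [cos _ * _]mulrC.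
move=> I ->; split => //.
rewrite mul0r addr0 -/(intk phi b 0) intk_sinhc.
have pi00 : pi != 0 :> R by rewrite lt0r_neq0 ?pi_gt0.
by move: pi00; move: (pi : R) => p p0; field.
Qed.

(** The phases 0 and - pi / 2 give the real and the imaginary part; the second vanishes with cos (-
    pi / 2). *)
Lemma cint_beta0 b :
  cintegrable setT (fun t => (beta0 t)%:C * cexp ((b * t) *i)) /\
  cint setT (fun t => (beta0 t)%:C * cexp ((b * t) *i)) = (sinhc b)%:C.
Proof.
have eR : (fun t => Re ((beta0 t)%:C * cexp ((b * t) *i))) =
    fun t => beta0 t * cos (b * t + 0).
  by apply/funext => t; rewrite cReM cexp_i /= mul0r subr0 addr0.
have eI : (fun t => Im ((beta0 t)%:C * cexp ((b * t) *i))) =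
    fun t => beta0 t * cos (b * t + - (pi / 2)).
  by apply/funext => t; rewrite cImM cexp_i /= mul0r addr0 cosBpihalf.
have [I1 E1] := fourier_beta0 0 b; have [I2 E2] := fourier_beta0 (- (pi / 2)) b.
split; first by split; rewrite ?eR ?eI.
apply: complexP; rewrite /cint /= ?eR ?eI.
- by rewrite E1 cos0 mul1r.
- by rewrite E2 cosN cos_pihalf mul0r.
Qed.

End FourierBeta.

(** * Cauchy integrals over circles *)

Section ComplexNorm.
Variable R : realType.
Local Notation C := R[i].
Implicit Types z w : C.

(** The norm on [R[i]] takes its values in [R[i]]; estimates are carried out on this real copy. *)
Definition cabs z : R := Re `|z|.

Lemma cabsE z : `|z| = (cabs z)%:C.
Proof. by rewrite RRe_real// normr_real. Qed.

Lemma cabs_ge0 z : 0 <= cabs z.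
Proof. by rewrite -ler0c -cabsE. Qed.

Lemma cabsM z w : cabs (z * w) = cabs z * cabs w.
Proof. by apply: complexI; rewrite -cabsE normrM !cabsE rmorphM. Qed.

Lemma cabsD z w : cabs (z + w) <= cabs z + cabs w.
Proof. by rewrite -lecR rmorphD /= -!cabsE ler_normD. Qed.

Lemma cabs_real (x : R) : cabs x%:C = `|x|.
Proof. by rewrite /cabs normc_def /= expr0n addr0 sqrtr_sqr. Qed.

Lemma cabs_cexp_i (u : R) : cabs (cexp (u *i)) = 1.
Proof. by rewrite /cabs normc_def cexp_i /= cos2Dsin2 sqrtr1. Qed.

Lemma cabs_Re_Im z : `|Re z| <= cabs z /\ `|Im z| <= cabs z.
Proof.
rewrite /cabs normc_def /=; split; rewrite -sqrtr_sqr ler_wsqrtr//.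
- by rewrite lerDl sqr_ge0.
- by rewrite lerDr sqr_ge0.
Qed.

Lemma cabs_le z : cabs z <= `|Re z| + `|Im z|.
Proof.
rewrite {1}(complexE z); apply: le_trans (cabsD _ _) _.
rewrite cabsM !cabs_real (_ : cabs 'i%C = 1) ?mul1r//.
by rewrite /cabs normc_def /= expr0n add0r expr1n sqrtr1.
Qed.

Lemma circ_center c r (u : R) : 0 < r -> `|circ c r u - c%:C| = r%:C.
Proof.
move=> r0; rewrite /circ addrAC subrr add0r cabsE cabsM cabs_real cabs_cexp_i mulr1.
by rewrite gtr0_norm.
Qed.

Lemma circ_Re_gt0 c r (u : R) : `|r| < c -> 0 < Re (circ c r u).
Proof.
move=> rc; rewrite /circ cReD cReM cexp_i /= mul0r subr0.
have : `|r * cos u| <= `|r| by rewrite normrM ler_piMr// cos_max.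
by rewrite ler_norml => /andP[h _]; lra.
Qed.

(** By the triangle inequality the pairs of centre and radius whose disc contains [z] form a convex
    set. Interpolated circles thus keep enclosing whatever both end circles enclose. *)
Lemma disc_convex z (c0 r0 c1 r1 t : R) : 0 <= t <= 1 ->
  `|z - c0%:C| < r0%:C -> `|z - c1%:C| < r1%:C ->
  `|z - (c0 + t * (c1 - c0))%:C| < (r0 + t * (r1 - r0))%:C.
Proof.
move=> /andP[t0 t1]; rewrite !cabsE !ltcR => h0 h1.
have -> : z - (c0 + t * (c1 - c0))%:C =
    (1 - t)%:C * (z - c0%:C) + t%:C * (z - c1%:C).
  by rewrite !(rmorphD, rmorphM, rmorphB, rmorph1) /=; ring.
apply: le_lt_trans (cabsD _ _) _; rewrite !cabsM !cabs_real ger0_norm ?subr_ge0// ger0_norm//.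
have [->|tn0] := eqVneq t 0; first by rewrite subr0 !mul0r mul1r !addr0.
have tp : 0 < t by rewrite lt_def tn0 t0.
have a1 : (1 - t) * cabs (z - c0%:C) <= (1 - t) * r0.
  by rewrite ler_wpM2l ?subr_ge0// ltW.
have a2 : t * cabs (z - c1%:C) < t * r1 by rewrite ltr_pM2l.
lra.
Qed.

End ComplexNorm.

(** * Cauchy's theorem for circles and the divided differences of the logarithm *)

Section Cauchy.
Variable R : realType.
Local Notation C := R[i].
Local Notation mu := (@lebesgue_measure R).
Implicit Types (g h : C -> C) (U : set C).

Lemma holomorphic_onS U V g g' : U `<=` V -> holomorphic_on V g g' -> holomorphic_on U g g'.
Proof.
move=> UV [d c c']; split.
- by move=> f x a Uf; apply: d => t; exact/UV/Uf.
- by move=> T f p Uf; apply: c => t; exact/UV/Uf.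
- by move=> T f p Uf; apply: c' => t; exact/UV/Uf.
Qed.

Lemma holomorphic_onM U g g' h h' : holomorphic_on U g g' -> holomorphic_on U h h' ->
  holomorphic_on U (fun z => g z * h z) (fun z => g z * h' z + g' z * h z).
Proof.
move=> [dg cg cg'] [dh ch ch']; split.
- move=> f x a Uf fa; apply: cderive_eq (cderiveM (dg _ _ _ Uf fa) (dh _ _ _ Uf fa)) _.
  by ring.
- by move=> T f p Uf fp; apply: ccontinuousM; [exact: cg|exact: ch].
- move=> T f p Uf fp; apply: ccontinuousD; apply: ccontinuousM.
  + exact: cg.
  + exact: ch'.
  + exact: cg'.
  + exact: ch.
Qed.

Lemma holomorphic_onV U g g' : (forall z, U z -> g z != 0) -> holomorphic_on U g g' ->
  holomorphic_on U (fun z => (g z)^-1) (fun z => (- g' z) * ((g z)^-1 * (g z)^-1)).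
Proof.
move=> g0 [dg cg cg']; split.
- move=> f x a Uf fa.
  apply: cderive_eq (@cderiveV R (fun t => g (f t)) x _ (g0 _ (Uf x)) (dg _ _ _ Uf fa)) _.
  by rewrite -mulNr expr2 invfM; ring.
- move=> T f p Uf fp; apply: (@ccontinuousV R T (fun t => g (f t))); first exact/g0/Uf.
  exact: cg.
- move=> T f p Uf fp.
  have cV : ccontinuous_at (fun t => (g (f t))^-1) p.
    apply: (@ccontinuousV R T (fun t => g (f t))); first exact/g0/Uf.
    exact: cg.
  apply: ccontinuousM; last exact: ccontinuousM.
  have -> : (fun t => - g' (f t)) = fun t => (- 1) * g' (f t).
    by apply/funext => t; rewrite mulN1r.
  by apply: ccontinuousM; [exact: ccontinuous_cst|exact: cg'].
Qed.

Definition right_half : set C := [set z | 0 < Re z].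

Lemma right_half_neq0 z : right_half z -> z != 0.
Proof. by move=> z0; apply/eqP => zE; move: z0; rewrite /right_half /= zE ltxx. Qed.

Lemma holomorphic_on_id U : holomorphic_on U id (fun=> 1).
Proof.
split=> [f x a _ fa|T f p _ //|T f p _ _]; last exact: ccontinuous_cst.
by apply: cderive_eq fa _; rewrite mul1r.
Qed.

Lemma holomorphic_on_inv : holomorphic_on right_half (fun z => z^-1)
  (fun z => (- 1) * (z^-1 * z^-1)).
Proof. exact: holomorphic_onV right_half_neq0 (holomorphic_on_id _). Qed.

Lemma holomorphic_on_clog : holomorphic_on right_half (@clog R) (fun z => z^-1).
Proof.
split.
- move=> f x a Uf fa; apply: cderive_eq (cderive_clog Uf fa) _.
  by rewrite mulrC.
- by move=> T f p Uf fp; exact: ccontinuous_clog.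
- move=> T f p Uf fp; apply: ccontinuousV => //.
  exact/right_half_neq0/Uf.
Qed.

Lemma holomorphic_on_horner U (p : {poly C}) :
  holomorphic_on U (horner p) (horner p^`()).
Proof.
suff H (q : {poly C}) : (forall (f : R -> C) x a, cderive f x a ->
      cderive (fun t => q.[f t]) x (q^`().[f x] * a)) /\
    forall (T : topologicalType) (f : T -> C) x, ccontinuous_at f x ->
      ccontinuous_at (fun t => q.[f t]) x.
  split=> [f x a _|T f x _|T f x _]; [exact: (H p).1|exact: (H p).2|exact: (H _).2].
elim/poly_ind: q => [|q c [IHd IHc]].
  split=> [f x a _|T f x _].
    rewrite deriv0 horner0 mul0r; apply: cderive_ext (cderive_cst 0 x) _ => t.
    by rewrite horner0.
  have -> : (fun t => (0 : {poly C}).[f t]) = fun=> 0 by apply/funext => t; rewrite horner0.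
  exact: ccontinuous_cst.
have qE (T : Type) (f : T -> C) :
    (fun t => (q * 'X + c%:P).[f t]) = fun t => q.[f t] * f t + c.
  by apply/funext => t; rewrite hornerMXaddC.
split=> [f x a fa|T f x fx]; rewrite qE.
  apply: cderive_eq (cderiveD (cderiveM (IHd _ _ _ fa) fa) (cderive_cst c x)) _.
  by rewrite derivMXaddC hornerD hornerMX addr0; ring.
by apply: ccontinuousD; [apply: ccontinuousM => //; exact: IHc|exact: ccontinuous_cst].
Qed.

Lemma ccontinuous_circ c r (u : R) : ccontinuous_at (circ c r) u.
Proof.
apply: ccontinuousD; first exact: ccontinuous_cst.
apply: ccontinuousM; first exact: ccontinuous_cst.
exact: cderive_continuous (cderive_cexp_i u).
Qed.

Lemma cderive_circ c r (u : R) : cderive (circ c r) u (circ' r u).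
Proof.
apply: cderive_eq (cderiveD (cderive_cst c%:C u) (cderiveZ r%:C (cderive_cexp_i u))) _.
by rewrite add0r /circ' mulrCA mulrA.
Qed.

Lemma ccontinuous_circ' r (u : R) : ccontinuous_at (circ' r) u.
Proof.
apply: ccontinuousM; first exact: ccontinuous_cst.
exact: cderive_continuous (cderive_cexp_i u).
Qed.

Lemma circ_per c r : circ c r 0 = circ c r (2 * pi) :> C.
Proof. by rewrite /circ !cexp_i mulr_natl cos2pi sin2pi cos0 sin0. Qed.

Definition oint g (c r : R) : C := cint `[0, 2 * pi] (fun u => g (circ c r u) * circ' r u).

Lemma oint_integrable U g g' c r : holomorphic_on U g g' -> (forall u, U (circ c r u)) ->
  cintegrable `[0, 2 * pi] (fun u => g (circ c r u) * circ' r u).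
Proof.
move=> [_ cg _] Uc; apply: cintegrable_continuous => u; apply: ccontinuousM.
  by apply: (cg _ (circ c r)) => //; exact: ccontinuous_circ.
exact: ccontinuous_circ'.
Qed.

Lemma oint_homotopy U g g' (c0 r0 c1 r1 : R) : holomorphic_on U g g' ->
  (forall t u, 0 <= t <= 1 -> U (circ (c0 + t * (c1 - c0)) (r0 + t * (r1 - r0)) u)) ->
  oint g c0 r0 = oint g c1 r1.
Proof.
move=> hg UU.
(* The family must be admissible at every real parameter: sin^2 stays in [0, 1] and equals 0 at 0
   and 1 at [pi / 2]. *)
pose T (s : R) : R := sin s * sin s.
have T01 s : 0 <= T s <= 1.
  by rewrite /T -expr2 sqr_ge0 /= sin2cos2 lerBlDr lerDl sqr_ge0.
have dT s : is_derive s (1 : R) T (sin s * cos s + cos s * sin s).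
  exact: is_derive_mul (is_derive_sin s) (is_derive_sin s).
have dl (a b s : R) : is_derive s (1 : R) (fun s => a + T s * b)
    ((sin s * cos s + cos s * sin s) * b).
  apply: is_derive_eq (is_deriveD (is_derive_cst a s (1 : R))
    (is_derive_mul (dT s) (is_derive_cst b s (1 : R)))) _.
  by rewrite /= mulr0 !add0r.
have cl (b : R) : continuous (fun s => (sin s * cos s + cos s * sin s) * b).
  move=> s; apply: cvgM; last exact: cvg_cst.
  by apply: cvgD; apply: cvgM; [exact: continuous_sin|exact: continuous_cos|
    exact: continuous_cos|exact: continuous_sin].
have := cint_circ_cst hg (dl c0 (c1 - c0)) (dl r0 (r1 - r0)) (cl _) (cl _)
  (fun s u => UU (T s) u (T01 s)) 0 (pi / 2).
by rewrite /T sin0 sin_pihalf !mul0r !addr0 !mul1r !(addrC _ (_ - _)) !subrK.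
Qed.

(* The circles of radius [r * sin s] interpolate between the given circle and  *)
(* its centre.                                                                 *)
Lemma mean_value g g' (a r : R) : holomorphic_on right_half g g' -> 0 < r < a ->
  cint `[0, 2 * pi] (fun u => g (circ a r u)) = (2 * pi)%:C * g a%:C.
Proof.
move=> [dg cg cg'] /andP[r0 ra].
pose e (u : R) : C := cexp (u *i).
have de u : cderive e u ('i%C * e u) by exact: cderive_cexp_i.
pose rr (s : R) : R := r * sin s.
have drr s : is_derive s (1 : R) rr (r * cos s).
  apply: is_derive_eq (is_derive_mul (is_derive_cst r s (1 : R)) (is_derive_sin s)) _.
  by rewrite mul0r addr0.
have crr : continuous rr by move=> s; exact: is_derive_continuous (drr s).
have crc : continuous (fun s => r * cos s).
  by move=> s; apply: cvgM; [exact: cvg_cst|exact: continuous_cos].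
have UU s u : right_half (circ a (rr s) u).
  apply: circ_Re_gt0; apply: le_lt_trans ra; rewrite normrM gtr0_norm//.
  by rewrite -[leRHS]mulr1 ler_pM2l// sin_max.
pose f s u := g (circ a (rr s) u).
pose f' s u := g' (circ a (rr s) u) * ((r * cos s)%:C * e u).
(* The integrand carries no [circ'], yet its s-derivative is exact: the radial velocity r cos s
   e^(iu) is cos s / (i sin s) times the angular velocity i r sin s e^(iu). Where sin s = 0 the
   circle is the point [a], the factor [g'] is constant, and e^(iu) / i is the primitive. *)
pose W s u : C := if sin s == 0 then g' a%:C * ((r * cos s)%:C * (e u / 'i%C))
  else g (circ a (rr s) u) * (((cos s / sin s)%:C) / 'i%C).
have i0 : 'i%C != 0 :> C by rewrite eq_complex /= oner_eq0 andbF.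
have cfst (h : R -> R) (p : R * R) : continuous h ->
    ccontinuous_at (fun p : R * R => (h p.1)%:C) p.
  move=> ch; apply: (@ccontinuous_real _ _ (fun p : R * R => h p.1)).
  apply: (@continuous_comp _ _ _ (@fst R R)); last exact: ch.
  by case: p => x y; exact: cvg_fst.
have ce (p : R * R) : ccontinuous_at (fun p : R * R => e p.2) p.
  by apply: ccontinuous_cexp_i; case: p => x y; exact: cvg_snd.
have ccirc (p : R * R) : ccontinuous_at (fun p : R * R => circ a (rr p.1) p.2) p.
  apply: ccontinuousD; first exact: ccontinuous_cst.
  by apply: ccontinuousM; [exact: cfst|exact: ce].
have H : cint `[0, 2 * pi] (f (pi / 2)) = cint `[0, 2 * pi] (f 0).
  apply: (@cint_family_cst R 0 (2 * pi) f f' W).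
  - by rewrite mulr_gt0// pi_gt0.
  - move=> s u; apply: (dg (fun s => circ a (rr s) u)); first by move=> t; exact: UU.
    apply: cderive_eq (cderiveD (cderive_cst a%:C s)
      (cderiveM (cderive_real (drr s)) (cderive_cst (e u) s))) _.
    by rewrite mulr0 !add0r.
  - move=> p; apply: ccontinuousM.
      apply: (cg' _ (fun p : R * R => circ a (rr p.1) p.2)); last exact: ccirc.
      by move=> q; exact: UU.
    by apply: ccontinuousM; [exact: (cfst (fun s => r * cos s))|exact: ce].
  - move=> s u; apply: (cg _ (circ a (rr s))); first exact: UU.
    exact: ccontinuous_circ.
  - move=> s u; have [s0|s0] := eqVneq (sin s) 0.
      have -> : W s = fun u => g' a%:C * ((r * cos s)%:C * (e u / 'i%C)).
        by apply/funext => v; rewrite /W s0 eqxx.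
      apply: cderive_eq (cderiveZ _ (cderiveZ _ (cderiveM (de u) (cderive_cst 'i%C^-1 u)))) _.
      rewrite mulr0 add0r /f' /circ /rr s0 mulr0 mul0r addr0.
      by rewrite mulrAC mulfV// mul1r.
    have -> : W s = fun u => g (circ a (rr s) u) * (((cos s / sin s)%:C) / 'i%C).
      by apply/funext => v; rewrite /W (negbTE s0).
    apply: cderive_eq (cderiveM (dg _ _ _ (UU s) (cderive_circ a (rr s) u)) (cderive_cst _ u)) _.
    have s0' : (sin s)%:C != 0 :> C by rewrite (inj_eq (@complexI _) _ 0).
    have hh : circ' (rr s) u * ((cos s / sin s)%:C / 'i%C) = (r * cos s)%:C * e u.
      rewrite /circ' /rr -/(e u); move: (e u) => y.
      have -> : (cos s / sin s)%:C = (cos s)%:C / (sin s)%:C :> C by rewrite fmorph_div.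
      by rewrite !rmorphM /=; field; rewrite i0 s0'.
    by rewrite mulr0 add0r /f' -mulrA hh.
  - move=> s; rewrite /W /e (circ_per a (rr s)) !cexp_i mulr_natl cos2pi sin2pi cos0 sin0.
    by [].
move: H; rewrite /f /rr sin_pihalf sin0 mulr1 mulr0 => ->.
have -> : (fun u => g (circ a 0 u)) = fun u => g a%:C * 1.
  by apply/funext => u; rewrite /circ mul0r addr0 mulr1.
have m02 : measurable (`[0, 2 * pi]%classic : set (measurableTypeR R)) by exact: measurable_itv.
rewrite cintZ//; last first.
  by apply: cintegrable_continuous => u; exact: ccontinuous_cst.
rewrite mulrC; congr (_ * _).
have := @cint_derive R 0 (2 * pi) (fun u => u%:C) (fun=> 1).
rewrite subr0; apply.
- by rewrite mulr_gt0// pi_gt0.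
- by move=> u; apply: (@cderive_real R id); exact: is_derive_id.
- by move=> u; exact: ccontinuous_cst.
Qed.

Lemma oint_exact U g g' c r : holomorphic_on U g g' -> (forall u, U (circ c r u)) ->
  oint g' c r = 0.
Proof.
move=> [dg cg cg'] Uc.
rewrite /oint (@cint_derive R 0 (2 * pi) (fun u => g (circ c r u))).
- by rewrite -circ_per subrr.
- by rewrite mulr_gt0// pi_gt0.
- by move=> u; apply: dg => //; exact: cderive_circ.
- move=> u; apply: ccontinuousM; last exact: ccontinuous_circ'.
  by apply: (cg' _ (circ c r)) => //; exact: ccontinuous_circ.
Qed.

Definition punctured (a : C) : set C := [set z | 0 < Re z /\ z != a].

Lemma circ_punctured (a c r u : R) : 0 < r < c -> `|a%:C - c%:C| < r%:C ->
  punctured a%:C (circ c r u).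
Proof.
move=> /andP[r0 rc] ac; split; first by apply: circ_Re_gt0; rewrite gtr0_norm.
by apply: contraTneq ac => <-; rewrite circ_center// ltxx.
Qed.

Lemma holomorphic_on_XsubV a : holomorphic_on (punctured a) (fun z => (z - a)^-1)
  (fun z => (- 1) * ((z - a)^-1 * (z - a)^-1)).
Proof.
have h := @holomorphic_on_horner (punctured a) ('X - a%:P).
have : holomorphic_on (punctured a) (fun z => z - a) (fun=> 1).
  have e1 : horner ('X - a%:P) = fun z => z - a by apply/funext => z; rewrite hornerXsubC.
  have e2 : horner ('X - a%:P)^`() = fun=> 1.
    by apply/funext => z; rewrite derivXsubC hornerC.
  by rewrite -e1 -e2.
apply: holomorphic_onV => z [_ za].
by rewrite subr_eq0.
Qed.

Lemma punctured_right a : punctured a `<=` right_half.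
Proof. by move=> z []. Qed.

(** The circle is deformed, without meeting [a], into the one centred at [a] of radius [a / 2],
    which stays in the right half-plane. There dz / (z - a) = i du, and the mean value property
    applies. *)
Lemma cauchy_formula g g' (a c r : R) : holomorphic_on right_half g g' ->
  0 < r < c -> `|a%:C - c%:C| < r%:C ->
  oint (fun z => g z * (z - a%:C)^-1) c r = (2 * pi)%:C * 'i%C * g a%:C.
Proof.
move=> hg rc ac.
have a0 : 0 < a.
  move: ac; rewrite -rmorphB cabsE ltcR cabs_real ltr_norml => /andP[h1 h2]; lra.
have h := holomorphic_onM (holomorphic_onS (@punctured_right a%:C) hg)
  (holomorphic_on_XsubV a%:C).
rewrite (@oint_homotopy _ _ _ c r a (a / 2) h).
- have a2 : 0 < a / 2 < a by apply/andP; split; lra.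
  have := mean_value hg a2.
  rewrite /oint => E.
  have m02 : measurable (`[0, 2 * pi]%classic : set (measurableTypeR R)) by exact: measurable_itv.
  transitivity (cint `[0, 2 * pi] (fun u => 'i%C * g (circ a (a / 2) u))).
    apply: eq_cint => u _.
    have -> : circ a (a / 2) u - a%:C = (a / 2)%:C * cexp (u *i).
      by rewrite /circ addrAC subrr add0r.
    have e0 : cexp (u *i) != 0 :> C by rewrite -normr_eq0 cabsE cabs_cexp_i oner_eq0.
    have a20 : (a / 2)%:C != 0 :> C.
      by rewrite (inj_eq (@complexI _) _ 0) lt0r_neq0//; case/andP: a2.
    rewrite /circ'; move: (cexp _) e0 (a / 2)%:C a20 (g _) => y y0 x x0 w.
    by field; rewrite ?y0 ?x0.
  rewrite cintZ//; first by rewrite E; ring.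
  apply: cintegrable_continuous => u; case: hg => _ cg _.
  apply: (cg _ (circ a (a / 2))); last exact: ccontinuous_circ.
  by move=> t; apply: circ_Re_gt0; rewrite gtr0_norm; lra.
- move=> t u t01; apply: circ_punctured.
    case/andP: rc => r0 rc'; case/andP: t01 => t0 t1.
    have [->|tn0] := eqVneq t 0; first by apply/andP; split; lra.
    have tp : 0 < t by rewrite lt_def tn0 t0.
    have h1 := mulr_gt0 tp a0.
    have h2 : 0 <= (1 - t) * r by rewrite mulr_ge0 ?subr_ge0// ltW.
    have h3 : 0 <= (1 - t) * (c - r) by rewrite mulr_ge0 ?subr_ge0// ltW.
    by apply/andP; split; lra.
  apply: disc_convex => //.
  by rewrite subrr normr0 ltcR; lra.
Qed.

Definition ln_dd (a b : R) : R := if a == b then a^-1 else (ln a - ln b) / (a - b).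

(** For distinct points, partial fractions reduce to two Cauchy formulas. For [a = b] the derivative
    of log z / (z - a) integrates to zero, so log z / (z - a)^2 has the same integral as z^-1 / (z -
    a). *)
Lemma oint_clog_dd (a b c r : R) : 0 < r < c -> `|a%:C - c%:C| < r%:C -> `|b%:C - c%:C| < r%:C ->
  oint (fun z => clog z * ((z - a%:C)^-1 * (z - b%:C)^-1)) c r =
    (2 * pi)%:C * 'i%C * (ln_dd a b)%:C.
Proof.
move=> rc ac bc.
have m02 : measurable (`[0, 2 * pi]%classic : set (measurableTypeR R)) by exact: measurable_itv.
have pos x : `|x%:C - c%:C| < r%:C -> 0 < x.
  rewrite -rmorphB cabsE ltcR cabs_real ltr_norml => /andP[h1 h2].
  by case/andP: rc => r0 rc; lra.
have a0 := pos _ ac; have b0 := pos _ bc.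
have hl x : holomorphic_on (punctured x%:C) (@clog R) (fun z => z^-1).
  exact: holomorphic_onS (@punctured_right x%:C) holomorphic_on_clog.
have ca u := circ_punctured u rc ac; have cb u := circ_punctured u rc bc.
rewrite /ln_dd; case: eqVneq => [ab|ab].
- rewrite -ab.
  have h := holomorphic_onM (hl a) (holomorphic_on_XsubV a%:C).
  have := oint_exact h ca.
  have hi := holomorphic_onM (holomorphic_onS (@punctured_right a%:C) holomorphic_on_inv)
    (holomorphic_on_XsubV a%:C).
  have hd := holomorphic_onM (hl a) (holomorphic_onM (holomorphic_on_XsubV a%:C)
    (holomorphic_on_XsubV a%:C)).
  have Ii := oint_integrable hi ca; have Id := oint_integrable hd ca.
  have Ci := cauchy_formula holomorphic_on_inv rc ac.
  have -> : oint (fun z => clog z * (-1 * ((z - a%:C)^-1 * (z - a%:C)^-1)) + z^-1 / (z - a%:C)) c r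
    = - oint (fun z => clog z * ((z - a%:C)^-1 * (z - a%:C)^-1)) c r
      + oint (fun z => z^-1 / (z - a%:C)) c r.
    rewrite -[- oint _ c r]mulN1r /oint -(cintZ m02 _ Id) -(cintD m02)//.
      by apply: eq_cint => u _; ring.
    exact: cintegrableZ.
  rewrite Ci addrC => /eqP; rewrite subr_eq0 => /eqP <-.
  by rewrite fmorphV.
- have ab0 : a%:C - b%:C != 0 :> C.
    by rewrite subr_eq0 (inj_eq (@complexI _)).
  have ha := holomorphic_onM (hl a) (holomorphic_on_XsubV a%:C).
  have hb := holomorphic_onM (hl b) (holomorphic_on_XsubV b%:C).
  have Ia := oint_integrable ha ca; have Ib := oint_integrable hb cb.
  transitivity ((a%:C - b%:C)^-1 * (oint (fun z => clog z * (z - a%:C)^-1) c r)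
     + (- (a%:C - b%:C)^-1) * (oint (fun z => clog z * (z - b%:C)^-1) c r)).
    rewrite /oint -(cintZ m02 _ Ia) -(cintZ m02 _ Ib) -(cintD m02); last 2 first.
    + exact: cintegrableZ.
    + exact: cintegrableZ.
    apply: eq_cint => u _.
    have [_ na] := ca u; have [_ nb] := cb u.
    move: (circ c r u) (circ' r u) na nb => z w na nb.
    by field; rewrite ab0 !subr_eq0 na nb.
  rewrite (cauchy_formula holomorphic_on_clog rc ac) (cauchy_formula holomorphic_on_clog rc bc).
  by rewrite !clog_real// fmorph_div !rmorphB /=; ring.
Qed.

End Cauchy.

(** * Spectral calculus and restriction to a subalgebra *)

Section Spectral.
Local Open Scope sesquilinear_scope.
Variables (R : realType) (n : nat).
Local Notation C := R[i].
Local Notation op := 'M[C]_n.+1.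
Implicit Types (A X Y : op) (f g : C -> C).

Lemma specfunM f g A : specfun f A *m specfun g A = specfun (fun x => f x * g x) A.
Proof.
rewrite /specfun; move: (spectralmx A) (spectral_diag A) (spectral_unit A) => V d uV.
rewrite !mulmxA (mulmxK uV); congr (_ *m V); rewrite -!mulmxA; congr (_ *m _).
by apply/matrixP => i j; rewrite mul_diag_mx !mxE mulrnAr.
Qed.

Lemma eq_specfun f g A : (forall i, f (spectral_diag A 0 i) = g (spectral_diag A 0 i)) ->
  specfun f A = specfun g A.
Proof.
rewrite /specfun; move: (spectralmx A) (spectral_diag A) => V d fg.
have -> : map_mx f d = map_mx g d by apply/rowP => i; rewrite !mxE fg.
by [].
Qed.

Lemma specfun_cst (c : C) A : specfun (fun=> c) A = c%:M.
Proof.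
rewrite /specfun; move: (spectralmx A) (spectral_diag A) (spectral_unit A) => V d uV.
have -> : map_mx (fun=> c) d = const_mx c by apply/rowP => i; rewrite !mxE.
by rewrite diag_const_mx scalar_mxC -mulmxA (mulVmx uV) mulmx1.
Qed.

Lemma specfunB f g A : specfun (fun x => f x - g x) A = specfun f A - specfun g A.
Proof.
rewrite /specfun; move: (spectralmx A) (spectral_diag A) => V d.
have -> : map_mx (fun x => f x - g x) d = map_mx f d - map_mx g d.
  by apply/rowP => i; rewrite !mxE.
by rewrite linearB /= mulmxBr mulmxBl.
Qed.

Lemma specfun_id A : A \is normalmx -> specfun id A = A.
Proof.
move=> /orthomx_spectralP nA; rewrite [RHS]nA /specfun.
move: (spectralmx A) (spectral_diag A) => V d.
by have -> : map_mx id d = d by apply/rowP => i; rewrite !mxE.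
Qed.

Lemma specfun_adj f A : (specfun f A)^t* = specfun (fun x => ((f x)^*)%R) A.
Proof.
rewrite /specfun (invmx_unitary (spectral_unitarymx A)).
move: (spectralmx A) (spectral_diag A) => V d.
rewrite !trmx_mul !map_mxM trmxCK tr_diag_mx map_diag_mx mulmxA.
by congr (_ *m diag_mx _ *m _); apply/rowP => i; rewrite !mxE.
Qed.

Lemma tr_specfun f A : \tr (specfun f A) = \sum_i f (spectral_diag A 0 i).
Proof.
rewrite /specfun; move: (spectralmx A) (spectral_diag A) (spectral_unit A) => V d uV.
rewrite mxtrace_mulC mulmxA (mulmxV uV) mul1mx mxtrace_diag.
by apply: eq_bigr => i _; rewrite !mxE.
Qed.

Lemma spectral_diag_scalar (a : C) i : spectral_diag (a%:M : op) 0 i = a.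
Proof.
have nA : (a%:M : op) \is normalmx.
  by apply/normalmxP; rewrite tr_scalar_mx map_scalar_mx scalar_mxC.
have := orthomx_spectralP nA.
move: (spectralmx _) (spectral_diag _) (spectral_unit (a%:M : op)) => V d uV.
move=> /(congr1 (fun X => V *m X *m invmx V)).
rewrite !mulmxA (mulmxV uV) mul1mx (mulmxK uV) scalar_mxC (mulmxK uV).
by move=> /matrixP /(_ i i); rewrite !mxE eqxx !mulr1n => <-.
Qed.

Lemma specfun_scalar f (a : C) : specfun f (a%:M : op) = (f a)%:M.
Proof.
rewrite -(specfun_cst (f a) (a%:M : op)); apply: eq_specfun => i.
by rewrite spectral_diag_scalar.
Qed.

Lemma prod_specfun (I : finType) (P : pred I) (F : I -> C -> C) A :
  \prod_(i | P i) specfun (F i) A = specfun (fun x => \prod_(i | P i) F i x) A.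
Proof.
elim: (index_enum I) => [|i s IH].
  rewrite big_nil -[LHS](specfun_cst 1 A); congr specfun.
  by apply/funext => x; rewrite big_nil.
have -> : (fun x => \prod_(j <- i :: s | P j) F j x) = fun x =>
    if P i then F i x * \prod_(j <- s | P j) F j x else \prod_(j <- s | P j) F j x.
  by apply/funext => x; rewrite big_cons.
rewrite big_cons IH; case: (P i); last reflexivity.
exact: (specfunM (F i) _ A).
Qed.

(** Being comparable with 0 forces the quadratic form to be real, so the form of X - X^* vanishes on
    the diagonal. Polarisation with u + v and u + i v makes it vanish altogether. *)
Lemma psd_hermitian k (X : 'M[C]_k) : psd X -> X^t* = X.
Proof.
move=> pX.
pose b (u v : 'cV[C]_k) := (u^t* *m (X - X^t*) *m v) 0 0.
have b0 v : b v v = 0.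
  have /ger0_real /CrealP h := pX v.
  rewrite /b mulmxBr mulmxBl mxE [X in _ + X]mxE.
  have -> : (v^t* *m X^t* *m v) 0 0 = (((v^t* *m X *m v) 0 0)^*)%R.
    have -> : v^t* *m X^t* *m v = (v^t* *m X *m v)^t*.
      by rewrite !trmx_mul !map_mxM trmxCK mulmxA.
    by rewrite !mxE.
  by rewrite h subrr.
have bD u v w z : b (u + v) (w + z) = b u w + b u z + b v w + b v z.
  have e : (u + v)^t* = u^t* + v^t* by apply/matrixP => i j; rewrite !mxE rmorphD.
  rewrite /b e; move: (X - X^t*) (u^t*) (v^t*) => K u' v'.
  have aE (A B : 'M[C]_1) : (A + B) 0 0 = A 0 0 + B 0 0 by rewrite mxE.
  by rewrite !mulmxDl !mulmxDr !aE !addrA.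
have bZr u v c : b u (c *: v) = c * b u v by rewrite /b -scalemxAr mxE.
have bZl u v c : b (c *: u) v = (c^*)%R * b u v.
  have e : (c *: u)^t* = (c^*)%R *: u^t* by apply/matrixP => i j; rewrite !mxE rmorphM.
  by rewrite /b e -!scalemxAl mxE.
have bs u v : b u v = 0.
  have h1 : b u v + b v u = 0.
    by have := b0 (u + v); rewrite bD !b0 add0r addr0.
  have h2 : b u v - b v u = 0.
    have := b0 (u + 'i%R *: v); rewrite bD bZr !bZl bZr !b0 !mulr0 add0r addr0 conjCi.
    by rewrite mulNr -mulrBr => /eqP; rewrite mulf_eq0 (negbTE (neq0Ci _)) /= => /eqP.
  have : 2 * b u v = (b u v + b v u) + (b u v - b v u) by ring.
  by rewrite h1 h2 addr0 => /eqP; rewrite mulf_eq0 pnatr_eq0 /= => /eqP.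
apply/eqP; rewrite eq_sym -subr_eq0; apply/eqP/matrixP => i j.
have := bs (delta_mx i 0) (delta_mx j 0).
by rewrite /b trmx_delta map_delta_mx -rowE -colE !mxE.
Qed.

Lemma hermitian_normal A : A^t* = A -> A \is normalmx.
Proof. by move=> h; apply/normalmxP; rewrite h. Qed.

Lemma tr_adj_mul_eq0 Y : \tr (Y *m Y^t*) = 0 -> Y = 0.
Proof.
have -> : \tr (Y *m Y^t*) = \sum_i \sum_j `|Y i j| ^+ 2.
  by apply: eq_bigr => i _; rewrite mxE; apply: eq_bigr => j _; rewrite !mxE normCK.
move=> /eqP; rewrite psumr_eq0; last first.
  by move=> i _; apply: sumr_ge0 => j _; exact: exprn_ge0.
move=> /allP h; apply/matrixP => i j.
have := h i (mem_index_enum i); rewrite /= psumr_eq0; last first.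
  by move=> k _; exact: exprn_ge0.
move=> /allP /(_ j (mem_index_enum j)) /=.
by rewrite expf_eq0 normr_eq0 /= => /eqP ->; rewrite mxE.
Qed.

Lemma mxtrace_adj X : \tr (X^t*) = ((\tr X)^*)%R.
Proof. by rewrite /mxtrace rmorph_sum; apply: eq_bigr => i _; rewrite !mxE. Qed.

Lemma adjM X Y : (X *m Y)^t* = Y^t* *m X^t*.
Proof. by rewrite trmx_mul map_mxM. Qed.

Section Restriction.
Variable M : {aspace op}.
Hypothesis vM : is_vN M.

Lemma is_vN_mul X Y : X \in M -> Y \in M -> X *m Y \in M.
Proof. by move=> XM YM; apply: (subvP (asubv M)); exact: memv_mul. Qed.

(** The difference of two candidates is tested against its own adjoint, which lies in [M]; the trace
    is then its squared Frobenius norm. *)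
Lemma restr_uniq X Y : Y \in M -> {in M, forall phi, \tr (Y *m phi) = \tr (X *m phi)} ->
  restr M X = Y.
Proof.
move=> YM YX; rewrite /restr; case: xgetP => [Z _ [ZM ZX]|/(_ Y)]; last first.
  by case.
apply/eqP; rewrite -subr_eq0; apply/eqP; apply: tr_adj_mul_eq0.
have hM : (Z - Y)^t* \in M by case: vM => _; apply; rewrite rpredB.
by rewrite mulmxBl linearB /= ZX// YX// subrr.
Qed.

(** [G] is the Gram matrix of the trace form in a basis of [M]. A vector in its kernel gives [Y] in
    [M] orthogonal to all of [M], in particular to [Y^t*], hence zero; so the linear system for the
    coordinates is solvable. *)
Lemma restr_exists X : exists Y, Y \in M /\ {in M, forall phi, \tr (Y *m phi) = \tr (X *m phi)}.
Proof.
pose e := vbasis M.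
pose G := \matrix_(i < \dim M, j < \dim M) \tr (e`_i *m e`_j).
have eM (i : 'I_(\dim M)) : e`_i \in M by rewrite vbasis_mem// mem_nth// size_tuple.
have trE (u : 'rV[C]_(\dim M)) (j : 'I_(\dim M)) :
    \tr ((\sum_i u 0 i *: e`_i) *m e`_j) = (u *m G) 0 j.
  rewrite mulmx_suml linear_sum mxE; apply: eq_bigr => i _.
  by rewrite -scalemxAl linearZ /= mxE.
have uG : G \in unitmx.
  rewrite -row_free_unit -kermx_eq0; apply/eqP/row_matrixP => k.
  rewrite row0; apply/eqP.
  have : (row k (kermx G) <= kermx G)%MS by exact: row_sub.
  move: (row k (kermx G)) => u /sub_kermxP u0.
  pose Y : op := \sum_i u 0 i *: e`_i.
  have YM : Y \in M by apply: rpred_sum => i _; exact: rpredZ.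
  have Y0 : Y = 0.
    apply: tr_adj_mul_eq0.
    have hM : Y^t* \in M by case: vM => _; apply.
    rewrite (coord_vbasis hM) mulmx_sumr linear_sum big1// => j _.
    by rewrite -scalemxAr linearZ /= trE u0 mxE mulr0.
  have /freeP fe : free e by exact: (basis_free (vbasisP M)).
  apply/eqP/rowP => i; rewrite mxE; exact: (fe (fun i => u 0 i) Y0).
pose b := \row_(j < \dim M) \tr (X *m e`_j).
exists (\sum_i (b *m invmx G) 0 i *: e`_i); split.
  by apply: rpred_sum => i _; exact: rpredZ.
move=> phi pM; rewrite (coord_vbasis pM) !mulmx_sumr !linear_sum.
apply: eq_bigr => j _; rewrite -!scalemxAr !linearZ /= trE mulmxKV//.
by rewrite mxE.
Qed.

Lemma restrP X : restr M X \in M /\ {in M, forall phi, \tr (restr M X *m phi) = \tr (X *m phi)}.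
Proof. by have [Y [YM YX]] := restr_exists X; rewrite (restr_uniq YM YX). Qed.

Lemma restr_linear a X Y : restr M (a *: X + Y) = a *: restr M X + restr M Y.
Proof.
have [XM XE] := restrP X; have [YM YE] := restrP Y.
apply: restr_uniq; first by rewrite rpredD// rpredZ.
by move=> phi pM; rewrite !mulmxDl !linearD /= -!scalemxAl !linearZ /= XE// YE.
Qed.

Lemma restrZ a X : restr M (a *: X) = a *: restr M X.
Proof.
have r0 : restr M 0 = 0 by apply: restr_uniq; [exact: rpred0|move=> phi _; rewrite !mul0mx].
by rewrite -[a *: X]addr0 restr_linear r0 addr0.
Qed.

Lemma restr_adj X : X^t* = X -> (restr M X)^t* = restr M X.
Proof.
move=> hX; have [XM XE] := restrP X; symmetry; apply: restr_uniq.
  by case: vM => _; apply.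
move=> phi pM; have pM' : phi^t* \in M by case: vM => _; apply.
rewrite -{1}(trmxCK phi) -adjM mxtrace_adj mxtrace_mulC XE//.
by rewrite -mxtrace_adj adjM trmxCK hX mxtrace_mulC.
Qed.

Lemma restr_spectral_ge0 X i : psd X -> 0 <= spectral_diag (restr M X) 0 i.
Proof.
move=> pX; have hX := psd_hermitian pX; have hA := restr_adj hX.
have [AM AE] := restrP X; set A := restr M X in hA AM AE *.
have nA := hermitian_normal hA.
set l := spectral_diag A 0 i.
pose F j x : C := x - spectral_diag A 0 j.
pose Y : op := \prod_(j | spectral_diag A 0 j != l) specfun (F j) A.
pose q x := \prod_(j | spectral_diag A 0 j != l) F j x.
have YE : Y = specfun q A by exact: prod_specfun.
have YM : Y \in M.
  apply: (big_ind (fun Z : op => Z \in M)) => [||j _].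
  - by case: vM.
  - exact: is_vN_mul.
  rewrite /F specfunB specfun_cst specfun_id// rpredB// -scalemx1 rpredZ//.
  by case: vM.
have YM' : Y^t* \in M by case: vM => _; apply.
have q0 j : spectral_diag A 0 j != l -> q (spectral_diag A 0 j) = 0.
  by move=> jl; rewrite /q (bigD1 j)//= /F subrr mul0r.
have ql : q l != 0.
  by apply/prodf_neq0 => j jl; rewrite /F subr_eq0 eq_sym.
have e1 : Y^t* *m Y *m A = l *: (Y^t* *m Y).
  rewrite YE specfun_adj specfunM -{2}(specfun_id nA) specfunM.
  rewrite -mul_scalar_mx -(specfun_cst l A) specfunM; apply: eq_specfun => j.
  have [->|/q0 ->] := eqVneq (spectral_diag A 0 j) l; first by rewrite mulrC.
  by rewrite !(mulr0, mul0r).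
have : 0 <= l * \tr (Y^t* *m Y).
  rewrite -linearZ /= -e1 mxtrace_mulC AE; last first.
    exact: is_vN_mul.
  rewrite mxtrace_mulC -mulmxA mxtrace_mulC -mulmxA mulmxA.
  apply: sumr_ge0 => k _.
  have := pX ((row k Y)^t*).
  rewrite trmxCK; congr (0 <= _); rewrite -row_mul !mxE; apply: eq_bigr => j _.
  by rewrite !mxE.
suff tp : 0 < \tr (Y^t* *m Y) by rewrite pmulr_lge0.
rewrite YE specfun_adj specfunM tr_specfun (bigD1 i)//= ltr_pwDl//.
  by rewrite mulrC -normCK exprn_gt0// normr_gt0.
by apply: sumr_ge0 => j _; rewrite mulrC -normCK exprn_ge0.
Qed.

End Restriction.

End Spectral.

(** * Channels and the maximally mixed state *)

Section Channel.
Local Open Scope sesquilinear_scope.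
Variable R : realType.
Local Notation C := R[i].

Lemma quad_mxblock1 n (B : 'M[C]_n) (w : 'I_1 -> 'cV[C]_n) :
  (\mxcol_(i < 1) w i)^t* *m (\mxblock_(i < 1, j < 1) B) *m (\mxcol_(i < 1) w i) =
  (w 0)^t* *m B *m w 0.
Proof.
have -> : (\mxcol_(i < 1) w i)^t* = \mxrow_(i < 1) ((w i)^t*).
  by rewrite tr_mxcol; apply/matrixP => i j; rewrite !mxE.
by rewrite mul_mxrow_mxblock mul_mxrow_mxcol big_ord1 big_ord1.
Qed.

Lemma psd_mxblock1 n (B : 'M[C]_n) : psd (\mxblock_(i < 1, j < 1) B) <-> psd B.
Proof.
split=> pB v.
- have := pB (\mxcol_(i < 1) v).
  by rewrite (quad_mxblock1 B (fun=> v)).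
- by rewrite -(submxcolK v) (quad_mxblock1 B (fun i => submxcol v i)).
Qed.

(** This is complete positivity for [k = 1], after identifying a single block with the matrix
    itself. *)
Lemma channel_psd n m (M : {vspace 'M[C]_n.+1}) (N : {vspace 'M[C]_m.+1}) J X :
  is_channel M N J -> X \in M -> psd X -> psd (J X).
Proof.
move=> chJ XM pX; apply/psd_mxblock1.
apply: (channel_cp chJ (X := fun=> fun=> X)) => //.
exact/psd_mxblock1.
Qed.

Lemma channelZ n m (M : {vspace 'M[C]_n.+1}) (N : {vspace 'M[C]_m.+1}) J a X :
  is_channel M N J -> X \in M -> J (a *: X) = a *: J X.
Proof.
move=> chJ XM; have M0 : 0 \in M by exact: mem0v.
have J0 : J 0 = 0.
  have := channel_linear chJ 1 M0 M0.
  by rewrite !scale1r addr0 -{1}[J 0]addr0 => /addrI.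
by have := channel_linear chJ a XM M0; rewrite addr0 J0 addr0.
Qed.

Variable n : nat.

Definition dimV : R := n.+1%:R^-1.

Lemma dimV_gt0 : 0 < dimV. Proof. by rewrite invr_gt0. Qed.

Lemma dimHV : (dimH R n)^-1 = dimV%:C.
Proof.
rewrite /dimH mxtrace1 /dimV fmorphV; congr (_^-1).
by rewrite rmorph_nat.
Qed.

Lemma maxmixedE : maxmixed R n = (dimV%:C)%:M.
Proof. by rewrite /maxmixed dimHV scalemx1. Qed.

Lemma psd_scalar k (a : R) : 0 <= a -> psd ((a%:C)%:M : 'M[C]_k).
Proof.
move=> a0 v; rewrite mul_mx_scalar -scalemxAl mxE mulr_ge0// ?ler0c// mxE.
by apply: sumr_ge0 => i _; rewrite !mxE mulrC -normCK exprn_ge0.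
Qed.

Lemma cexpD (z w : C) : cexp (z + w) = cexp z * cexp w.
Proof.
rewrite /cexp cReD cImD expRD cosD sinD.
by apply: complexP; rewrite /= !(mul0r, subr0, addr0); ring.
Qed.

Lemma cexp_real (x : R) : cexp x%:C = (expR x)%:C.
Proof. by rewrite /cexp /= cos0 sin0; apply: complexP; rewrite /= !(mulr1, mulr0, mul0r, subr0, addr0). Qed.

Lemma expH_maxmixed (z w : C) (X : 'M[C]_n.+1) : z + w = 1 ->
  expH (- z) (maxmixed R n) *m X *m expH (- w) (maxmixed R n) = dimV%:C *: X.
Proof.
move=> zw; rewrite /expH /mxpow maxmixedE !specfun_scalar !opprK.
have d0 : (dimV%:C == 0) = false.
  by rewrite (inj_eq (@complexI _) _ 0) gt_eqF// dimV_gt0.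
rewrite d0 mul_scalar_mx mul_mx_scalar scalerA; congr (_ *: _).
rewrite -cexpD -mulrDl addrC zw mul1r clog_real ?dimV_gt0//.
by rewrite cexp_real lnK// posrE dimV_gt0.
Qed.

End Channel.

(** * Entrywise integrals of matrix-valued functions *)

Section MatrixIntegral.
Variable R : realType.
Variable n : nat.
Local Notation C := R[i].
Local Notation op := 'M[C]_n.+1.
Variables (D : set R) (mD : measurable (D : set (measurableTypeR R))).
Implicit Types (F G : R -> op).

Definition mxintegrable F : Prop := forall i j, cintegrable D (fun t => F t i j).

Lemma mxintegrable_mul (A B : op) F : mxintegrable F ->
  mxintegrable (fun t => A *m F t *m B) /\
  mxint D (fun t => A *m F t *m B) = A *m mxint D F *m B.
Proof.
move=> FI.
have E (X : op) i j : (A *m X *m B) i j = \sum_k \sum_l (A i l * B k j) * X l k.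
  rewrite mxE; apply: eq_bigr => k _; rewrite mxE mulr_suml; apply: eq_bigr => l _.
  by rewrite mulrAC.
split.
  move=> i j; have -> : (fun t => (A *m F t *m B) i j) =
      fun t => \sum_k \sum_l (A i l * B k j) * F t l k by apply/funext => t; exact: E.
  apply: (cintegrable_sum mD) => k; apply: (cintegrable_sum mD) => l.
  exact: (cintegrableZ mD).
apply/matrixP => i j; rewrite mxE E.
have -> : (fun t => (A *m F t *m B) i j) =
    fun t => \sum_k \sum_l (A i l * B k j) * F t l k by apply/funext => t; exact: E.
rewrite (cint_sum mD) => [|k]; last first.
  by apply: (cintegrable_sum mD) => l; exact: (cintegrableZ mD).
apply: eq_bigr => k _; rewrite (cint_sum mD) => [|l]; last exact: (cintegrableZ mD).
by apply: eq_bigr => l _; rewrite (cintZ mD)// mxE.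
Qed.

Lemma mxintZ (c : C) F : mxintegrable F -> mxint D (fun t => c *: F t) = c *: mxint D F.
Proof.
move=> FI; apply/matrixP => i j; rewrite !mxE -(cintZ mD)//.
by apply: eq_cint => t _; rewrite mxE.
Qed.

Lemma eq_mxint F G : {in D, F =1 G} -> mxint D F = mxint D G.
Proof. by move=> FG; apply/matrixP => i j; rewrite !mxE; apply: eq_cint => t /FG ->. Qed.

End MatrixIntegral.

(** * The twirled powers in an eigenbasis *)

Section SpectralIntegral.
Variables (R : realType) (m : nat).
Local Notation C := R[i].
Local Notation op := 'M[C]_m.+1.
Implicit Types (lam : 'I_m.+1 -> R) (B : op).

(** The Schur multiplier of the Daleckii-Krein formula for the logarithm. Rows and columns of zero
    eigenvalues are cleared, in accordance with the convention on the kernel. *)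
Definition dd_mx lam B : op := \matrix_(i, j)
  if (lam i == 0) || (lam j == 0) then 0 else (ln_dd (lam i) (lam j))%:C * B i j.

Definition powC (x : R) (z : C) : C := if x == 0 then 0 else cexp (z * (ln x)%:C).

(** With x = e^(2a) and y = e^(2b), x - y = 2 e^(a + b) sinh (a - b) and ln x - ln y = 2 (a - b).
    Coinciding eigenvalues use the value 1 of [sinhc] at 0. *)
Lemma ln_dd_sinhc (x y : R) : 0 < x -> 0 < y ->
  ln_dd x y = expR (- (ln x + ln y) / 2) * sinhc ((ln x - ln y) / 2).
Proof.
move=> x0 y0; rewrite /ln_dd /sinhc.
have [<-|xy] := eqVneq x y.
  rewrite subrr mul0r eqxx mulr1 -{1}(lnK (x0 : x \is Num.pos)) -expRN.
  by congr expR; lra.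
have lxy : ln x - ln y != 0.
  by rewrite subr_eq0; apply: contra xy => /eqP /ln_inj -> //; rewrite posrE.
rewrite mulf_eq0 (negbTE lxy) invr_eq0 pnatr_eq0 /=.
pose a := ln x / 2; pose b := ln y / 2.
have xE : x = expR a * expR a by rewrite -expRD -splitr lnK.
have yE : y = expR b * expR b by rewrite -expRD -splitr lnK.
have a0 := lt0r_neq0 (expR_gt0 a); have b0 := lt0r_neq0 (expR_gt0 b).
have -> : - (ln x + ln y) / 2 = - (a + b) by rewrite /a /b; lra.
have -> : (ln x - ln y) / 2 = a - b by rewrite /a /b; lra.
have -> : ln x - ln y = 2 * (a - b) by rewrite /a /b; lra.
rewrite {1}xE {1}yE /sh opprB !(expRN, expRD).
have d0 : expR a * expR a - expR b * expR b != 0 by rewrite -xE -yE subr_eq0.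
field; rewrite ?a0 ?b0 ?d0 /=.
by rewrite mulNr.
Qed.

Lemma powC_mul_beta (x y t : R) : 0 < x -> 0 < y ->
  powC x (- ((1 - 'i%C * t%:C) / 2)) * powC y (- ((1 + 'i%C * t%:C) / 2)) =
  (expR (- (ln x + ln y) / 2))%:C * cexp (((ln x - ln y) / 2 * t) *i).
Proof.
move=> x0 y0; rewrite /powC !gt_eqF// -cexpD -cexp_real -cexpD; congr cexp.
by apply: complexP; rewrite !(cReD, cImD, cReM, cImM, cReN, cImN) /=; field.
Qed.

Lemma cint_pow_beta (x y : R) (c : C) : 0 <= x -> 0 <= y ->
  cintegrable setT (fun t => (beta0 t)%:C *
    (powC x (- ((1 - 'i%C * t%:C) / 2)) * c * powC y (- ((1 + 'i%C * t%:C) / 2)))) /\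
  cint setT (fun t => (beta0 t)%:C *
    (powC x (- ((1 - 'i%C * t%:C) / 2)) * c * powC y (- ((1 + 'i%C * t%:C) / 2)))) =
  if (x == 0) || (y == 0) then 0 else (ln_dd x y)%:C * c.
Proof.
move=> x0 y0.
have mT : measurable (setT : set (measurableTypeR R)) by exact: measurableT.
have [xy|] := boolP ((x == 0) || (y == 0)).
  have -> : (fun t => (beta0 t)%:C * (powC x (- ((1 - 'i%C * t%:C) / 2)) * c *
      powC y (- ((1 + 'i%C * t%:C) / 2)))) = fun=> 0.
    apply/funext => t; rewrite /powC.
    by case/orP: xy => ->; rewrite !(mulr0, mul0r).
  by split; [exact: cintegrable0|exact: cint0].
rewrite negb_or => /andP[xn0 yn0].
have xp : 0 < x by rewrite lt_def xn0.
have yp : 0 < y by rewrite lt_def yn0.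
have -> : (fun t => (beta0 t)%:C * (powC x (- ((1 - 'i%C * t%:C) / 2)) * c *
    powC y (- ((1 + 'i%C * t%:C) / 2)))) =
    fun t => (c * (expR (- (ln x + ln y) / 2))%:C) *
      ((beta0 t)%:C * cexp (((ln x - ln y) / 2 * t) *i)).
  apply/funext => t.
  transitivity ((beta0 t)%:C * c * ((expR (- (ln x + ln y) / 2))%:C *
    cexp (((ln x - ln y) / 2 * t) *i))); last by ring.
  by rewrite -(powC_mul_beta t xp yp); ring.
have [I E] := cint_beta0 ((ln x - ln y) / 2).
split; first exact: (cintegrableZ mT).
by rewrite (cintZ mT)// E ln_dd_sinhc// rmorphM /=; ring.
Qed.

Lemma mxint_pow_diag lam B : (forall i, 0 <= lam i) ->
  let F t : op := (beta0 t)%:C *: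
    (diag_mx (\row_i powC (lam i) (- ((1 - 'i%C * t%:C) / 2))) *m B *m
     diag_mx (\row_i powC (lam i) (- ((1 + 'i%C * t%:C) / 2)))) in
  mxintegrable setT F /\ mxint setT F = dd_mx lam B.
Proof.
move=> l0 F.
have E i j : (fun t => F t i j) = fun t => (beta0 t)%:C *
    (powC (lam i) (- ((1 - 'i%C * t%:C) / 2)) * B i j *
     powC (lam j) (- ((1 + 'i%C * t%:C) / 2))).
  by apply/funext => t; rewrite mxE mul_mx_diag mxE mul_diag_mx !mxE.
split=> [i j|]; first by rewrite E; exact: (cint_pow_beta _ (l0 i) (l0 j)).1.
by apply/matrixP => i j; rewrite !mxE E (cint_pow_beta _ (l0 i) (l0 j)).2.
Qed.

Lemma mxpow_specfun (rho : op) lam z : (forall i, 0 <= lam i) ->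
  (forall i, spectral_diag rho 0 i = (lam i)%:C) ->
  mxpow rho z = invmx (spectralmx rho) *m diag_mx (\row_i powC (lam i) z) *m spectralmx rho.
Proof.
move=> l0 lE; rewrite /mxpow /specfun.
have -> : map_mx (fun x => if x == 0 then 0 else cexp (z * clog x)) (spectral_diag rho) =
    \row_i powC (lam i) z.
  apply/rowP => i; rewrite !mxE lE /powC (inj_eq (@complexI _) _ 0).
  by case: eqVneq => // ln0; rewrite clog_real// lt_def ln0 l0.
by [].
Qed.

Lemma mxint_expH (rho : op) lam B : (forall i, 0 <= lam i) ->
  (forall i, spectral_diag rho 0 i = (lam i)%:C) ->
  let F t : op := (beta0 t)%:C *:
    (expH ((1 - 'i%C * t%:C) / 2) rho *m B *m expH ((1 + 'i%C * t%:C) / 2) rho) in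
  mxintegrable setT F /\ mxint setT F = invmx (spectralmx rho) *m
    dd_mx lam (spectralmx rho *m B *m invmx (spectralmx rho)) *m spectralmx rho.
Proof.
move=> l0 lE F.
have mT : measurable (setT : set (measurableTypeR R)) by exact: measurableT.
have [I E] := mxint_pow_diag (spectralmx rho *m B *m invmx (spectralmx rho)) l0.
have -> : F = fun t => invmx (spectralmx rho) *m ((beta0 t)%:C *:
    (diag_mx (\row_i powC (lam i) (- ((1 - 'i%C * t%:C) / 2))) *m
      (spectralmx rho *m B *m invmx (spectralmx rho)) *m
     diag_mx (\row_i powC (lam i) (- ((1 + 'i%C * t%:C) / 2))))) *m spectralmx rho.
  apply/funext => t; rewrite /F /expH !(mxpow_specfun _ l0 lE).
  by rewrite -scalemxAr -scalemxAl !mulmxA.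
have [I' E'] := mxintegrable_mul mT (invmx (spectralmx rho)) (spectralmx rho) I.
by split; [exact: I'|rewrite E' E].
Qed.

End SpectralIntegral.

(** * The logarithm as a contour integral *)

Section Resolvent.
Variables (R : realType) (m : nat).
Local Notation C := R[i].
Local Notation op := 'M[C]_m.+1.
Implicit Types (P X Y : op) (z : C).

(** The matrix acts on the whole space, [eig_on] only on the range of [P]. They are reconciled by
    [z != 0]: a vector with P X P v = z v is then fixed by [P]. *)
Lemma resolvent_unit P X z : P *m P = P -> z != 0 -> ~ eig_on P X z ->
  z%:M - P *m X *m P \in unitmx.
Proof.
move=> PP z0 ne; have [//|nu] := boolP (z%:M - P *m X *m P \in unitmx).
exfalso; apply: ne.
set Y := P *m X *m P in nu *.
have : kermx (z%:M - Y)^T != 0 by rewrite kermx_eq0 row_free_unit unitmx_tr.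
move=> /rowV0Pn [u /sub_kermxP uK u0].
have Yv : Y *m u^T = z *: u^T.
  apply/esym/eqP; rewrite -subr_eq0 -mul_scalar_mx -mulmxBl -[_ - _]trmxK -trmx_mul uK.
  by rewrite trmx0.
have PY : P *m Y = Y by rewrite /Y !mulmxA PP.
have Pv : P *m u^T = u^T.
  apply: (scalerI z0); rewrite scalemxAr -Yv.
  by rewrite mulmxA PY.
exists u^T; split => //.
by apply: contra u0 => /eqP e; rewrite -[u]trmxK e trmx0.
Qed.

(** Cramer's rule for the characteristic matrix, evaluated at [z]. It makes the resolvent
    holomorphic entry by entry through polynomials alone. *)
Lemma resolvent_rational P Y : exists (q : {poly C}) (p : 'I_m.+1 -> 'I_m.+1 -> {poly C}),
  (forall z, (z%:M - Y \in unitmx) = (q.[z] != 0)) /\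
  forall z i j, q.[z] != 0 ->
    (P *m invmx (z%:M - Y) *m P) i j = (p i j).[z] * (q.[z])^-1.
Proof.
pose ch := char_poly_mx Y.
have chE z : map_mx (horner_eval z) ch = z%:M - Y.
  apply/matrixP => i j; rewrite !mxE /horner_eval hornerD hornerN hornerMn hornerX hornerC.
  by [].
pose p i j := \sum_k \sum_l (P i l * P k j) *: (\adj ch) l k.
exists (\det ch), p.
have dE z : (\det ch).[z] = \det (z%:M - Y).
  by rewrite -chE det_map_mx.
have uE z : (z%:M - Y \in unitmx) = ((\det ch).[z] != 0) by rewrite unitmxE unitfE dE.
split=> // z i j qz.
have u : z%:M - Y \in unitmx by rewrite uE.
rewrite /invmx u -dE -scalemxAr -scalemxAl mxE mulrC; congr (_ * _).
rewrite -chE -map_mx_adj horner_sum mxE; apply: eq_bigr => k _.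
rewrite horner_sum mxE mulr_suml; apply: eq_bigr => l _.
by rewrite hornerZ mxE mulrAC.
Qed.

Definition contour_ok P X (c r : R) : Prop :=
  0 < r < c /\ forall z, eig_on P X z -> `|z - c%:C| < r%:C.

Lemma contour_unit P X c r u : P *m P = P -> contour_ok P X c r ->
  (circ c r u)%:M - P *m X *m P \in unitmx.
Proof.
move=> PP [/andP[r0 rc] H]; apply: resolvent_unit => //.
  by apply: right_half_neq0; apply: circ_Re_gt0; rewrite gtr0_norm.
by move=> /H; rewrite circ_center// ltxx.
Qed.

Definition log_res P X i j z : C := clog z * (P *m invmx (z%:M - P *m X *m P) *m P) i j.

Lemma cauchy_log_entry P X c r i j :
  cauchy_log P X c r i j = ((2 * pi)%:C * 'i%C)^-1 * oint (log_res P X i j) c r.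
Proof.
rewrite /cauchy_log mxE mxE; congr (_ * _); apply: eq_cint => u _.
rewrite mxE /log_res mulrAC; reflexivity.
Qed.

(** [invmx] has a default value at singular matrices, so the integrand is replaced by a rational
    expression times [clog], which agrees with it wherever the resolvent exists. *)
Lemma log_res_holomorphic P X i j : exists U g g', [/\ holomorphic_on U g g',
  (forall z, z%:M - P *m X *m P \in unitmx -> g z = log_res P X i j z) &
  (forall z, 0 < Re z -> z%:M - P *m X *m P \in unitmx -> U z)].
Proof.
have [q [p [uE pE]]] := resolvent_rational P (P *m X *m P).
pose U := [set z : C | 0 < Re z /\ q.[z] != 0].
have Ur : U `<=` @right_half R by move=> z [].
have hV := @holomorphic_onV R U _ _ (fun z (Uz : U z) => Uz.2) (holomorphic_on_horner U q).
have h := holomorphic_onM (holomorphic_onS Ur (@holomorphic_on_clog R))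
  (holomorphic_onM (holomorphic_on_horner U (p i j)) hV).
exists U; eexists; eexists; split; first exact: h.
- by move=> z; rewrite uE => qz; rewrite /log_res pE.
- by move=> z z0; rewrite uE.
Qed.

Lemma oint_log_res P X c r i j : P *m P = P -> contour_ok P X c r ->
  cintegrable `[0, 2 * pi] (fun u => log_res P X i j (circ c r u) * circ' r u).
Proof.
move=> PP ok; have [U [g [g' [h gE gU]]]] := log_res_holomorphic P X i j.
have Uc u : U (circ c r u).
  apply: gU; last exact: contour_unit.
  by case: ok => /andP[r0 rc] _; apply: circ_Re_gt0; rewrite gtr0_norm.
have := oint_integrable h Uc.
have -> : (fun u => g (circ c r u) * circ' r u) =
    fun u => log_res P X i j (circ c r u) * circ' r u.
  by apply/funext => u; rewrite gE//; exact: contour_unit.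
by [].
Qed.

Lemma contour_ok_convex P X c0 r0 c1 r1 t : 0 <= t <= 1 ->
  contour_ok P X c0 r0 -> contour_ok P X c1 r1 ->
  contour_ok P X (c0 + t * (c1 - c0)) (r0 + t * (r1 - r0)).
Proof.
move=> t01 [/andP[r00 rc0] H0] [/andP[r10 rc1] H1]; split; last first.
  by move=> z ez; apply: disc_convex => //; [exact: H0|exact: H1].
case/andP: t01 => t0 t1.
have [->|tn0] := eqVneq t 0; first by apply/andP; split; lra.
have tp : 0 < t by rewrite lt_def tn0 t0.
have h1 := mulr_gt0 tp r10.
have h2 : 0 < t * (c1 - r1) by rewrite mulr_gt0// subr_gt0.
have h3 : 0 <= (1 - t) * r0 by rewrite mulr_ge0 ?subr_ge0// ltW.
have h4 : 0 <= (1 - t) * (c0 - r0) by rewrite mulr_ge0 ?subr_ge0// ltW.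
by apply/andP; split; lra.
Qed.

Lemma cauchy_log_indep P X c0 r0 c1 r1 : P *m P = P ->
  contour_ok P X c0 r0 -> contour_ok P X c1 r1 ->
  cauchy_log P X c0 r0 = cauchy_log P X c1 r1.
Proof.
move=> PP ok0 ok1; apply/matrixP => i j.
apply: etrans (cauchy_log_entry P X c0 r0 i j) _.
apply: etrans _ (esym (cauchy_log_entry P X c1 r1 i j)).
suff -> : oint (log_res P X i j) c0 r0 = oint (log_res P X i j) c1 r1 by reflexivity.
have [U [g [g' [h gE gU]]]] := log_res_holomorphic P X i j.
have E c r : contour_ok P X c r -> oint (log_res P X i j) c r = oint g c r.
  by move=> ok; apply: eq_cint => u _; rewrite (gE _ (contour_unit u PP ok)).
rewrite (E _ _ ok0) (E _ _ ok1); apply: (oint_homotopy h) => t u t01.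
have ok := contour_ok_convex t01 ok0 ok1.
apply: gU; last exact: contour_unit.
by case: ok => /andP[r0' rc] _; apply: circ_Re_gt0; rewrite gtr0_norm.
Qed.

Lemma mxlog_onE P X c r : P *m P = P -> contour_ok P X c r ->
  mxlog_on P X = cauchy_log P X c r.
Proof.
move=> PP ok; rewrite /mxlog_on; case: xgetP => [L _ [c' [r' [rc H ->]]]|].
  by apply: cauchy_log_indep => //; split.
move=> /(_ (cauchy_log P X c r)) []; exists c, r; case: ok => rc H.
by split.
Qed.

Lemma arg_max_cabs (w : 'I_m.+1 -> C) : exists i, forall k, cabs (w k) <= cabs (w i).
Proof.
have : forall s : seq 'I_m.+1, exists i, forall k, k \in ord0 :: s -> cabs (w k) <= cabs (w i).
  elim=> [|a s [i IH]]; first by exists ord0 => k; rewrite inE => /eqP ->.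
  have [h|h] := leP (cabs (w a)) (cabs (w i)).
    exists i => k; rewrite !inE => /or3P[/eqP ->|/eqP ->|ks] //.
    - by apply: IH; rewrite inE eqxx.
    - by apply: IH; rewrite inE ks orbT.
  exists a => k; rewrite !inE => /or3P[/eqP ->|/eqP -> //|ks].
  - by apply: le_trans (ltW h); apply: IH; rewrite inE eqxx.
  - by apply: le_trans (ltW h); apply: IH; rewrite inE ks orbT.
move=> /(_ (enum 'I_m.+1)) [i H]; exists i => k; apply: H.
by rewrite inE mem_enum orbT.
Qed.

Lemma cabs_sum (I : Type) (s : seq I) (F : I -> C) :
  cabs (\sum_(i <- s) F i) <= \sum_(i <- s) cabs (F i).
Proof.
elim: s => [|i s IH]; first by rewrite !big_nil /cabs normr0.
by rewrite !big_cons; apply: le_trans (cabsD _ _) _; rewrite lerD2l.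
Qed.

Definition mxle k l (A : 'M[C]_(k, l)) (a : R) : Prop := forall i j, cabs (A i j) <= a.

Lemma mxle_exists k l (A : 'M[C]_(k, l)) : exists2 a, 0 <= a & mxle A a.
Proof.
exists (\sum_i \sum_j cabs (A i j)) => [|i j].
  by apply: sumr_ge0 => i _; apply: sumr_ge0 => j _; exact: cabs_ge0.
rewrite (bigD1 i)//= (bigD1 j)//= -addrA lerDl addr_ge0//.
  by apply: sumr_ge0 => ? _; exact: cabs_ge0.
by apply: sumr_ge0 => ? _; apply: sumr_ge0 => ? _; exact: cabs_ge0.
Qed.

Lemma mxleM (A B : op) a b : mxle A a -> mxle B b -> mxle (A *m B) (m.+1%:R * (a * b)).
Proof.
move=> Aa Bb i j; rewrite mxE; apply: le_trans (cabs_sum _ _) _.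
apply: le_trans (_ : \sum_(k < m.+1) a * b <= _).
  by apply: ler_sum => k _; rewrite cabsM ler_pM ?cabs_ge0.
by rewrite sumr_const card_ord mulr_natl.
Qed.

Lemma mxle_sum_mul (B : op) (w : 'I_m.+1 -> C) b k i : mxle B b ->
  (forall l, cabs (w l) <= cabs (w k)) ->
  cabs (\sum_l B i l * w l) <= m.+1%:R * b * cabs (w k).
Proof.
move=> Bb wk; apply: le_trans (cabs_sum _ _) _.
apply: le_trans (_ : \sum_(l < m.+1) b * cabs (w k) <= _).
  by apply: ler_sum => l _; rewrite cabsM ler_pM ?cabs_ge0.
by rewrite sumr_const card_ord -mulrA mulr_natl.
Qed.

(* Diagonal dominance in the sup norm. *)
Lemma diag_dominant_bound (d : 'rV[C]_m.+1) (B W F : op) (t b f eta : R) : 0 < eta ->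
  (forall i, eta <= cabs (d 0 i)) -> mxle B b -> mxle F f ->
  `|t| * (m.+1%:R * b) <= eta / 2 -> (diag_mx d - t%:C *: B) *m W = F ->
  mxle W (2 / eta * f).
Proof.
move=> eta0 deta Bb Ff tb E i j.
have [k wk] := arg_max_cabs (fun i => W i j).
apply: le_trans (wk i) _.
have : d 0 k * W k j = F k j + t%:C * \sum_l B k l * W l j.
  rewrite -E mulmxBl -scalemxAl mxE mul_diag_mx !mxE; ring.
move=> /(congr1 (@cabs R)); rewrite cabsM => e1.
have e2 : eta * cabs (W k j) <= f + eta / 2 * cabs (W k j).
  apply: le_trans (_ : cabs (d 0 k) * cabs (W k j) <= _).
    by rewrite ler_wpM2r// cabs_ge0.
  rewrite e1; apply: le_trans (cabsD _ _) _; apply: lerD => //.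
  rewrite cabsM cabs_real; apply: le_trans (_ : `|t| * (m.+1%:R * b * cabs (W k j)) <= _).
    by rewrite ler_wpM2l//; apply: mxle_sum_mul.
  by rewrite mulrA ler_wpM2r// cabs_ge0.
have : cabs (W k j) * (eta / 2) <= f by lra.
rewrite -ler_pdivlMr ?divr_gt0// => /le_trans; apply.
by rewrite invf_div mulrC.
Qed.

End Resolvent.

(** * Quadratic remainders and crude bounds on integrals *)

Section QuadraticDerivative.
Variable R : realType.

Lemma is_derive_quadratic (f : R -> R) (d K t0 : R) : 0 < t0 ->
  (forall t, `|t| < t0 -> `|f t - f 0 - t * d| <= K * t ^+ 2) ->
  is_derive (0 : R) (1 : R) f d.
Proof.
move=> t00 H; apply/is_derive1_caratheodory.
exists (fun z => if z == 0 then d else (f z - f 0) / z); split; last by rewrite eqxx.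
  move=> z; rewrite subr0; case: eqVneq => [->|z0]; first by rewrite subrr mulr0.
  by rewrite mulfVK.
have hK (z : R) : `|z| < t0 -> `|d - (if z == 0 then d else (f z - f 0) / z)| <= `|K| * `|z|.
  move=> zt; case: eqVneq => [_|z0]; first by rewrite subrr normr0 mulr_ge0.
  have -> : d - (f z - f 0) / z = - (f z - f 0 - z * d) / z by field.
  rewrite normrM normrN normfV ler_pdivrMr ?normr_gt0//.
  apply: le_trans (H _ zt) _; rewrite -mulrA -expr2 real_normK ?num_real//.
  by rewrite ler_wpM2r ?sqr_ge0// ler_norm.
apply/cvgrPdist_le => e e0; near=> z; rewrite /= eqxx.
have zt : `|z| < t0.
  by near: z; exists t0 => //= x /=; rewrite sub0r normrN.
apply: le_trans (hK _ zt) _.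
have : `|z| <= e / (`|K| + 1).
  near: z; exists (e / (`|K| + 1)) => /=; first by rewrite divr_gt0// ltr_wpDl.
  by move=> x /=; rewrite sub0r normrN => /ltW.
rewrite ler_pdivlMr ?ltr_wpDl// => h.
by have := normr_ge0 z; have := normr_ge0 K; nra.
Unshelve. all: by end_near. Qed.

(** The constant is 4 pi instead of 2 pi because the real and imaginary parts are bounded
    separately. *)
Lemma cint_bound (f : R -> R[i]) (K : R) :
  cintegrable `[0, 2 * pi] f -> (forall u, u \in `[0, 2 * pi] -> cabs (f u) <= K) ->
  cabs (cint `[0, 2 * pi] f) <= 4 * pi * K.
Proof.
move=> [fr fi] fK.
have mab : measurable (`[0, 2 * pi]%classic : set (measurableTypeR R)) by exact: measurable_itv.
have pi2 : 0 < 2 * pi :> R by rewrite mulr_gt0// pi_gt0.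
have bnd (g : R -> R) : (@lebesgue_measure R).-integrable `[0, 2 * pi] (EFin \o g) ->
    (forall u, u \in `[0, 2 * pi] -> `|g u| <= K) ->
    `|Rintegral (@lebesgue_measure R) `[0, 2 * pi] g| <= 2 * pi * K.
  move=> gi gK.
  have IK k : Rintegral (@lebesgue_measure R) `[0, 2 * pi] (fun=> k) = 2 * pi * k.
    have ck : continuous ((fun=> k) : R -> R) by move=> x; exact: cvg_cst.
    rewrite (@Rintegral_derive R 0 (2 * pi) (fun x => k * x) (fun=> k) pi2
      (fun x => is_derive_linear k x) ck).
    by rewrite mulr0 subr0 mulrC.
  have ck k : (@lebesgue_measure R).-integrable `[0, 2 * pi] (EFin \o (fun=> k : R)).
    by apply: continuous_integrable => x; exact: cvg_cst.
  rewrite ler_norml; apply/andP; split.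
  - rewrite -mulrN -IK; apply: le_Rintegral => // u uI.
    by have := gK u uI; rewrite ler_norml => /andP[].
  - rewrite -IK; apply: le_Rintegral => // u uI.
    by have := gK u uI; rewrite ler_norml => /andP[].
apply: le_trans (cabs_le _) _; rewrite /cint /=.
have h1 : `|Rintegral (@lebesgue_measure R) `[0, 2 * pi] (fun t => Re (f t))| <= 2 * pi * K.
  by apply: bnd => // u uI; apply: le_trans (cabs_Re_Im _).1 (fK _ uI).
have h2 : `|Rintegral (@lebesgue_measure R) `[0, 2 * pi] (fun t => Im (f t))| <= 2 * pi * K.
  by apply: bnd => // u uI; apply: le_trans (cabs_Re_Im _).2 (fK _ uI).
lra.
Qed.

End QuadraticDerivative.

(** The resolvent identity Xt = X0 + t X0 Z Xt is inserted once into itself, which leaves an exact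
    remainder. *)
Lemma resolvent_expand (K : fieldType) k (A0 Z X0 Xt : 'M[K]_k) (t : K) :
  X0 *m A0 = 1%:M -> (A0 - t *: Z) *m Xt = 1%:M ->
  Xt - X0 - t *: (X0 *m Z *m X0) = (t ^+ 2) *: (X0 *m Z *m X0 *m Z *m Xt).
Proof.
move=> X0A; rewrite mulmxBl -scalemxAl => /eqP; rewrite subr_eq => /eqP AX.
have e : Xt = X0 + t *: (X0 *m Z *m Xt).
  by rewrite -{1}(mul1mx Xt) -X0A -mulmxA AX mulmxDr mulmx1 -scalemxAr mulmxA.
have e1 : Xt - X0 = t *: (X0 *m Z *m Xt) by rewrite {1}e addrAC subrr add0r.
by rewrite e1 -scalerBr -mulmxBr e1 -scalemxAr scalerA -expr2 !mulmxA.
Qed.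

Lemma compress_entry (K : fieldType) k (P Xt X0 X3 X4 : 'M[K]_k) (t s : K) i j :
  Xt - X0 - t *: X3 = s *: X4 ->
  (P *m Xt *m P) i j - (P *m X0 *m P) i j - t * (P *m X3 *m P) i j = s * (P *m X4 *m P) i j.
Proof.
have eB (X Y : 'M[K]_k) : (X - Y) i j = X i j - Y i j by rewrite !mxE.
have eZ (a : K) (X : 'M[K]_k) : (a *: X) i j = a * X i j by rewrite mxE.
move=> /(congr1 (fun X => (P *m X *m P) i j)).
by rewrite !mulmxBr !mulmxBl -!scalemxAr -!scalemxAl !eB !eZ.
Qed.

(** * Perturbation of the logarithm in an eigenbasis *)

Section EigenbasisLog.
Variables (R : realType) (m : nat).
Local Notation C := R[i].
Local Notation op := 'M[C]_m.+1.
Variables (V : op) (uV : V \in unitmx) (lam : 'I_m.+1 -> R).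
Hypothesis l0 : forall i, 0 <= lam i.

(* Locked, as unification would otherwise unfold it when rewriting with [mulmxA]. *)
Definition eigdiag (s : 'I_m.+1 -> C) : op := locked (invmx V *m diag_mx (\row_i s i) *m V).

Lemma eigdiagE s : eigdiag s = invmx V *m diag_mx (\row_i s i) *m V.
Proof. by rewrite /eigdiag -lock. Qed.

Lemma eigdiagM s s' : eigdiag s *m eigdiag s' = eigdiag (fun i => s i * s' i).
Proof.
rewrite !eigdiagE !mulmxA (mulmxK uV); congr (_ *m V); rewrite -!mulmxA; congr (_ *m _).
by apply/matrixP => i j; rewrite mul_diag_mx !mxE mulrnAr.
Qed.

Lemma eigdiag_cst z : eigdiag (fun=> z) = z%:M.
Proof.
rewrite eigdiagE; have -> : \row_i z = const_mx z :> 'rV[C]_m.+1.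
  by apply/rowP => i; rewrite !mxE.
by rewrite diag_const_mx scalar_mxC -mulmxA (mulVmx uV) mulmx1.
Qed.

Lemma eigdiagB s s' : eigdiag s - eigdiag s' = eigdiag (fun i => s i - s' i).
Proof.
rewrite !eigdiagE.
have -> : diag_mx (\row_i (s i - s' i)) = diag_mx (\row_i s i) - diag_mx (\row_i s' i) :> op.
  by apply/matrixP => i j; rewrite !mxE mulrnBl.
by rewrite mulmxBr mulmxBl.
Qed.

Lemma eq_eigdiag s s' : s =1 s' -> eigdiag s = eigdiag s'.
Proof. by move=> /funext ->. Qed.

Lemma eigdiag_inv s : (forall i, s i != 0) -> invmx (eigdiag s) = eigdiag (fun i => (s i)^-1).
Proof.
move=> s0; have E : eigdiag s *m eigdiag (fun i => (s i)^-1) = 1%:M.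
  rewrite eigdiagM -(eigdiag_cst 1); apply: eq_eigdiag => i.
  by rewrite mulfV.
have [u _] := mulmx1_unit E.
by rewrite -[RHS](mulKmx u) E mulmx1.
Qed.

Local Notation rho := (eigdiag (fun i => (lam i)%:C)).
Local Notation P := (eigdiag (fun i => (lam i != 0)%:R)).

Lemma proj_idem : P *m P = P.
Proof. by rewrite eigdiagM; apply: eq_eigdiag => i; rewrite -natrM mulnb andbb. Qed.

Lemma proj_rho : P *m rho *m P = rho.
Proof.
rewrite !eigdiagM; apply: eq_eigdiag => i.
by case: eqVneq => [->|_]; rewrite ?mul0r// mul1r mulr1.
Qed.

Lemma spectral_gap : exists d c : R, [/\ 0 < d <= c,
  (forall i, lam i != 0 -> d <= lam i) & (forall i, lam i <= c)].
Proof.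
have : forall s : seq 'I_m.+1, exists d c : R, [/\ 0 < d <= c,
    (forall i, i \in s -> lam i != 0 -> d <= lam i) & (forall i, i \in s -> lam i <= c)].
  elim=> [|a s [d [c [/andP[d0 dc] Hd Hc]]]]; first by exists 1, 1; rewrite ltr01 lexx.
  exists (if lam a == 0 then d else Num.min d (lam a)), (Num.max c (lam a)); split.
  - case: eqVneq => a0; first by rewrite d0 le_max dc.
    by rewrite lt_min d0 lt_def a0 l0 /= ge_min le_max dc.
  - move=> i; rewrite inE => /orP[/eqP ->|is_] i0.
      by rewrite (negbTE i0) ge_min lexx orbT.
    by case: ifP => _; rewrite ?ge_min Hd.
  - move=> i; rewrite inE => /orP[/eqP ->|is_]; first by rewrite le_max lexx orbT.
    by rewrite le_max Hc.
move=> /(_ (enum 'I_m.+1)) [d [c [dc Hd Hc]]]; exists d, c; split => // i.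
  by apply: Hd; rewrite mem_enum.
by apply: Hc; rewrite mem_enum.
Qed.

Variable B : op.
Definition compB : op := locked (P *m B *m P).

Lemma compBE : compB = P *m B *m P. Proof. by rewrite /compB -lock. Qed.

Local Notation B' := compB.
Local Notation Bt := (V *m B' *m invmx V).

Lemma compress_affine t : P *m (rho + t%:C *: B) *m P = rho + t%:C *: B'.
Proof. by rewrite mulmxDr mulmxDl proj_rho -scalemxAr -scalemxAl compBE. Qed.

Lemma conj_resolvent z t :
  V *m (z%:M - (rho + t%:C *: B')) = (diag_mx (\row_i (z - (lam i)%:C)) - t%:C *: Bt) *m V.
Proof.
have e1 : V *m (z%:M - rho) = diag_mx (\row_i (z - (lam i)%:C)) *m V.
  by rewrite -(eigdiag_cst z) eigdiagB eigdiagE !mulmxA (mulmxV uV) mul1mx.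
have e2 : V *m (t%:C *: B') = (t%:C *: Bt) *m V.
  by rewrite -scalemxAr -scalemxAl (mulmxKV uV).
by rewrite opprD addrA mulmxBr e1 e2 mulmxBl.
Qed.

Section Contour.
Variables (d c b : R).
Hypothesis dc : 0 < d <= c.
Hypothesis dlam : forall i, lam i != 0 -> d <= lam i.
Hypothesis lamc : forall i, lam i <= c.
Hypothesis Btb : mxle Bt b.
(** The circle meets the real axis at d / 2 and 2 c - d / 2. The nonzero eigenvalues, which lie in
    [d, c], are inside and 0 is outside, all at distance at least d / 2 from it. *)
Local Notation r := (c - d / 2).

Lemma radius_ok : 0 < r < c.
Proof. by case/andP: dc => h1 h2; apply/andP; split; lra. Qed.

Lemma lam_disc i : lam i != 0 -> `|(lam i)%:C - c%:C| < r%:C.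
Proof.
move=> /dlam h; rewrite -rmorphB cabsE ltcR cabs_real distrC ger0_norm ?subr_ge0//.
by case/andP: dc => h1 h2; lra.
Qed.

(** Gershgorin's argument. At the largest coordinate k of an eigenvector, written in the eigenbasis
    of rho, |z - lam k| is at most |t| times the row sum of the perturbation, hence below d / 2. The
    vector lies in the range of [P], so lam k is not 0. *)
Lemma contour_ok_near t : `|t| * (m.+1%:R * b) < d / 2 ->
  contour_ok P (rho + t%:C *: B) c r.
Proof.
move=> tb; split; first exact: radius_ok.
move=> z [v [v0 Pv]]; rewrite compress_affine => Ev.
pose w : 'cV[C]_m.+1 := V *m v.
have Ew i : (z - (lam i)%:C) * w i 0 = t%:C * \sum_l Bt i l * w l 0.
  have : (z%:M - (rho + t%:C *: B')) *m v = 0 by rewrite mulmxBl Ev mul_scalar_mx subrr.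
  move=> /(congr1 (mulmx V)); rewrite mulmx0 mulmxA conj_resolvent -mulmxA -/w mulmxBl.
  move=> /eqP; rewrite subr_eq0 => /eqP /matrixP /(_ i 0).
  by rewrite mul_diag_mx -scalemxAl !mxE.
have Pw i : w i 0 = (lam i != 0)%:R * w i 0.
  have /matrixP /(_ i 0) : w = diag_mx (\row_i (lam i != 0)%:R) *m w.
    by rewrite /w -{1}Pv eigdiagE !mulmxA (mulmxV uV) mul1mx.
  by rewrite mul_diag_mx !mxE.
have [k wk] := arg_max_cabs (fun i => w i 0).
have wk0 : 0 < cabs (w k 0).
  rewrite lt_neqAle cabs_ge0 andbT eq_sym; apply: contra v0 => /eqP wk00.
  have w0 : w = 0.
    apply/matrixP => i j; rewrite ord1 [RHS]mxE; apply/eqP.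
    rewrite -normr_eq0 cabsE (inj_eq (@complexI _) _ 0) eq_le cabs_ge0 andbT.
    by rewrite -wk00.
  by rewrite -(mulKmx uV v) -/w w0 mulmx0.
have lk0 : lam k != 0.
  apply/eqP => lk; move: wk0; rewrite Pw lk eqxx mul0r /cabs normr0 /=.
  by rewrite ltxx.
have h : cabs (z - (lam k)%:C) < d / 2.
  apply: le_lt_trans tb; rewrite -(ler_pM2r wk0) -cabsM Ew cabsM cabs_real -mulrA.
  by rewrite ler_wpM2l//; exact: mxle_sum_mul.
have -> : z - c%:C = (z - (lam k)%:C) + ((lam k)%:C - c%:C) by ring.
rewrite cabsE ltcR; apply: le_lt_trans (cabsD _ _) _.
rewrite -rmorphB cabs_real distrC ger0_norm ?subr_ge0//.
by have := dlam lk0; lra.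
Qed.

Lemma contour_gap u i : d / 2 <= cabs (circ c r u - (lam i)%:C).
Proof.
have /andP[d0 dc'] := dc; have /andP[r0 rc] := radius_ok.
have E : cabs (circ c r u - c%:C) = r.
  by apply: complexI; rewrite -cabsE circ_center.
have [l00|ln0] := eqVneq (lam i) 0.
  have := cabsD (circ c r u) (c%:C - circ c r u).
  rewrite addrCA subrr addr0 cabs_real (gtr0_norm (lt_le_trans d0 dc')).
  have -> : cabs (c%:C - circ c r u) = r by rewrite /cabs distrC; exact: E.
  by rewrite l00 rmorph0 subr0; lra.
have := cabsD (circ c r u - (lam i)%:C) ((lam i)%:C - c%:C).
rewrite addrA subrK E -rmorphB cabs_real distrC ger0_norm ?subr_ge0//.
by have := dlam ln0; lra.
Qed.

Local Notation Res t u := (invmx ((circ c r u)%:M - (rho + t%:C *: B'))).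

Lemma res_unit t u : `|t| * (m.+1%:R * b) < d / 2 ->
  (circ c r u)%:M - (rho + t%:C *: B') \in unitmx.
Proof.
by move=> /contour_ok_near /(contour_unit u proj_idem); rewrite compress_affine.
Qed.

(** Diagonal dominance with gap d / 2; the perturbation may use up half of it, whence d / 4. The
    bound is uniform in [t] and along the circle. *)
Lemma res_bound : exists2 K, 0 <= K & forall t u, `|t| * (m.+1%:R * b) < d / 4 -> mxle (Res t u) K.
Proof.
have /andP[d0 _] := dc.
have [v1 v10 V1] := mxle_exists (invmx V); have [v2 v20 V2] := mxle_exists V.
exists (m.+1%:R * (m.+1%:R * (v1 * (2 / (d / 2) * 1)) * v2)).
  by rewrite !mulr_ge0// ?invr_ge0 ?divr_ge0 ?ltW.
move=> t u tb.
have un : (circ c r u)%:M - (rho + t%:C *: B') \in unitmx by apply: res_unit; lra.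
have E : (diag_mx (\row_i (circ c r u - (lam i)%:C)) - t%:C *: Bt) *m
    (V *m Res t u *m invmx V) = 1%:M.
  rewrite -!mulmxA [V *m _]mulmxA mulmxA -conj_resolvent.
  by rewrite -!mulmxA (mulKVmx un) (mulmxV uV).
have W : mxle (V *m Res t u *m invmx V) (2 / (d / 2) * 1).
  apply: (diag_dominant_bound _ _ Btb _ _ E); rewrite ?divr_gt0//.
  - by move=> i; rewrite mxE contour_gap.
  - move=> i j; rewrite mxE; case: eqVneq => _; rewrite ?mulr1n ?mulr0n.
      by rewrite /cabs normr1.
    by rewrite /cabs normr0.
  - by lra.
have -> : Res t u = invmx V *m (V *m Res t u *m invmx V) *m V.
  by rewrite !mulmxA (mulVmx uV) mul1mx (mulmxKV uV).
exact: mxleM (mxleM V1 W) V2.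
Qed.

Lemma res_expand t u : `|t| * (m.+1%:R * b) < d / 2 ->
  Res t u - Res 0 u - t%:C *: (Res 0 u *m B' *m Res 0 u) =
  (t ^+ 2)%:C *: (Res 0 u *m B' *m Res 0 u *m B' *m Res t u).
Proof.
have /andP[d0 _] := dc.
move=> tb; have ut := res_unit u tb.
have u0 : (circ c r u)%:M - (rho + (0 : R)%:C *: B') \in unitmx.
  by apply: res_unit; rewrite normr0 mul0r divr_gt0.
have At : (circ c r u)%:M - (rho + t%:C *: B') =
    ((circ c r u)%:M - (rho + (0 : R)%:C *: B')) - t%:C *: B'.
  by rewrite scale0r addr0 opprD addrA.
rewrite rmorphXn; apply: resolvent_expand (mulVmx u0) _.
exact: (etrans (congr1 (mulmx^~ (Res t u)) (esym At)) (mulmxV ut)).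
Qed.

Definition log_dd : op := invmx V *m dd_mx lam (V *m B *m invmx V) *m V.

Lemma diag_sandwich (s s' : 'I_m.+1 -> C) (X : op) i j :
  (diag_mx (\row_i s i) *m X *m diag_mx (\row_i s' i)) i j = s i * X i j * s' j.
Proof. by rewrite mul_mx_diag mxE mul_diag_mx !mxE. Qed.

(** The first-order term of the integrand in the eigenbasis; the factors [lam i != 0] come from [P],
    which commutes with the unperturbed resolvent. *)
Let S (u : R) : op := (clog (circ c r u) * circ' r u) *:
  (diag_mx (\row_i ((lam i != 0)%:R * (circ c r u - (lam i)%:C)^-1)) *m
    (V *m B *m invmx V) *m
   diag_mx (\row_i ((lam i != 0)%:R * (circ c r u - (lam i)%:C)^-1))).

Lemma res0E u : Res 0 u = eigdiag (fun i => (circ c r u - (lam i)%:C)^-1).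
Proof.
have /andP[d0 _] := dc.
rewrite scale0r addr0 -(eigdiag_cst (circ c r u)) eigdiagB eigdiag_inv// => i.
rewrite -normr_eq0 cabsE (inj_eq (@complexI _) _ 0) lt0r_neq0//.
by apply: lt_le_trans (contour_gap u i); rewrite divr_gt0.
Qed.

Lemma SE u : (clog (circ c r u) * circ' r u) *: (P *m (Res 0 u *m B' *m Res 0 u) *m P) =
  invmx V *m S u *m V.
Proof.
pose s i : C := (lam i != 0)%:R * (circ c r u - (lam i)%:C)^-1.
have e1 : P *m Res 0 u *m P = eigdiag s.
  rewrite res0E !eigdiagM; apply: eq_eigdiag => i; rewrite /s mulrAC -natrM mulnb andbb.
  by [].
have -> : P *m (Res 0 u *m B' *m Res 0 u) *m P = eigdiag s *m B *m eigdiag s.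
  by rewrite -e1 compBE !mulmxA.
rewrite /S -scalemxAr -scalemxAl; congr (_ *: _).
by rewrite !eigdiagE !mulmxA.
Qed.

Lemma S_integral : mxintegrable `[0, 2 * pi] S /\
  mxint `[0, 2 * pi] S = ((2 * pi)%:C * 'i%C) *: dd_mx lam (V *m B *m invmx V).
Proof.
have m02 : measurable (`[0, 2 * pi]%classic : set (measurableTypeR R)) by exact: measurable_itv.
set BB := V *m B *m invmx V.
have H i j : cintegrable `[0, 2 * pi] (fun u => S u i j) /\
    cint `[0, 2 * pi] (fun u => S u i j) =
      ((2 * pi)%:C * 'i%C) * dd_mx lam BB i j.
  pose g u := clog (circ c r u) *
    ((circ c r u - (lam i)%:C)^-1 * (circ c r u - (lam j)%:C)^-1) * circ' r u.
  have E : (fun u => S u i j) = fun u => ((lam i != 0)%:R * (lam j != 0)%:R * BB i j) * g u.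
    have alg (x y k e f g' h : C) : x * y * (e * f * k * (g' * h)) =
      e * g' * k * (x * (f * h) * y) by ring.
    by apply/funext => u; rewrite /S mxE diag_sandwich; exact: alg.
  rewrite E [dd_mx _ _ _ _]mxE.
  have [z|] := boolP ((lam i == 0) || (lam j == 0)).
    have -> : (lam i != 0)%:R * (lam j != 0)%:R * BB i j = 0 :> C.
      by case/orP: z => ->; rewrite ?mulr0 ?mul0r.
    have -> : (fun u => 0 * g u) = fun=> 0 by apply/funext => u; rewrite mul0r.
    by rewrite mulr0; split; [exact: cintegrable0|exact: cint0].
  rewrite negb_or => /andP[li lj]; rewrite li lj !mul1r.
  have ci u := circ_punctured u radius_ok (lam_disc li).
  have cj u := circ_punctured u radius_ok (lam_disc lj).
  pose U := punctured (lam i)%:C `&` punctured (lam j)%:C.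
  have Ui : U `<=` punctured (lam i)%:C by move=> z [].
  have Uj : U `<=` punctured (lam j)%:C by move=> z [].
  have Ur : U `<=` @right_half R by move=> z [[]].
  have h := holomorphic_onM (holomorphic_onS Ur (@holomorphic_on_clog R))
    (holomorphic_onM (holomorphic_onS Ui (holomorphic_on_XsubV (lam i)%:C))
      (holomorphic_onS Uj (holomorphic_on_XsubV (lam j)%:C))).
  have I := oint_integrable h (fun u => conj (ci u) (cj u)).
  have := oint_clog_dd radius_ok (lam_disc li) (lam_disc lj); rewrite /oint => Eo.
  split; first exact: (cintegrableZ m02).
  by rewrite (cintZ m02 _ I) Eo; ring.
split=> [i j|]; first exact: (H i j).1.
by apply/matrixP => i j; rewrite mxE (H i j).2 [RHS]mxE.
Qed.

Lemma clog_bounded : exists2 K, 0 <= K &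
  forall u, u \in `[0, 2 * pi] -> cabs (clog (circ c r u) * circ' r u) <= K.
Proof.
have /andP[r0 rc] := radius_ok.
have cf u : ccontinuous_at (fun u => clog (circ c r u) * circ' r u) u.
  apply: ccontinuousM; last exact: ccontinuous_circ'.
  apply: ccontinuous_clog; last exact: ccontinuous_circ.
  by move=> t; apply: circ_Re_gt0; rewrite gtr0_norm.
have bnd (g : R -> R) : continuous g ->
    exists2 K, 0 <= K & forall u, u \in `[0, 2 * pi] -> `|g u| <= K.
  move=> cg; have := continuous_compact (continuous_subspaceT cg)
    (@segment_compact R 0 (2 * pi)).
  move=> /compact_bounded [M [_ HM]]; exists (`|M| + 1) => [|u uI].
    by rewrite addr_ge0.
  apply: (HM (`|M| + 1)); first by rewrite ltr_pwDr// ler_norm.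
  by exists u.
have [K1 K10 H1] := bnd _ (fun u => (cf u).1).
have [K2 K20 H2] := bnd _ (fun u => (cf u).2).
exists (K1 + K2) => [|u uI]; first by rewrite addr_ge0.
by apply: le_trans (cabs_le _) _; apply: lerD; [exact: H1|exact: H2].
Qed.

(** The circle does not move with [t], so the exact expansion of the resolvent can be integrated
    term by term, leaving t^2 times the integral of a uniformly bounded function. *)
Lemma cauchy_log_quadratic : exists2 t0, 0 < t0 & exists K, forall t i j, `|t| < t0 ->
  contour_ok P (rho + t%:C *: B) c r /\
  cabs (cauchy_log P (rho + t%:C *: B) c r i j - cauchy_log P (rho + (0 : R)%:C *: B) c r i j
    - t%:C * log_dd i j) <= K * t ^+ 2.
Proof.
have /andP[d0 _] := dc.
have m02 : measurable (`[0, 2 * pi]%classic : set (measurableTypeR R)) by exact: measurable_itv.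
have b0 : 0 <= b by apply: le_trans (Btb 0 0); exact: cabs_ge0.
have mb : 0 < 4 * (m.+1%:R * b + 1) by rewrite mulr_gt0// ltr_wpDl// mulr_ge0.
have [K1 K10 HK1] := res_bound; have [K2 K20 HK2] := clog_bounded.
have [p p0 Hp] := mxle_exists P; have [q q0 Hq] := mxle_exists B'.
(* Below this threshold |t| (m + 1) b < d / 4, as the resolvent bound requires; the added 1 keeps
   the denominator positive when [b = 0]. *)
exists (d / (4 * (m.+1%:R * b + 1))); first by rewrite divr_gt0.
pose mm : R := m.+1%:R.
(* Bounds the entries of P Res(0) B' Res(0) B' Res(t) P; each product costs a factor m + 1. *)
pose K3 := mm * (mm * (p * (mm * (mm * (mm * (mm * (K1 * q) * K1) * q) * K1))) * p).
pose k : C := ((2 * pi)%:C * 'i%C)^-1.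
exists (cabs k * (4 * pi * (K2 * K3))) => t i j.
rewrite ltr_pdivlMr// => tt.
have tb : `|t| * (m.+1%:R * b) < d / 4.
  by have := normr_ge0 t; lra.
have tb2 : `|t| * (m.+1%:R * b) < d / 2 by lra.
have z2 : `|0 : R| * (m.+1%:R * b) < d / 2 by rewrite normr0 mul0r divr_gt0.
have z4 : `|0 : R| * (m.+1%:R * b) < d / 4 by rewrite normr0 mul0r divr_gt0.
split; first exact: contour_ok_near.
have [SI SE'] := S_integral.
have [VI VE] := mxintegrable_mul m02 (invmx V) V SI.
pose F t u := log_res P (rho + t%:C *: B) i j (circ c r u) * circ' r u.
pose G u := (invmx V *m S u *m V) i j.
have FI t' : `|t'| * (m.+1%:R * b) < d / 2 -> cintegrable `[0, 2 * pi] (F t').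
  by move=> h; apply: oint_log_res; [exact: proj_idem|exact: contour_ok_near].
have GI : cintegrable `[0, 2 * pi] G by exact: VI.
have kdd : log_dd i j = k * cint `[0, 2 * pi] G.
  have -> : cint `[0, 2 * pi] G = (mxint `[0, 2 * pi] (fun u => invmx V *m S u *m V)) i j.
    by rewrite mxE.
  have e2 (a : C) (X : op) : (a *: X) i j = a * X i j by rewrite mxE.
  rewrite VE SE' -scalemxAr -scalemxAl e2 mulrA mulVf ?mul1r//.
  have pi0 : (2 * pi)%:C != 0 :> C.
    by rewrite (inj_eq (@complexI _) _ 0) lt0r_neq0// mulr_gt0// pi_gt0.
  by rewrite mulf_neq0// eq_complex /= oner_eq0 andbF.
have cE t' : cauchy_log P (rho + t'%:C *: B) c r i j = k * cint `[0, 2 * pi] (F t').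
  exact: cauchy_log_entry.
have Rm u : F t u + (-1) * F 0 u + (- t%:C) * G u = (t ^+ 2)%:C * ((clog (circ c r u) * circ' r u) *
    (P *m (Res 0 u *m B' *m Res 0 u *m B' *m Res t u) *m P) i j).
  have e2 (a : C) (X : op) : (a *: X) i j = a * X i j by rewrite mxE.
  have FE t' : F t' u = clog (circ c r u) * (P *m Res t' u *m P) i j * circ' r u.
    by rewrite /F /log_res compress_affine.
  have GE : G u = clog (circ c r u) * circ' r u * (P *m (Res 0 u *m B' *m Res 0 u) *m P) i j.
    exact: (etrans (congr1 (fun X : op => X i j) (esym (SE u))) (e2 _ _)).
  have alg (y1 y2 X1 X2 X3 X4 t' s : C) : X1 - X2 - t' * X3 = s * X4 ->
      y1 * X1 * y2 + (-1) * (y1 * X2 * y2) + (- t') * (y1 * y2 * X3) = s * (y1 * y2 * X4).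
    by move=> e; rewrite [s * _]mulrCA -e; ring.
  by rewrite (FE t) (FE 0) GE; exact: alg (compress_entry P i j (res_expand u tb2)).
have I1 := cintegrableZ m02 (-1) (FI 0 z2).
have I2 := cintegrableZ m02 (- t%:C) GI.
have I12 := cintegrableD m02 (FI t tb2) I1.
have -> : cauchy_log P (rho + t%:C *: B) c r i j - cauchy_log P (rho + (0 : R)%:C *: B) c r i j
    - t%:C * log_dd i j =
    k * cint `[0, 2 * pi] (fun u => F t u + (-1) * F 0 u + (- t%:C) * G u).
  have alg2 (a0 a1 a2 t' x y z : C) : a0 = k * x -> a1 = k * y -> a2 = k * z ->
      a0 - a1 - t' * a2 = k * (x + (-1) * y + (- t') * z).
    by move=> -> -> ->; ring.
  apply: etrans (alg2 _ _ _ _ _ _ _ (cE t) (cE 0) kdd) _.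
  apply: (congr1 ( *%R k)); apply: esym.
  apply: etrans (cintD m02 I12 I2) _; apply: congr2; last exact: (cintZ m02 _ GI).
  apply: etrans (cintD m02 (FI t tb2) I1) _; apply: congr2; first by [].
  exact: (cintZ m02 _ (FI 0 z2)).
have I := cintegrableD m02 I12 I2.
rewrite cabsM -[X in _ <= X]mulrA; apply: ler_wpM2l; first exact: cabs_ge0.
rewrite -[X in _ <= X]mulrA; apply: cint_bound I _ => u uI.
rewrite Rm cabsM cabs_real ger0_norm ?sqr_ge0// mulrC.
apply: ler_wpM2r; first exact: sqr_ge0.
rewrite cabsM; apply: ler_pM; [exact: cabs_ge0|exact: cabs_ge0|exact: HK2|].
have R0 := HK1 0 u z4; have Rt := HK1 t u tb.
exact: (mxleM (mxleM Hp (mxleM (mxleM (mxleM (mxleM R0 Hq) R0) Hq) Rt)) Hp i j).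
Qed.

End Contour.

(** [mxlog_on] may choose a different circle for each [t]; independence of the contour replaces all
    of them near 0 by the fixed one. *)
Lemma is_derive_mxlog i j :
  is_derive (0 : R) (1 : R) (fun t => Re (mxlog_on P (rho + t%:C *: B) i j)) (Re (log_dd i j)) /\
  is_derive (0 : R) (1 : R) (fun t => Im (mxlog_on P (rho + t%:C *: B) i j)) (Im (log_dd i j)).
Proof.
have [d [c [dc dlam lamc]]] := spectral_gap.
have [b _ Btb] := mxle_exists Bt.
have [t0 t00 [K H]] := cauchy_log_quadratic dc dlam lamc Btb.
have H' t : `|t| < t0 -> cabs (mxlog_on P (rho + t%:C *: B) i j -
    mxlog_on P (rho + (0 : R)%:C *: B) i j - t%:C * log_dd i j) <= K * t ^+ 2.
  move=> tt; have [ok h] := H t i j tt.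
  have z0 : `|0 : R| < t0 by rewrite normr0.
  have [ok0 _] := H 0 i j z0.
  by rewrite (mxlog_onE proj_idem ok) (mxlog_onE proj_idem ok0).
split; apply: (is_derive_quadratic t00) => t /H' h.
- apply: le_trans (le_trans (cabs_Re_Im _).1 h).
  by rewrite !(cReD, cReN, cReM) /= mul0r subr0.
- apply: le_trans (le_trans (cabs_Re_Im _).2 h).
  by rewrite !(cImD, cImN, cImM) /= mul0r addr0.
Qed.

End EigenbasisLog.


(** * Comparison of the twirled powers with the derivative of the logarithm *)

Theorem mainTheorem5 (R : realType) (n m : nat)
    (Ma Mcode : {aspace 'M[R[i]]_n.+1}) (MA Mcft : {aspace 'M[R[i]]_m.+1})
    (J : 'M[R[i]]_n.+1 -> 'M[R[i]]_m.+1) (sigma : 'M[R[i]]_n.+1)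
    (vNa : is_vN Ma) (vNcode : is_vN Mcode) (vNA : is_vN MA)
    (vNcft : is_vN Mcft)
    (sub_a : (Ma <= Mcode)%VS) (sub_A : (MA <= Mcft)%VS)
    (channelJ : is_channel Mcode Mcft J)
    (state_sigma : is_state Ma sigma) (sigma_full : sigma \in unitmx)
    (sigma_mixed : state_ext sigma = maxmixed R n)
    (phi : 'M[R[i]]_n.+1) (phi_a : phi \in Ma) :
  [/\ Rstar MA J sigma phi =
        (dimH R n)^-1 *: mxint setT (fun t : R =>
          (beta0 t)%:C *:
            (expH ((1 - 'i%C * t%:C) / 2) (restr MA (J (maxmixed R n))) *m
             restr MA (J phi) *m
             expH ((1 + 'i%C * t%:C) / 2) (restr MA (J (maxmixed R n))))),
      mxderivable (fun t : R => logJ MA J (maxmixed R n + t%:C *: phi)) 0,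
      Rstar MA J sigma phi = (dimH R n)^-1 *:
        mxderive (fun t : R => logJ MA J (maxmixed R n + t%:C *: phi)) 0,
      mxderivable (fun t : R => HA MA J (maxmixed R n + t%:C *: phi)) 0 &
      Rstar MA J sigma phi = - ((dimH R n)^-1 *:
        mxderive (fun t : R => HA MA J (maxmixed R n + t%:C *: phi)) 0)].

Proof.
have sE : sigma = maxmixed R n by exact: sigma_mixed.
have tauM : maxmixed R n \in Mcode by rewrite maxmixedE -scalemx1 rpredZ//; case: vNcode.
have phiM : phi \in Mcode by exact: (subvP sub_a).
have ptau : psd (maxmixed R n) by rewrite maxmixedE; exact: psd_scalar (ltW (dimV_gt0 R n)).
have pJ := channel_psd channelJ tauM ptau.
pose rho := restr MA (J (maxmixed R n)); pose B := restr MA (J phi).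
pose lam i := Re (spectral_diag rho 0 i).
(* Positivity of the maximally mixed state passes through the channel and then through the
   restriction to the subalgebra. *)
have s0 i : 0 <= spectral_diag rho 0 i by exact: restr_spectral_ge0.
have lamE i : spectral_diag rho 0 i = (lam i)%:C.
  by apply: complexP => //=; exact: ger0_Im (s0 i).
have l0 i : 0 <= lam i by rewrite -ler0c -lamE.
have nrho : rho \is normalmx.
  by apply: hermitian_normal; apply: restr_adj => //; exact: psd_hermitian.
have uV := spectral_unit rho.
have rhoE : rho = eigdiag (spectralmx rho) (fun i => (lam i)%:C).
  rewrite eigdiagE {1}(orthomx_spectralP nrho).
  have -> : spectral_diag rho = \row_i (lam i)%:C by apply/rowP => i; rewrite lamE mxE.
  by [].
have PE : supp rho = eigdiag (spectralmx rho) (fun i => (lam i != 0)%:R).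
  rewrite eigdiagE /supp /specfun.
  have -> : map_mx (fun x : R[i] => (x != 0)%:R : R[i]) (spectral_diag rho) =
     \row_i (lam i != 0)%:R.
    by apply/rowP => i; rewrite !mxE lamE (inj_eq (@complexI _) _ 0).
  by [].
(* Linearity of the channel on [Mcode] and of the restriction turns the perturbed state into the
   affine family rho + t B, seen in the eigenbasis of rho. *)
have logE t : logJ MA J (maxmixed R n + t%:C *: phi) =
    mxlog_on (eigdiag (spectralmx rho) (fun i => (lam i != 0)%:R))
      (eigdiag (spectralmx rho) (fun i => (lam i)%:C) + t%:C *: B).
  rewrite /logJ -/rho PE -rhoE; congr (mxlog_on _ _).
  by rewrite addrC (channel_linear channelJ)// restr_linear// addrC.
have dlog := is_derive_mxlog uV l0 B.
have mT : measurable (setT : set (measurableTypeR R)) by exact: measurableT.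
have [FI FE] := mxint_expH B l0 lamE.
pose L := log_dd (spectralmx rho) lam B.
have RE : Rstar MA J sigma phi = (dimH R n)^-1 *: mxint setT (fun t : R =>
    (beta0 t)%:C *: (expH ((1 - 'i%C * t%:C) / 2) rho *m B *m
      expH ((1 + 'i%C * t%:C) / 2) rho)).
  rewrite dimHV -(mxintZ mT _ FI) /Rstar sE; apply: eq_mxint => t _.
  (* The exponents (1 - i t) / 2 and (1 + i t) / 2 add up to 1, so the powers of [sigma] leave the
     scalar 1 / d, which is pulled through the channel and the restriction. *)
  rewrite /state_ext expH_maxmixed; last by field.
  rewrite (channelZ _ channelJ phiM) restrZ//.
  by rewrite -/rho -/B -scalemxAr -scalemxAl !scalerA mulrC.
have RL : Rstar MA J sigma phi = (dimH R n)^-1 *: L by rewrite RE FE.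
have dRe i j : is_derive (0 : R) (1 : R)
    (fun t : R => Re (logJ MA J (maxmixed R n + t%:C *: phi) i j)) (Re (L i j)).
  rewrite (_ : (fun t : R => _) = (fun t => Re (mxlog_on
    (eigdiag (spectralmx rho) (fun i => (lam i != 0)%:R))
    (eigdiag (spectralmx rho) (fun i => (lam i)%:C) + t%:C *: B) i j))).
    exact: (dlog i j).1.
  by apply/funext => t; rewrite logE.
have dIm i j : is_derive (0 : R) (1 : R)
    (fun t : R => Im (logJ MA J (maxmixed R n + t%:C *: phi) i j)) (Im (L i j)).
  rewrite (_ : (fun t : R => _) = (fun t => Im (mxlog_on
    (eigdiag (spectralmx rho) (fun i => (lam i != 0)%:R))
    (eigdiag (spectralmx rho) (fun i => (lam i)%:C) + t%:C *: B) i j))).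
    exact: (dlog i j).2.
  by apply/funext => t; rewrite logE.
have HRe i j : is_derive (0 : R) (1 : R)
    (fun t : R => Re (HA MA J (maxmixed R n + t%:C *: phi) i j)) (- Re (L i j)).
  rewrite (_ : (fun t : R => _) =
    - (fun t : R => Re (logJ MA J (maxmixed R n + t%:C *: phi) i j))).
    exact: is_deriveN.
  by apply/funext => t; rewrite /HA mxE cReN.
have HIm i j : is_derive (0 : R) (1 : R)
    (fun t : R => Im (HA MA J (maxmixed R n + t%:C *: phi) i j)) (- Im (L i j)).
  rewrite (_ : (fun t : R => _) =
    - (fun t : R => Im (logJ MA J (maxmixed R n + t%:C *: phi) i j))).
    exact: is_deriveN.
  by apply/funext => t; rewrite /HA mxE cImN.
have DL : mxderive (fun t : R => logJ MA J (maxmixed R n + t%:C *: phi)) 0 = L.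
  apply/matrixP => i j; rewrite mxE; apply: complexP => /=.
    by case: (dRe i j).
  by case: (dIm i j).
have DH : mxderive (fun t : R => HA MA J (maxmixed R n + t%:C *: phi)) 0 = - L.
  apply/matrixP => i j; rewrite mxE [in RHS]mxE; apply: complexP; rewrite ?cReN ?cImN /=.
    by case: (HRe i j).
  by case: (HIm i j).
split.
- exact: RE.
- by move=> i j; split; [case: (dRe i j)|case: (dIm i j)].
- by rewrite DL.
- by move=> i j; split; [case: (HRe i j)|case: (HIm i j)].
- by rewrite DH scalerN opprK.
Qed.
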